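(* Assume: (A1) $\sup_{i,j}\|X_{ij}\|=O(\sqrt{p_n})$; (A2) the unknown parameter $\beta_n$ belongs to a compact subset $\mathcal{B}\subseteq\mathbb{R}^{p_n}$, the true value $\beta_{n0}$ lies in the interior of $\mathcal{B}$, and there are constants $b_1,b_2$ (not depending on $n$) with $0<b_1\le\pi_{ij}(\beta_{n0})\le b_2<1$ for all $i,j$; (A3) there are positive constants $b_3,b_4$ with $b_3\le\lambda_{\min}\big(n^{-1}\sum_{i=1}^nX_i^TX_i\big)\le\lambda_{\max}\big(n^{-1}\sum_{i=1}^nX_i^TX_i\big)\le b_4$; (A4) the common true correlation matrix $R_0$ has eigenvalues bounded away from $0$ and $+\infty$, and the estimated working correlation matrix $\widehat R$ satisfies $\|\widehat R^{-1}-\overline R^{-1}\|=O_p(\sqrt{p_n/n})$, where $\overline R$ is a constant positive definite matrix with eigenvalues bounded away from $0$ and $+\infty$ ($\overline R$ is not required to equal $R_0$). Let $\widehat\beta_n$ be the GEE estimator, i.e. a root of $S_n(\beta_n)=0$ with $\|\widehat\beta_n-\beta_{n0}\|=O_p(\sqrt{p_n/n})$. Let $L_n$ be an $l\times p_n$ matrix with $l$ fixed and $L_nL_n^T=I_l$, and let $$W_n=(L_n\widehat\beta_n)^T(L_n\widehat\Sigma_nL_n^T)^{-1}(L_n\widehat\beta_n)$$ be the Wald statistic for testing $H_0: L_n\beta_{n0}=0$ versus $H_1: L_n\beta_{n0}\ne0$. If $n^{-1}p_n^3=o(1)$, then under $H_0$, $W_n\to\chi^2_l$ in distribution, where $\chi_l^2$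 denotes the chi-square distribution with $l$ degrees of freedom.
   Context: Setting: the number of clusters $n\to\infty$, the cluster size $m<\infty$ is a fixed integer, and the number of covariates $p_n\to\infty$ as $n\to\infty$. For each $n$, each cluster $i=1,\dots,n$ and each $j=1,\dots,m$, one observes a binary response $Y_{ij}\in\{0,1\}$ and a covariate vector $X_{ij}\in\mathbb{R}^{p_n}$ (covariates are treated as fixed: all moments and probabilities are conditional on them; dependence on $n$ is suppressed). $Y_i=(Y_{i1},\dots,Y_{im})^T$, and $X_i=(X_{i1},\dots,X_{im})^T$ is the $m\times p_n$ matrix with rows $X_{ij}^T$. $Y_1,\dots,Y_n$ are independent; components of one $Y_i$ may be dependent. For $\beta\in\mathbb{R}^{p_n}$ let $\pi_{ij}(\beta)=\exp(X_{ij}^T\beta)/[1+\exp(X_{ij}^T\beta)]$ and $\pi_i(\beta)=(\pi_{i1}(\beta),\dots,\pi_{im}(\beta))^T$. The true parameter $\beta_{n0}$ satisfies $E(Y_{ij})=\pi_{ij}(\beta_{n0})$, hence $\mathrm{Var}(Y_{ij})=\pi_{ij}(\beta_{n0})(1-\pi_{ij}(\beta_{n0}))$. All $Y_i$ have the same $m\times m$ true correlation matrix $R_0$. $A_i(\beta)$ is the $m\times m$ diagonal matrix with $j$th diagonal entry $A_{ij}(\beta)=\pi_{ij}(\beta)(1-\pi_{ij}(\beta))$, and $\varepsilon_i(\beta)=A_i^{-1/2}(\beta)(Y_i-\pi_i(\beta))$. $\widehat R$ is an estimated $m\times m$ working correlation matrix (random, and not depending on the argument $\beta_n$ of the estimating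 function). Define $$S_n(\beta_n)=\sum_{i=1}^nX_i^TA_i^{1/2}(\beta_n)\widehat R^{-1}A_i^{-1/2}(\beta_n)\big(Y_i-\pi_i(\beta_n)\big),$$ $$\widehat M_n(\beta_n)=\sum_{i=1}^nX_i^TA_i^{1/2}(\beta_n)\widehat R^{-1}\varepsilon_i(\beta_n)\varepsilon_i^T(\beta_n)\widehat R^{-1}A_i^{1/2}(\beta_n)X_i,\qquad H_n(\beta_n)=\sum_{i=1}^nX_i^TA_i^{1/2}(\beta_n)\widehat R^{-1}A_i^{1/2}(\beta_n)X_i,$$ and the sandwich covariance matrix estimator $\widehat\Sigma_n=H_n^{-1}(\widehat\beta_n)\widehat M_n(\widehat\beta_n)H_n^{-1}(\widehat\beta_n)$. $I_l$ is the $l\times l$ identity. $\|\cdot\|$ is the Euclidean norm for vectors and the Frobenius norm for matrices; $\lambda_{\min},\lambda_{\max}$ denote smallest and largest eigenvalues. *)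

(* Defs.v *)
From HB Require Import structures.
From mathcomp Require Import all_boot all_order all_algebra.
From mathcomp Require Import all_classical all_reals all_analysis.

Set Implicit Arguments.
Unset Strict Implicit.
Unset Printing Implicit Defensive.

Import Order.TTheory GRing.Theory Num.Theory.
Import numFieldNormedType.Exports.

Local Open Scope classical_set_scope.
Local Open Scope ring_scope.

Section Matrices.
Context {R : realType}.

(* The library norm on matrices is the sup norm; this is the Frobenius norm,
   which is the Euclidean norm on row and column vectors. *)
Definition frobenius (a b : nat) (A : 'M[R]_(a, b)) : R :=
  Num.sqrt (\sum_i \sum_j A i j ^+ 2).

(* Only used for symmetric matrices, whose spectrum is real. *)
Definition lambda_min (a : nat) (A : 'M[R]_a) : R := inf [set x | eigenvalue A x].
Definition lambda_max (a : nat) (A : 'M[R]_a) : R := sup [set x | eigenvalue A x].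

Definition posdef (a : nat) (A : 'M[R]_a) : Prop :=
  A^T = A /\ forall v : 'cV[R]_a, v != 0 -> 0 < (v^T *m A *m v) 0 0.

End Matrices.

Section Probability.
Context {R : realType}.

Definition measurable_mx d (T : measurableType d) (a b : nat)
    (A : T -> 'M[R]_(a, b)) : Prop :=
  forall i j, measurable_fun [set: T] (fun w => A w i j).

Definition correlation d (T : measurableType d) (P : probability T R)
    (U V : T -> R) : R :=
  fine (covariance P U V) /
  (Num.sqrt (fine 'V_P[U]) * Num.sqrt (fine 'V_P[V])).

(* Mutual independence of the random vectors (Y i j)_j, i < n. *)
Definition independent_vectors d (T : measurableType d) (P : probability T R)
    (n m : nat) (Y : 'I_n -> 'I_m -> T -> R) : Prop :=
  forall (J : {set 'I_n}) (E : 'I_n -> set T),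
    (forall i, i \in J -> g_sigma_preimage (Y i) (E i)) ->
    P (\bigcap_(i in [set` J]) E i) = (\prod_(i in J) P (E i))%E.

(* Below, P n lives on its own sample space T n (triangular array). *)

Definition with_prob_to1 (d : nat -> measure_display)
    (T : forall n, measurableType (d n)) (P : forall n, probability (T n) R)
    (E : forall n, set (T n)) : Prop :=
  P n (E n) @[n --> \oo] --> 1%E.

(* U n = O_p(a n). *)
Definition bigOp (d : nat -> measure_display)
    (T : forall n, measurableType (d n)) (P : forall n, probability (T n) R)
    (U : forall n, T n -> R) (a : nat -> R) : Prop :=
  forall e : R, 0 < e -> exists2 K : R, 0 < K &
    \forall n \near \oo, (P n [set w | (K * a n < `|U n w|)%R] <= e%:E)%E.

(* Convergence of distribution functions at the continuity points of the
   limit. *)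
Definition cvg_in_distribution (d : nat -> measure_display)
    (T : forall n, measurableType (d n)) (P : forall n, probability (T n) R)
    (W : forall n, T n -> R) (mu : set R -> \bar R) : Prop :=
  forall x : R, {for x, continuous (fun t : R => mu [set s | s <= t])} ->
    P n [set w | W n w <= x] @[n --> \oo] --> mu [set s | s <= x].

(* Law of Z_1^2 + ... + Z_l^2 with Z_1, ..., Z_l independent N(0, 1): by
   Fubini, P (Z_1^2 + S \in B) is the integral of P (z^2 + S \in B) over the
   law of Z_1 when S is independent of Z_1. *)
Fixpoint chi_square (l : nat) (B : set R) : \bar R :=
  match l with
  | 0%N => \d_(0 : R) B
  | k.+1 => (\int[normal_prob (0 : R) 1]_z
              chi_square k [set s : R | B ((z : R) ^+ 2 + s)%R])%E
  end.

End Probability.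

Section GEE.
Context {R : realType} (m p : nat).
Implicit Types (X : 'M[R]_(m, p)) (b : 'cV[R]_p) (y : 'cV[R]_m).

(* X is the covariate matrix of one cluster, y its response vector; row j X
   is the transpose of X_ij. *)
Definition gee_pi X b : 'cV[R]_m :=
  \col_j (expR ((row j X *m b) 0 0) / (1 + expR ((row j X *m b) 0 0))).

Definition gee_var X b : 'rV[R]_m :=
  \row_j (gee_pi X b j 0 * (1 - gee_pi X b j 0)).

(* A_i^{1/2} and A_i^{-1/2} *)
Definition gee_Ahalf X b : 'M[R]_m := diag_mx (map_mx Num.sqrt (gee_var X b)).
Definition gee_Anhalf X b : 'M[R]_m :=
  diag_mx (map_mx (fun a => (Num.sqrt a)^-1) (gee_var X b)).

Definition gee_eps X y b : 'cV[R]_m := gee_Anhalf X b *m (y - gee_pi X b).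

Section Sample.
Context (n : nat) (X : 'I_n -> 'M[R]_(m, p)) (Y : 'I_n -> 'cV[R]_m).
Context (Rh : 'M[R]_m).

Definition gee_S (b : 'cV[R]_p) : 'cV[R]_p :=
  \sum_i (X i)^T *m gee_Ahalf (X i) b *m invmx Rh *m gee_Anhalf (X i) b
         *m (Y i - gee_pi (X i) b).

Definition gee_M (b : 'cV[R]_p) : 'M[R]_p :=
  \sum_i (X i)^T *m gee_Ahalf (X i) b *m invmx Rh
         *m gee_eps (X i) (Y i) b *m (gee_eps (X i) (Y i) b)^T
         *m invmx Rh *m gee_Ahalf (X i) b *m X i.

Definition gee_H (b : 'cV[R]_p) : 'M[R]_p :=
  \sum_i (X i)^T *m gee_Ahalf (X i) b *m invmx Rh *m gee_Ahalf (X i) b *m X i.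

Definition gee_sandwich (b : 'cV[R]_p) : 'M[R]_p :=
  invmx (gee_H b) *m gee_M b *m invmx (gee_H b).

Definition gee_wald (l : nat) (L : 'M[R]_(l, p)) (b : 'cV[R]_p) : R :=
  ((L *m b)^T *m invmx (L *m gee_sandwich b *m L^T) *m (L *m b)) 0 0.

End Sample.
End GEE.

(* Main.v *)
Require Import Defs.
From HB Require Import structures.
From mathcomp Require Import all_boot all_order all_algebra.
From mathcomp Require Import all_classical all_reals all_analysis.
From mathcomp Require Import measurable_realfun.
From mathcomp Require Import complex.
From mathcomp Require Import ring lra.

Set Implicit Arguments.
Unset Strict Implicit.
Unset Printing Implicit Defensive.

Import Order.TTheory GRing.Theory Num.Theory.
Import numFieldNormedType.Exports.

Local Open Scope classical_set_scope.
Local Open Scope ring_scope.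

(** The Wald statistic is asymptotically a squared length of a sum of independent
vectors, for the following reason. Let H be the information matrix at the true
parameter with the limiting working correlation. Under the null hypothesis the
contrast L betahat equals L delta, where delta is the estimation error, and for
z solving H z = (row of L)^T this is the pairing of z with H delta. Expanding
S(betahat) = 0 in the direction z identifies that pairing with the pairing of z
with the score S(beta0), a sum over the clusters of independent centred terms,
up to errors of order sqrt (p^3 / n) ([gee_linearization]). In the same
directions, the sandwich estimator is a sum of squared contributions of the
clusters, and the law of large numbers brings it to the covariance of the score
([gee_sandwich_close]), whatever the limiting working correlation. Since the
Wald statistic is unchanged when L is multiplied on the left by an invertible
matrix, the directions can be chosen so that this covariance is the identity
([gee_normalizer]); the statistic is then within O(sqrt (p^3 / n)) of the
squared length |U|^2 of the normalized score, on an event of probability close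
to 1 ([gee_wald_close], [gee_wald_approx]).

The dimension p enters only through the directions z, the estimation error and
the design norm: the random sums are either scalars attached to one direction z,
or vectors of length p paired with the estimation error, and their second
moments suffice ([random_terms]).

The limit law of |U|^2 comes from its Laplace transform. The responses are
binary, so the sample has a finite product law ([prob_outcome]) and expectations
are finite sums. Characteristic functions of linear
combinations of U converge by Lindeberg's comparison ([pexp_cos_gauss]). The
Gaussian identity exp(- s u^2) = E cos(sqrt(2 s) u g) turns them, one
coordinate at a time, into the Laplace transform of |U|^2
([cvg_array_laplace_partial]), whose limit is (1 + 2 s)^(- l/2), that of the
chi-square law. Polynomials in exp(- s) approximating a step function convert
this into convergence of distribution functions ([array_sqnorm_cdf]), which a
perturbation tending to 0 in probability does not affect ([slutsky_cdf]). *)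

(** * Expansions of the logistic function *)

Section ScalarAnalysis.
Context {R : realType}.
Implicit Types x d t : R.

(** Integrating an inequality: applied repeatedly from 0 <= 1 - cos, it yields the
alternating Taylor bounds of sine and cosine below. *)
Lemma ge0_of_derive_ge0 (f df : R -> R) :
  (forall x, is_derive x (1 : R) f (df x)) -> f 0 = 0 ->
  (forall x, 0 <= x -> 0 <= df x) -> forall x, 0 <= x -> 0 <= f x.
Proof.
move=> fd f0 df0 x; rewrite le_eqVlt => /predU1P[<-|x0]; first by rewrite f0.
have cf : {within `[0, x], continuous f}.
  apply: continuous_subspaceT => y.
  apply: differentiable_continuous; apply/derivable1_diffP.
  by have [] := fd y.
have [c c0x] := MVT x0 (fun y _ => fd y) cf.
rewrite f0 !subr0 => ->; rewrite mulr_ge0 ?(ltW x0)// df0//.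
by move: c0x; rewrite in_itv/= => /andP[/ltW].
Qed.

Lemma sin_le_id x : 0 <= x -> sin x <= x.
Proof.
move=> x0; rewrite -subr_ge0.
apply: (@ge0_of_derive_ge0 (fun y => y - sin y) (fun y => 1 - cos y)) => //.
by rewrite sin0 subr0.
Qed.

Lemma cos_ge_taylor2 x : 0 <= x -> 1 - x ^+ 2 / 2 <= cos x.
Proof.
move=> x0; rewrite -subr_ge0.
apply: (@ge0_of_derive_ge0 (fun y => cos y - (1 - y ^+ 2 / 2))
  (fun y => y - sin y)) => //.
- move=> y; apply: is_derive_eq; rewrite !scaler0 /= /GRing.scale/=.
  by field.
- by rewrite cos0; field.
- by move=> y y0; rewrite subr_ge0 sin_le_id.
Qed.

Lemma sin_ge_taylor3 x : 0 <= x -> x - x ^+ 3 / 6 <= sin x.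
Proof.
move=> x0; rewrite -subr_ge0.
apply: (@ge0_of_derive_ge0 (fun y => sin y - (y - y ^+ 3 / 6))
  (fun y => cos y - (1 - y ^+ 2 / 2))) => //.
- move=> y; apply: is_derive_eq; rewrite !scaler0 /= /GRing.scale/=.
  by field.
- by rewrite sin0; field.
- by move=> y y0; rewrite subr_ge0 cos_ge_taylor2.
Qed.

Lemma cos_le_taylor4 x : 0 <= x -> cos x <= 1 - x ^+ 2 / 2 + x ^+ 4 / 24.
Proof.
move=> x0; rewrite -subr_ge0.
apply: (@ge0_of_derive_ge0 (fun y => 1 - y ^+ 2 / 2 + y ^+ 4 / 24 - cos y)
  (fun y => sin y - (y - y ^+ 3 / 6))) => //.
- move=> y; apply: is_derive_eq; rewrite !scaler0 /= /GRing.scale/=.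
  by field.
- by rewrite cos0; field.
- by move=> y y0; rewrite subr_ge0 sin_ge_taylor3.
Qed.

Lemma cos_taylor x : `|cos x - (1 - x ^+ 2 / 2)| <= x ^+ 4 / 24.
Proof.
wlog x0 : x / 0 <= x => [H|].
  have [/H//|/ltW x0] := leP 0 x.
  by have := H (- x); rewrite cosN sqrrN exprNn oppr_ge0 => /(_ x0);
    rewrite -signr_odd/= mul1r.
have := cos_ge_taylor2 x0; have := cos_le_taylor4 x0.
by rewrite ler_norml; lra.
Qed.

Lemma sin_taylor x : `|sin x - x| <= `|x| ^+ 3 / 6.
Proof.
wlog x0 : x / 0 <= x => [H|].
  have [/H//|/ltW x0] := leP 0 x.
  by have := H (- x); rewrite sinN oppr_ge0 => /(_ x0);
    rewrite -opprD !normrN.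
have := sin_le_id x0; have := sin_ge_taylor3 x0.
by rewrite (ger0_norm x0) ler_norml; lra.
Qed.

(** The upper bound is 1 + d <= exp d applied at - d and inverted. *)
Lemma expR_taylor d : `|d| <= 1/2 -> `|expR d - 1 - d| <= 2 * d ^+ 2.
Proof.
rewrite ler_norml => /andP[d1 d2].
have h1 := expR_ge1Dx d; have h2 := expR_ge1Dx (- d).
have h3 : expR d * expR (- d) = 1 by rewrite expRxMexpNx_1.
have h4 := expR_gt0 d.
rewrite ler_norml; have h7 := sqr_ge0 d; apply/andP; split; first lra.
have h5 : expR d * (1 - d) <= 1 by rewrite -[leRHS]h3 ler_pM2l.
have h6 : 0 < 1 - d by lra.
rewrite lerBlDr lerBlDr -(ler_pM2r h6); apply: (le_trans h5).
nra.
Qed.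

Definition logit_pi t : R := expR t / (1 + expR t).

(** When the linear predictor moves by d from a point of mean q, the standard
deviation of the response is divided by exactly this factor
([logit_var_shift]); the symmetric exponents make the mean shift a multiple of a
hyperbolic sine ([logit_pi_shift]). *)
Definition logit_g (q d : R) : R := (1 - q) * expR (- (d / 2)) + q * expR (d / 2).

Lemma logit_pi_gt0 t : 0 < logit_pi t.
Proof. by rewrite divr_gt0 ?expR_gt0// addr_gt0 ?expR_gt0. Qed.

Lemma logit_pi_lt1 t : logit_pi t < 1.
Proof.
have e0 := expR_gt0 t.
by rewrite ltr_pdivrMr ?addr_gt0// mul1r ltrDr.
Qed.

Lemma logit_g_gt0 q d : 0 <= q <= 1 -> 0 < logit_g q d.
Proof.
move=> /andP[q0 q1]; rewrite /logit_g.
have := expR_gt0 (d/2); have := expR_gt0 (- (d/2)).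
set a := expR _; set b := expR _ => a0 b0.
have [q12|q12] := leP q (1/2); nra.
Qed.

Lemma logit_var_shift t d :
  logit_pi (t + d) * (1 - logit_pi (t + d)) =
  logit_pi t * (1 - logit_pi t) / logit_g (logit_pi t) d ^+ 2.
Proof.
have h : expR d = expR (d / 2) ^+ 2 by rewrite -expRM_natl; congr expR; field.
have h' := expR_gt0 (d/2); have ht := expR_gt0 t.
rewrite /logit_g /logit_pi expRD h expRN.
set a := expR (d/2) in h' *; set b := expR t in ht *.
have h1 : 1 + b * a ^+ 2 != 0 by rewrite gt_eqF//; nra.
field.
by rewrite !gt_eqF//=; nra.
Qed.

Lemma logit_pi_shift t d :
  logit_pi (t + d) - logit_pi t =
  logit_pi t * (1 - logit_pi t) * (expR (d / 2) - expR (- (d / 2)))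
    / logit_g (logit_pi t) d.
Proof.
have h : expR d = expR (d / 2) ^+ 2 by rewrite -expRM_natl; congr expR; field.
have h' := expR_gt0 (d/2); have ht := expR_gt0 t.
rewrite /logit_g /logit_pi expRD h expRN.
set a := expR (d/2) in h' *; set b := expR t in ht *.
have h1 : 1 + b * a ^+ 2 != 0 by rewrite gt_eqF//; nra.
field.
by rewrite !gt_eqF//=; nra.
Qed.

Section Expansions.
Variables q d : R.
Hypothesis q01 : 0 <= q <= 1.
Hypothesis d2 : `|d| <= 1/2.

Let Ep : `|expR (d / 2) - 1 - d / 2| <= d ^+ 2 / 2.
Proof.
have /expR_taylor : `|d / 2| <= 1 / 2 by move: d2; rewrite !ler_norml; lra.
by rewrite (_ : 2 * (d / 2) ^+ 2 = d ^+ 2 / 2)//; field.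
Qed.

Let Em : `|expR (- (d / 2)) - 1 + d / 2| <= d ^+ 2 / 2.
Proof.
have /expR_taylor : `|- (d / 2)| <= 1 / 2 by move: d2; rewrite !ler_norml; lra.
by rewrite opprK (_ : 2 * (- (d / 2)) ^+ 2 = d ^+ 2 / 2)//; field.
Qed.

Let dsq : d ^+ 2 <= `|d| / 2.
Proof.
rewrite -[d ^+ 2]real_normK ?num_real// expr2.
have : `|d| * `|d| <= `|d| * (1/2) by rewrite ler_wpM2l.
lra.
Qed.

Lemma logit_g_taylor : `|logit_g q d - 1 - (q - 1/2) * d| <= d ^+ 2 / 2.
Proof.
have /andP[q0 q1] := q01.
have -> : logit_g q d - 1 - (q - 1/2) * d = (1 - q) * (expR (- (d / 2)) - 1 + d / 2)
   + q * (expR (d / 2) - 1 - d / 2) by rewrite /logit_g; field.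
rewrite (_ : d ^+ 2 / 2 = (1 - q) * (d ^+ 2 / 2) + q * (d ^+ 2 / 2)); last by ring.
apply: le_trans (ler_normD _ _) _; rewrite !normrM.
by apply: lerD; rewrite ger0_norm ?subr_ge0// ler_wpM2l ?subr_ge0.
Qed.

Lemma logit_g_ge : 1/2 <= logit_g q d.
Proof.
have /andP[q0 q1] := q01.
move: logit_g_taylor dsq; rewrite ler_norml => /andP[h1 h2] h3.
have h4 : `|(q - 1/2) * d| <= 1/2 * (1/2) by rewrite normrM ler_pM// ler_norml; lra.
move: h4 d2; rewrite ler_norml; lra.
Qed.

Lemma logit_g_lip : `|logit_g q d - 1| <= `|d|.
Proof.
have /andP[q0 q1] := q01.
have -> : logit_g q d - 1 = (logit_g q d - 1 - (q - 1/2) * d) + (q - 1/2) * d by ring.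
apply: le_trans (ler_normD _ _) _.
have h1 : `|(q - 1/2) * d| <= `|d| / 2.
  rewrite normrM mulrC ler_wpM2l//; rewrite ler_norml; lra.
move: logit_g_taylor dsq d2 (normr_ge0 d); lra.
Qed.

Lemma logit_gV_le : (logit_g q d)^-1 <= 2.
Proof.
have h := logit_g_ge; have h0 : 0 < logit_g q d by lra.
rewrite -(ler_pM2l h0) divff ?gt_eqF//; lra.
Qed.

Lemma logit_gV_lip : `|(logit_g q d)^-1 - 1| <= 2 * `|d|.
Proof.
have h := logit_g_ge; have h0 : 0 < logit_g q d by lra.
have -> : (logit_g q d)^-1 - 1 = (logit_g q d)^-1 * (1 - logit_g q d).
  by field; rewrite gt_eqF.
rewrite normrM (ger0_norm _) ?invr_ge0 ?(ltW h0)//.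
by rewrite ler_pM ?invr_ge0 ?(ltW h0) ?logit_gV_le// distrC logit_g_lip.
Qed.

Lemma logit_gV_taylor :
  `|(logit_g q d)^-1 - 1 + (q - 1/2) * d| <= 2 * d ^+ 2.
Proof.
have h := logit_g_ge; have h0 : 0 < logit_g q d by lra.
have /andP[q0 q1] := q01.
have -> : (logit_g q d)^-1 - 1 + (q - 1/2) * d = (logit_g q d)^-1 *
   (- (logit_g q d - 1 - (q - 1/2) * d) + (q - 1/2) * d * (logit_g q d - 1)).
  by field; rewrite gt_eqF.
rewrite normrM (ger0_norm _) ?invr_ge0 ?(ltW h0)//.
rewrite ler_pM ?invr_ge0 ?(ltW h0) ?logit_gV_le//.
apply: le_trans (ler_normD _ _) _; rewrite normrN.
have h1 : `|(q - 1/2) * d * (logit_g q d - 1)| <= d ^+ 2 / 2.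
  rewrite -[d ^+ 2]real_normK ?num_real// expr2 !normrM mulrAC mulrC.
  rewrite -mulrA ler_wpM2l// mulrC ler_pM ?logit_g_lip//.
  by rewrite ler_norml; lra.
by move: logit_g_taylor; lra.
Qed.

Lemma logit_sinh_taylor :
  `|(expR (d / 2) - expR (- (d / 2))) / logit_g q d - d| <= 4 * d ^+ 2.
Proof.
have h := logit_g_ge; have h0 : 0 < logit_g q d by lra.
have -> : (expR (d / 2) - expR (- (d / 2))) / logit_g q d - d =
  (logit_g q d)^-1 * ((expR (d / 2) - 1 - d / 2) - (expR (- (d / 2)) - 1 + d / 2)
    - d * (logit_g q d - 1)).
  by field; rewrite gt_eqF.
rewrite normrM (ger0_norm _) ?invr_ge0 ?(ltW h0)//.
have -> : 4 * d ^+ 2 = 2 * (d ^+ 2 / 2 + d ^+ 2 / 2 + d ^+ 2) by field.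
rewrite ler_pM ?invr_ge0 ?(ltW h0) ?logit_gV_le//.
apply: le_trans (ler_normB _ _) _; apply: lerD.
  by apply: le_trans (ler_normB _ _) _; apply: lerD.
by rewrite -[d ^+ 2]real_normK ?num_real// expr2 normrM ler_wpM2l// logit_g_lip.
Qed.

End Expansions.
End ScalarAnalysis.

(** * Euclidean norms, quadratic forms and spectral bounds *)

Section FiniteSums.
Context {R : realType}.

Lemma sum_sqr_ge0 (I : finType) (f : I -> R) : 0 <= \sum_i f i ^+ 2.
Proof. by apply: sumr_ge0 => i _; rewrite sqr_ge0. Qed.

Lemma cauchy_schwarz_sum (I : finType) (f g : I -> R) :
  (\sum_i f i * g i) ^+ 2 <= (\sum_i f i ^+ 2) * (\sum_i g i ^+ 2).
Proof.
set a := \sum_i f i ^+ 2; set b := \sum_i g i ^+ 2; set c := \sum_i f i * g i.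
have a0 : 0 <= a by exact: sum_sqr_ge0.
have H t s : 0 <= t ^+ 2 * a - 2 * t * s * c + s ^+ 2 * b.
  have -> : t ^+ 2 * a - 2 * t * s * c + s ^+ 2 * b
      = \sum_i (t * f i - s * g i) ^+ 2.
    rewrite /a /b /c !mulr_sumr -sumrB -big_split/=.
    by apply: eq_bigr => i _; ring.
  exact: sum_sqr_ge0.
have [a_eq0|a_neq0] := eqVneq a 0.
  have := H (b + 1) c; have := H (- (b + 1)) c; rewrite a_eq0.
  have b0 : 0 <= b by exact: sum_sqr_ge0.
  move=> h1 h2; rewrite mul0r; have := H (b + 1) c.
  by rewrite a_eq0; nra.
have ap : 0 < a by rewrite lt_neqAle eq_sym a_neq0.
have := H c a => h.
have : 0 <= a * (a * b - c ^+ 2) by move: h; rewrite (_ : _ + _ = a * (a * b - c ^+ 2))//; ring.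
by rewrite pmulr_rge0// subr_ge0.
Qed.

Definition l2 (I : finType) (f : I -> R) : R := Num.sqrt (\sum_i f i ^+ 2).

Lemma l2_ge0 (I : finType) (f : I -> R) : 0 <= l2 f.
Proof. exact: sqrtr_ge0. Qed.

Lemma l2_sqr (I : finType) (f : I -> R) : l2 f ^+ 2 = \sum_i f i ^+ 2.
Proof. by rewrite sqr_sqrtr// sum_sqr_ge0. Qed.

Lemma ler_l2P (I : finType) (f : I -> R) c : 0 <= c ->
  (l2 f <= c) = (\sum_i f i ^+ 2 <= c ^+ 2).
Proof. by move=> c0; rewrite -l2_sqr ler_pXn2r ?nnegrE ?l2_ge0. Qed.

Lemma l2_cauchy_schwarz (I : finType) (f g : I -> R) :
  `|\sum_i f i * g i| <= l2 f * l2 g.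
Proof.
rewrite -(@ler_pXn2r _ 2)// ?nnegrE ?mulr_ge0 ?l2_ge0//.
by rewrite exprMn !l2_sqr real_normK ?num_real// cauchy_schwarz_sum.
Qed.

Lemma l2_cauchy_schwarz_norm (I : finType) (f g : I -> R) :
  \sum_i `|f i| * `|g i| <= l2 f * l2 g.
Proof.
apply: le_trans (ler_norm _) _; apply: le_trans (l2_cauchy_schwarz _ _) _.
by rewrite /l2; under eq_bigr do rewrite real_normK ?num_real//;
  under [in X in _ * X <= _]eq_bigr do rewrite real_normK ?num_real//.
Qed.

Lemma le_l2 (I : finType) (f g : I -> R) :
  (forall i, `|f i| <= `|g i|) -> l2 f <= l2 g.
Proof.
move=> fg; rewrite ler_sqrt ?sum_sqr_ge0// ler_sum// => i _.
by rewrite -[_ ^+ 2]real_normK ?num_real// -[leRHS]real_normK ?num_real//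
  ler_pXn2r// nnegrE.
Qed.

Lemma l2Z (I : finType) (c : R) (f : I -> R) : 0 <= c ->
  l2 (fun i => c * f i) = c * l2 f.
Proof.
move=> c0; rewrite /l2; under eq_bigr do rewrite exprMn.
by rewrite -mulr_sumr sqrtrM ?sqr_ge0// sqrtr_sqr ger0_norm.
Qed.

End FiniteSums.

Section QuadraticForms.
Context {R : realType}.

Definition vdot n (u v : 'cV[R]_n) : R := (u^T *m v) 0 0.
Definition vnorm n (v : 'cV[R]_n) : R := l2 (fun i => v i 0).

Lemma vdotE n (u v : 'cV[R]_n) : vdot u v = \sum_i u i 0 * v i 0.
Proof. by rewrite /vdot mxE; apply: eq_bigr => i _; rewrite mxE. Qed.

Lemma vdotC n (u v : 'cV[R]_n) : vdot u v = vdot v u.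
Proof. by rewrite !vdotE; apply: eq_bigr => i _; rewrite mulrC. Qed.

Lemma vdotDr n (u v w : 'cV[R]_n) : vdot u (v + w) = vdot u v + vdot u w.
Proof. by rewrite /vdot mulmxDr mxE. Qed.

Lemma vdotBr n (u v w : 'cV[R]_n) : vdot u (v - w) = vdot u v - vdot u w.
Proof. by rewrite /vdot mulmxBr !mxE. Qed.

Lemma vdotZr n (u v : 'cV[R]_n) c : vdot u (c *: v) = c * vdot u v.
Proof. by rewrite /vdot -scalemxAr mxE. Qed.

Lemma vdotDl n (u v w : 'cV[R]_n) : vdot (u + v) w = vdot u w + vdot v w.
Proof. by rewrite ![vdot _ w]vdotC vdotDr. Qed.

Lemma vdotZl n (u v : 'cV[R]_n) c : vdot (c *: u) v = c * vdot u v.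
Proof. by rewrite ![vdot _ v]vdotC vdotZr. Qed.

Lemma vdot_mull n k (A : 'M[R]_(n, k)) (u : 'cV[R]_k) v :
  vdot (A *m u) v = vdot u (A^T *m v).
Proof. by rewrite /vdot trmx_mul mulmxA. Qed.

Lemma vdotr0 n (u : 'cV[R]_n) : vdot u 0 = 0.
Proof. by rewrite /vdot mulmx0 mxE. Qed.

Lemma mulmx_tr_entry k n (L : 'M[R]_(k, n)) (A : 'M[R]_n) a b :
  (L *m A *m L^T) a b = vdot (row a L)^T (A *m (row b L)^T).
Proof.
rewrite /vdot trmxK mulmxA -row_mul [LHS]mxE [RHS]mxE.
by apply: eq_bigr => k' _; rewrite !mxE.
Qed.

Lemma mulmx_entry k n (L : 'M[R]_(k, n)) (v : 'cV[R]_n) a :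
  (L *m v) a 0 = vdot (row a L)^T v.
Proof. by rewrite /vdot trmxK -row_mul [RHS]mxE. Qed.

Lemma vnorm_sqr n (v : 'cV[R]_n) : vnorm v ^+ 2 = vdot v v.
Proof. by rewrite l2_sqr vdotE. Qed.

Lemma vnorm_ge0 n (v : 'cV[R]_n) : 0 <= vnorm v.
Proof. exact: l2_ge0. Qed.

Lemma vdot_ge0 n (v : 'cV[R]_n) : 0 <= vdot v v.
Proof. by rewrite -vnorm_sqr sqr_ge0. Qed.

Lemma vdot_eq0 n (v : 'cV[R]_n) : (vdot v v == 0) = (v == 0).
Proof.
apply/idP/eqP => [|->]; last by rewrite /vdot mulmx0 mxE.
rewrite vdotE psumr_eq0 => [/allP h|i _]; last by rewrite -expr2 sqr_ge0.
apply/matrixP => i j; rewrite ord1 mxE; apply/eqP.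
by have := h i (mem_index_enum _); rewrite -expr2 sqrf_eq0.
Qed.

Lemma vdot_norm_le n (u v : 'cV[R]_n) : `|vdot u v| <= vnorm u * vnorm v.
Proof. by rewrite vdotE l2_cauchy_schwarz. Qed.

Lemma frobenius_vnorm n (v : 'cV[R]_n) : frobenius v = vnorm v.
Proof. by congr Num.sqrt; apply: eq_bigr => i _; rewrite big_ord1. Qed.

Lemma frobenius_entry a b (A : 'M[R]_(a, b)) i j : `|A i j| <= frobenius A.
Proof.
rewrite -sqrtr_sqr ler_sqrt; last first.
  by apply: sumr_ge0 => k _; exact: sum_sqr_ge0.
rewrite (bigD1 i)//= (bigD1 j)//= -addrA lerDl addr_ge0//.
  by apply: sumr_ge0 => k _; rewrite sqr_ge0.
by apply: sumr_ge0 => k _; exact: sum_sqr_ge0.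
Qed.

Lemma vdot_mulmx_continuous n (A : 'M[R]_n) :
  continuous (fun u : 'rV[R]_n => (u *m A *m u^T) 0 0).
Proof.
rewrite (_ : (fun _ => _) = (fun u : 'rV[R]_n =>
    \sum_j (\sum_i u 0 i * A i j) * u 0 j)); last first.
  by apply/funext => w; rewrite mxE; apply: eq_bigr => j _; rewrite !mxE.
have sumc (f : 'I_n -> 'rV[R]_n -> R) : (forall i, continuous (f i)) ->
    continuous (fun u => \sum_i f i u).
  by move=> fc; apply: continuous_big => //; exact: add_continuous.
have c1 j : continuous (fun u : 'rV[R]_n => \sum_i u 0 i * A i j).
  apply: (sumc) => i z.
  by apply: continuousM; [exact: coord_continuous|exact: cst_continuous].
apply: (sumc) => j w.
by apply: continuousM; [exact: c1|exact: coord_continuous].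
Qed.

(** Courant-Fischer for the extreme eigenvalue: the quadratic form attains its
minimum on the unit sphere, and a minimiser is an eigenvector. *)
Lemma rayleigh_min n (A : 'M[R]_n) : A^T = A -> (0 < n)%N ->
  exists2 a, eigenvalue A a & forall v, a * vdot v v <= vdot v (A *m v).
Proof.
move=> Asym n0; pose S := [set u : 'rV[R]_n | (u *m 1%:M *m u^T) 0 0 = 1].
have Sc : compact S.
  apply: (@subclosed_compact _ _
      [set v : 'rV[R]_n | forall i, `[(-1 : R), 1]%classic (v ord0 i)]).
  - rewrite (_ : S = (fun u : 'rV[R]_n => (u *m 1%:M *m u^T) 0 0) @^-1` [set 1])//.
    apply: preimage_closed; last exact: closed_eq.
    by move=> u _; exact: vdot_mulmx_continuous.
  - apply: (@rV_compact _ _ (fun=> `[(-1 : R), 1]%classic)) => i.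
    exact: segment_compact.
  - move=> u; rewrite /S/= mulmx1 mxE => u1 i; rewrite /= in_itv/= -ler_norml.
    rewrite -(@ler_pXn2r _ 2)// ?nnegrE// expr1n real_normK ?num_real// -u1.
    rewrite (bigD1 i)//= mxE -expr2 lerDl sumr_ge0// => j _.
    by rewrite mxE -expr2 sqr_ge0.
have S0 : S !=set0.
  exists (delta_mx 0 (Ordinal n0)); rewrite /S/= mulmx1 trmx_delta mul_delta_mx.
  by rewrite mxE !eqxx.
have [c] := EVT_min_rV S0 Sc
  (continuous_subspaceT (@vdot_mulmx_continuous _ A)).
rewrite inE => cS cmin; set a := (c *m A *m c^T) 0 0 in cmin.
have c1 : vdot c^T c^T = 1 by rewrite /vdot trmxK -[RHS]cS mulmx1.
have Hmin v : a * vdot v v <= vdot v (A *m v).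
  have [->|v0] := eqVneq v 0; first by rewrite /vdot !mulmx0 mxE mulr0.
  have vn : 0 < vdot v v by rewrite lt_neqAle eq_sym vdot_eq0 v0 vdot_ge0.
  have s0 : 0 < vnorm v by rewrite sqrtr_gt0 -l2_sqr vnorm_sqr.
  pose u := (vnorm v)^-1 *: v^T.
  have uS : u \in S.
    rewrite inE /S/= mulmx1 /u linearZ/= -scalemxAl -scalemxAr trmxK !mxE.
    rewrite -[X in _ * (_ * X)](_ : vdot v v = _); last by rewrite /vdot mxE.
    by rewrite -vnorm_sqr; field; rewrite gt_eqF.
  have := cmin _ uS.
  rewrite /u linearZ/= -!scalemxAl -scalemxAr trmxK !mxE.
  rewrite -[X in _ <= _ * (_ * X)](_ : vdot v (A *m v) = _); last first.
    by rewrite /vdot mulmxA mxE.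
  rewrite -(ler_pM2r vn) => /le_trans; apply.
  by rewrite -vnorm_sqr le_eqVlt; apply/orP; left; apply/eqP; field; rewrite gt_eqF.
exists a => //; apply/eigenvalueP; exists c; last first.
  by apply/eqP => c0; move/eqP: c1; rewrite c0 /vdot linear0 mulmx0 mxE eq_sym oner_eq0.
have [w wE] : exists w, w = A *m c^T - a *: c^T by eexists.
(* first variation of the quadratic form at c in the direction w *)
have var t : 0 <= 2 * t * vdot w w + t ^+ 2 * (vdot w (A *m w) - a * vdot w w).
  have := Hmin (c^T + t *: w).
  rewrite mulmxDr -scalemxAr !(vdotDl, vdotDr, vdotZl, vdotZr) c1.
  have -> : vdot c^T (A *m w) = vdot w (A *m c^T).
    by rewrite vdotC vdot_mull Asym.
  have -> : vdot c^T (A *m c^T) = a by rewrite /vdot trmxK mulmxA.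
  have -> : vdot c^T w = vdot w c^T by rewrite vdotC.
  have -> : vdot w w = vdot w (A *m c^T) - a * vdot w c^T.
    by rewrite {2}wE vdotBr vdotZr.
  by rewrite -subr_ge0 => h; move: h; congr (0 <= _); ring.
have w0 : w == 0.
  rewrite -vdot_eq0 eq_le vdot_ge0 andbT leNgt; apply/negP => ww.
  set k := vdot w (A *m w) - a * vdot w w in var.
  have k0 : 0 <= k by rewrite subr_ge0.
  have k1 : 0 < k + 1 by lra.
  have := var (- (vdot w w / (k + 1))).
  rewrite (_ : _ + _ = - (vdot w w ^+ 2 / (k + 1) * (2 - k / (k + 1)))); last first.
    by field; rewrite gt_eqF.
  have kk : k / (k + 1) <= 1 by rewrite ler_pdivrMr//; lra.
  rewrite oppr_ge0 leNgt => /negP; apply; rewrite mulr_gt0//; last lra.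
  by rewrite divr_gt0// exprn_gt0.
apply: trmx_inj; rewrite trmx_mul Asym linearZ/=.
by apply/eqP; rewrite -subr_eq0 -wE.
Qed.

Lemma eigenvalue_vdot n (A : 'M[R]_n) a : eigenvalue A a ->
  exists2 v : 'cV[R]_n, vdot v (A *m v) = a * vdot v v & 0 < vdot v v.
Proof.
move=> /eigenvalueP[v vA v0]; exists v^T.
  by rewrite /vdot trmxK mulmxA vA -scalemxAl mxE.
rewrite lt_neqAle vdot_ge0 eq_sym vdot_eq0 andbT.
by apply: contraNN v0 => /eqP v0; rewrite -[v]trmxK v0 linear0.
Qed.

(** The infimum defining lambda_min is over a set bounded below by the Rayleigh
quotient, and it is the value a of [rayleigh_min]. *)
Lemma lambda_min_le n (A : 'M[R]_n) c v : A^T = A -> c <= lambda_min A ->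
  c * vdot v v <= vdot v (A *m v).
Proof.
move=> Asym cA; case: n => [|n] in A v Asym cA *.
  by rewrite !vdotE !big_ord0 mulr0.
have [a aA aP] := rayleigh_min Asym (ltn0Sn _).
apply: le_trans (aP v); rewrite ler_wpM2r ?vdot_ge0//.
apply: (le_trans cA); apply: ge_inf => //; exists a => x.
move=> /eigenvalue_vdot[w wA w0].
by rewrite -(ler_pM2r w0) -wA.
Qed.

Lemma lambda_max_ge n (A : 'M[R]_n) c v : A^T = A -> lambda_max A <= c ->
  vdot v (A *m v) <= c * vdot v v.
Proof.
move=> Asym cA; case: n => [|n] in A v Asym cA *.
  by rewrite !vdotE !big_ord0 mulr0.
have [a aA aP] := @rayleigh_min _ (- A) (etrans (linearN _ _) (congr1 _ Asym)) (ltn0Sn _).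
have aP' w : vdot w (A *m w) <= - a * vdot w w.
  have := aP w; rewrite mulNmx -scaleN1r vdotZr mulN1r; lra.
apply: (le_trans (aP' v)); rewrite ler_wpM2r ?vdot_ge0//.
apply: le_trans cA; apply: ub_le_sup.
  exists (- a) => x /eigenvalue_vdot[w wA w0].
  by rewrite -(ler_pM2r w0) -wA.
move: aA => /eigenvalueP[w wA w0]; apply/eigenvalueP; exists w => //.
by move: wA; rewrite mulmxN => /eqP; rewrite eqr_oppLR => /eqP ->; rewrite scaleNr.
Qed.

(** Block elimination: the Schur complement S of the corner entry a inherits the
lower bound c, because its form at w is the form of G at (- vdot b w / a, w). *)
Lemma whitening l (G : 'M[R]_l) c : 0 < c -> G^T = G ->
  (forall v, c * vdot v v <= vdot v (G *m v)) ->
  exists T : 'M[R]_l, T *m G *m T^T = 1%:M.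
Proof.
move=> c0; elim: l G => [|l IH] G Gsym Gc.
  by exists 1%:M; apply/matrixP => -[].
change 'M[R]_(1 + l) in G.
pose a := G 0 0; pose b := dlsubmx G; pose D := drsubmx G.
have GE : G = block_mx a%:M b^T b D.
  rewrite -[LHS]submxK; congr block_mx.
    by rewrite [LHS]mx11_scalar !mxE lshift0.
  by rewrite /b -{1}Gsym trmx_dlsub.
have Dsym : D^T = D by rewrite /D trmx_drsub Gsym.
have vdot_col (x y : 'cV[R]_1) (w z : 'cV[R]_l) :
    vdot (col_mx x w : 'cV_(1 + l)) (col_mx y z) = x 0 0 * y 0 0 + vdot w z.
  by rewrite /vdot tr_col_mx mul_row_col !mxE big_ord1 !mxE.
have qG (s : R) (w : 'cV[R]_l) :
    vdot (col_mx s%:M w : 'cV_(1 + l)) (G *m col_mx s%:M w) =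
    a * s ^+ 2 + 2 * s * vdot b w + vdot w (D *m w).
  rewrite GE mul_block_col vdot_col vdotDr -scalar_mxM mul_mx_scalar vdotZr.
  rewrite [X in s%:M _ _ * X]mxE -[(b^T *m w) 0 0]/(vdot b w) (vdotC w b) !mxE eqxx.
  by rewrite !mulr1n; ring.
have a0 : 0 < a.
  have := Gc (col_mx (1%:M : 'cV_1) (0 : 'cV_l)).
  by rewrite qG vdot_col /vdot !mulmx0 !mxE eqxx mulr1n expr1n !mulr1 !mulr0; lra.
pose S := D - a^-1 *: (b *m b^T).
have qS w : vdot w (S *m w) = vdot w (D *m w) - a^-1 * vdot b w ^+ 2.
  rewrite /S mulmxBl vdotBr -scalemxAl vdotZr; congr (_ - _ * _).
  rewrite -mulmxA [b^T *m w]mx11_scalar -[(b^T *m w) 0 0]/(vdot b w).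
  by rewrite mul_mx_scalar vdotZr vdotC expr2.
have [||T' T'P] := IH S.
- by rewrite /S linearB/= linearZ/= trmx_mul trmxK Dsym.
- move=> w; have := Gc (col_mx ((- (a^-1 * vdot b w))%:M : 'cV_1) w).
  rewrite qG qS vdot_col !mxE eqxx mulr1n => h.
  have h2 : 0 <= c * (- (a^-1 * vdot b w) * - (a^-1 * vdot b w)).
    by rewrite -expr2 mulr_ge0 ?sqr_ge0 ?ltW.
  have -> : vdot w (D *m w) - a^-1 * vdot b w ^+ 2 =
    a * (- (a^-1 * vdot b w)) ^+ 2 + 2 * (- (a^-1 * vdot b w)) * vdot b w + vdot w (D *m w).
    by field; rewrite gt_eqF.
  by apply: le_trans h; rewrite mulrDr; lra.
exists (block_mx (Num.sqrt a)^-1%:M 0 (- (a^-1 *: (T' *m b))) T').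
have sa : Num.sqrt a != 0 by rewrite gt_eqF// sqrtr_gt0.
have sa2 : Num.sqrt a * Num.sqrt a = a by rewrite -expr2 sqr_sqrtr// ltW.
change ((block_mx (Num.sqrt a)^-1%:M 0 (- (a^-1 *: (T' *m b))) T' : 'M[R]_(1 + l)) *m G *m
  (block_mx (Num.sqrt a)^-1%:M 0 (- (a^-1 *: (T' *m b))) T' : 'M[R]_(1 + l))^T = 1%:M).
rewrite {}GE (tr_block_mx (Num.sqrt a)^-1%:M) !mulmx_block (@scalar_mx_block _ 1 l 1); congr block_mx.
- rewrite !mul0mx !addr0 trmx0 mulmx0 addr0 -!scalar_mxM tr_scalar_mx -scalar_mxM.
  by congr _%:M; rewrite -[X in _ * X * _]sa2; field.
- rewrite !mul0mx !addr0 !mul_scalar_mx -!scalemxAl mul_scalar_mx.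
  rewrite linearN/= [(_ *: _)^T]linearZ/= trmx_mul -scalerN [a *: (_ *: _)]scalerA mulfV ?gt_eqF//.
  by rewrite scale1r scalerN addNr.
- rewrite trmx0 mulmx0 addr0 mulNmx -scalemxAl mul_mx_scalar scalerA mulVf ?gt_eqF//.
  by rewrite scale1r addNr mul0mx.
- rewrite mulNmx -scalemxAl mul_mx_scalar scalerA mulVf ?gt_eqF// scale1r addNr mul0mx add0r.
  rewrite -T'P /S mulmxBr mulNmx addrC -scalemxAl -scalemxAr !mulmxA.
  by rewrite mulmxBl.
Qed.

End QuadraticForms.

(** * Expectations in a finite product space *)

Section ProductExpectation.
Context {R : realType} {I A : finType} (q : I -> A -> R).
Hypothesis q_ge0 : forall i a, 0 <= q i a.
Hypothesis q_sum : forall i, \sum_a q i a = 1.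

Definition pweight (o : {ffun I -> A}) : R := \prod_i q i (o i).
Definition pexp (f : {ffun I -> A} -> R) : R := \sum_o pweight o * f o.
Definition mexp (i : I) (g : A -> R) : R := \sum_a q i a * g a.

Lemma pweight_ge0 o : 0 <= pweight o.
Proof. exact: prodr_ge0. Qed.

Lemma mexp1 i : mexp i (fun=> 1) = 1.
Proof. by rewrite /mexp; under eq_bigr do rewrite mulr1. Qed.

Lemma pexp_prod (h : I -> A -> R) :
  pexp (fun o => \prod_i h i (o i)) = \prod_i mexp i (h i).
Proof.
rewrite /mexp bigA_distr_bigA; apply: eq_bigr => o _.
by rewrite -big_split.
Qed.

Lemma pexp_coord i g : pexp (fun o => g (o i)) = mexp i g.
Proof.
transitivity (\prod_j mexp j (fun a => if j == i then g a else 1)); last first.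
  by rewrite (bigD1 i)//= eqxx big1 ?mulr1// => j /negbTE ->; exact: mexp1.
rewrite -pexp_prod; apply: eq_bigr => o _; congr (_ * _).
by rewrite (bigD1 i)//= eqxx big1 ?mulr1// => j /negbTE ->.
Qed.

Lemma pexp_coord2 i j g h : i != j ->
  pexp (fun o => g (o i) * h (o j)) = mexp i g * mexp j h.
Proof.
move=> ij; have ji : j != i by rewrite eq_sym.
transitivity (\prod_k mexp k
    (fun a => if k == i then g a else if k == j then h a else 1)); last first.
  rewrite (bigD1 i)//= eqxx (bigD1 j)//= (negbTE ji) eqxx.
  rewrite big1 ?mulr1// => k /andP[/negbTE -> /negbTE ->]; exact: mexp1.
rewrite -pexp_prod; apply: eq_bigr => o _; congr (_ * _).
rewrite (bigD1 i)//= eqxx (bigD1 j)//= (negbTE ji) eqxx.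
by rewrite big1 ?mulr1// => k /andP[/negbTE -> /negbTE ->].
Qed.

Lemma pexpD f g : pexp (fun o => f o + g o) = pexp f + pexp g.
Proof. by rewrite -big_split; apply: eq_bigr => o _; rewrite mulrDr. Qed.

Lemma pexpZ c f : pexp (fun o => c * f o) = c * pexp f.
Proof. by rewrite /pexp mulr_sumr; apply: eq_bigr => o _; rewrite mulrCA. Qed.

Lemma pexp_sum (J : finType) (f : J -> {ffun I -> A} -> R) :
  pexp (fun o => \sum_j f j o) = \sum_j pexp (f j).
Proof.
by rewrite /pexp exchange_big; apply: eq_bigr => o _; rewrite mulr_sumr.
Qed.

Lemma pexp_cst c : pexp (fun=> c) = c.
Proof.
have := pexp_prod (fun=> fun=> 1); rewrite [in RHS]big1 => [h|i _]; last exact: mexp1.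
rewrite -[RHS]mulr1 -h -pexpZ; apply: eq_bigr => o _.
by rewrite prodr_const expr1n mulr1.
Qed.

Lemma ler_pexp f g : (forall o, f o <= g o) -> pexp f <= pexp g.
Proof. by move=> fg; apply: ler_sum => o _; rewrite ler_wpM2l ?pweight_ge0. Qed.

Lemma ler_mexp i f g : (forall a, f a <= g a) -> mexp i f <= mexp i g.
Proof. by move=> fg; apply: ler_sum => a _; rewrite ler_wpM2l. Qed.

Lemma mexp_le i f c : (forall a, f a <= c) -> mexp i f <= c.
Proof.
move=> fc; apply: (le_trans (ler_mexp i fc)).
by rewrite /mexp -mulr_suml q_sum mul1r.
Qed.

Lemma mexp_norm_le i f g : (forall a, `|f a| <= g a) -> `|mexp i f| <= mexp i g.
Proof.
move=> fg; apply: le_trans (ler_norm_sum _ _ _) _; apply: ler_sum => a _.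
by rewrite normrM ger0_norm// ler_wpM2l.
Qed.

Lemma pexp_norm_le f c : (forall o, `|f o| <= c) -> `|pexp f| <= c.
Proof.
move=> fc; rewrite -[leRHS]pexp_cst; apply: le_trans (ler_norm_sum _ _ _) _.
by apply: ler_sum => o _; rewrite normrM ger0_norm ?pweight_ge0// ler_wpM2l ?pweight_ge0.
Qed.

(** Pairwise independence: variances of centred summands add up. *)
Lemma pexp_sqr_sum (g : I -> A -> R) : (forall i, mexp i (g i) = 0) ->
  pexp (fun o => (\sum_i g i (o i)) ^+ 2) = \sum_i mexp i (fun a => g i a ^+ 2).
Proof.
move=> g0; transitivity (pexp (fun o => \sum_i g i (o i) * \sum_j g j (o j))).
  by apply: eq_bigr => o _; rewrite expr2 mulr_suml.
rewrite pexp_sum; apply: eq_bigr => i _.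
rewrite -(pexp_coord i (fun a => g i a ^+ 2)).
have -> : pexp (fun o => g i (o i) * \sum_j g j (o j)) =
    \sum_j pexp (fun o => g i (o i) * g j (o j)).
  by rewrite -pexp_sum; apply: eq_bigr => o _; rewrite mulr_sumr.
rewrite (bigD1 i)//= [X in _ + X]big1 ?addr0// => j ji.
by rewrite pexp_coord2 1?eq_sym// g0 mul0r.
Qed.

Definition pprob (B : pred {ffun I -> A}) : R := pexp (fun o => (B o)%:R).

Lemma markov_pprob f c : 0 < c -> (forall o, 0 <= f o) ->
  pprob (fun o => c <= f o) <= pexp f / c.
Proof.
move=> c0 f0; rewrite ler_pdivlMr// mulrC -pexpZ; apply: ler_pexp => o.
by case: (leP c (f o)) => h; rewrite ?mulr1 ?mulr0.
Qed.

End ProductExpectation.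

(** * Characteristic function of a sum of small independent variables *)

Section CharacteristicFunction.
Context {R : realType} {I A : finType} (q : I -> A -> R).
Hypothesis q_ge0 : forall i a, 0 <= q i a.
Hypothesis q_sum : forall i, \sum_a q i a = 1.

Let cis (x : R) : R[i] := (cos x +i* sin x)%C.

Let cisD x y : cis (x + y) = cis x * cis y.
Proof. by rewrite /cis cosD sinD; congr Complex; rewrite [RHS]addrC mulrC addrC. Qed.

Let cis_sum (f : I -> R) : cis (\sum_i f i) = \prod_i cis (f i).
Proof.
elim/big_ind2 : _ => // [|x1 x2 y1 y2 <- <-]; last exact: cisD.
by rewrite /cis cos0 sin0.
Qed.

Let norm_cis x : `|cis x| = 1.
Proof. by rewrite normc_def /= cos2Dsin2 sqrtr1. Qed.

Let norm_real (x : R) : `|x%:C%C| = `|x|%:C%C :> R[i].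
Proof. by rewrite normc_def /= expr0n/= addr0 sqrtr_sqr. Qed.

Let norm_le (a b : R) : `|(a +i* b)%C| <= (`|a| + `|b|)%:C%C.
Proof.
rewrite normc_def lecR /= -[leRHS]ger0_norm ?addr_ge0// -sqrtr_sqr ler_sqrt ?sqr_ge0//.
rewrite sqrrD -[a ^+ 2]real_normK ?num_real// -[b ^+ 2]real_normK ?num_real//.
by rewrite lerD2r lerDl mulrn_wge0// mulr_ge0.
Qed.

Let norm_prodB (S : numDomainType) (z w : I -> S) (r : seq I) :
  (forall i, `|z i| <= 1) -> (forall i, `|w i| <= 1) ->
  `|\prod_(i <- r) z i - \prod_(i <- r) w i| <= \sum_(i <- r) `|z i - w i|.
Proof.
move=> z1 w1; elim: r => [|i r IH]; first by rewrite !big_nil subrr normr0.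
rewrite !big_cons.
have -> : z i * \prod_(j <- r) z j - w i * \prod_(j <- r) w j =
  (z i - w i) * \prod_(j <- r) z j + w i * (\prod_(j <- r) z j - \prod_(j <- r) w j).
  by rewrite mulrBl mulrBr addrA subrK.
apply: le_trans (ler_normD _ _) _; rewrite !normrM; apply: lerD.
  rewrite ler_piMr// normr_prod; apply: prodr_ile1 => j _.
  by rewrite normr_ge0 z1.
by apply: le_trans IH; rewrite ler_piMl.
Qed.

Let sum_complex (J : finType) (f g : J -> R) :
  \sum_j (f j +i* g j)%C = ((\sum_j f j) +i* (\sum_j g j))%C.
Proof. by elim/big_rec3 : _ => [|j x y z _ ->]. Qed.

Let normr_Re (z : R[i]) : `|complex.Re z|%:C%C <= `|z|.
Proof.
rewrite normc_def lecR -sqrtr_sqr ler_sqrt ?lerDl ?sqr_ge0//.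
by rewrite addr_ge0 ?sqr_ge0.
Qed.

(** Lindeberg's comparison: each factor E exp(i zeta) differs from
exp(- sigma^2/2) by at most tau sigma^2, and replacing the factors of a product
of numbers of modulus at most 1 one at a time adds up these differences. The
phase theta lets the cosine carry both the real and the imaginary part. *)
Lemma pexp_cos_gauss (zeta : I -> A -> R) (tau theta : R) :
  0 <= tau <= 1 ->
  (forall i a, `|zeta i a| <= tau) ->
  (forall i, mexp q i (zeta i) = 0) ->
  let s := \sum_i mexp q i (fun a => zeta i a ^+ 2) in
  `|pexp q (fun o => cos (\sum_i zeta i (o i) + theta))
    - expR (- (s / 2)) * cos theta| <= tau * s.
Proof.
move=> /andP[tau0 tau1] zt z0 /=; set s2 := fun i => mexp q i (fun a => zeta i a ^+ 2).
have s2ge0 i : 0 <= s2 i by apply: sumr_ge0 => a _; rewrite mulr_ge0// sqr_ge0.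
have zt2 i a : zeta i a ^+ 2 <= tau ^+ 2.
  by rewrite -[_ ^+ 2]real_normK ?num_real// ler_pXn2r ?nnegrE.
have s2le i : s2 i <= tau ^+ 2 by exact: mexp_le.
pose phi i : R[i] := \sum_a (q i a)%:C%C * cis (zeta i a).
pose psi i : R[i] := (expR (- (s2 i / 2)))%:C%C.
have phi1 i : `|phi i| <= 1.
  apply: le_trans (ler_norm_sum _ _ _) _.
  under eq_bigr => a _ do rewrite normrM norm_cis mulr1 norm_real ger0_norm//.
  by rewrite -(rmorph_sum (real_complex R)) q_sum.
have psi1 i : `|psi i| <= 1.
  rewrite norm_real ger0_norm ?expR_ge0// lecR expR_le1 oppr_le0.
  by rewrite divr_ge0.
have scale_cis (c x : R) : c%:C%C * cis x = ((c * cos x) +i* (c * sin x))%C.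
  by rewrite /cis; simpc.
have phiE i : phi i = (mexp q i (cos \o zeta i) +i* mexp q i (sin \o zeta i))%C.
  by rewrite -sum_complex; apply: eq_bigr => a _; rewrite scale_cis.
have cosE i : `|mexp q i (cos \o zeta i) - (1 - s2 i / 2)| <= tau ^+ 2 * s2 i / 24.
  have -> : mexp q i (cos \o zeta i) - (1 - s2 i / 2) =
      mexp q i (fun a => cos (zeta i a) - (1 - zeta i a ^+ 2 / 2)).
    rewrite -[X in _ - (X - _)](mexp1 q_sum i) /s2 /mexp mulr_suml -!sumrB.
    by apply: eq_bigr => a _ /=; ring.
  have -> : tau ^+ 2 * s2 i / 24 = mexp q i (fun a => tau ^+ 2 * zeta i a ^+ 2 / 24).
    rewrite /s2 /mexp mulr_sumr mulr_suml.
    by apply: eq_bigr => a _ /=; ring.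
  apply: mexp_norm_le => // a; apply: le_trans (cos_taylor _) _.
  rewrite ler_pM2r// (_ : zeta i a ^+ 4 = zeta i a ^+ 2 * zeta i a ^+ 2); last by ring.
  by rewrite ler_wpM2r ?sqr_ge0.
have sinE i : `|mexp q i (sin \o zeta i)| <= tau * s2 i / 6.
  have -> : mexp q i (sin \o zeta i) =
      mexp q i (fun a => sin (zeta i a) - zeta i a).
    rewrite -[LHS]subr0 -(z0 i) /mexp -sumrB.
    by apply: eq_bigr => a _ /=; ring.
  have -> : tau * s2 i / 6 = mexp q i (fun a => tau * zeta i a ^+ 2 / 6).
    rewrite /s2 /mexp mulr_sumr mulr_suml.
    by apply: eq_bigr => a _ /=; ring.
  apply: mexp_norm_le => // a; apply: le_trans (sin_taylor _) _.
  by rewrite ler_pM2r// exprS real_normK ?num_real// ler_wpM2r ?sqr_ge0.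
have expE i : `|expR (- (s2 i / 2)) - (1 - s2 i / 2)| <= tau ^+ 2 * s2 i / 2.
  have h : `|- (s2 i / 2)| <= 1/2.
    rewrite normrN ger0_norm ?divr_ge0//.
    have : tau ^+ 2 <= 1 by rewrite exprn_ile1.
    by have := s2le i; lra.
  have := expR_taylor h; rewrite (_ : _ - 1 - - (s2 i / 2) =
    expR (- (s2 i / 2)) - (1 - s2 i / 2)); last by ring.
  by have := s2le i; have := s2ge0 i => h1 h2 /le_trans; apply; nra.
have dist i : `|phi i - psi i| <= (tau * s2 i)%:C%C.
  rewrite phiE /psi; apply: le_trans (norm_le _ _) _; rewrite lecR oppr0 addr0.
  have -> : mexp q i (cos \o zeta i) - expR (- (s2 i / 2)) =
    (mexp q i (cos \o zeta i) - (1 - s2 i / 2)) - (expR (- (s2 i / 2)) - (1 - s2 i / 2)).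
    by ring.
  have h1 := ler_normB (mexp q i (cos \o zeta i) - (1 - s2 i / 2))
    (expR (- (s2 i / 2)) - (1 - s2 i / 2)).
  have h2 := cosE i; have h3 := sinE i; have h4 := expE i.
  have h5 : tau ^+ 2 * s2 i <= tau * s2 i by rewrite ler_wpM2r// expr2 ler_piMr.
  have h6 : 0 <= tau * s2 i by rewrite mulr_ge0.
  lra.
have -> : pexp q (fun o => cos (\sum_i zeta i (o i) + theta)) =
   complex.Re (cis theta * \prod_i phi i).
  rewrite /phi bigA_distr_bigA mulr_sumr/=.
  rewrite (eq_bigr (fun o : {ffun I -> A} =>
    ((pweight q o * cos (\sum_i zeta i (o i) + theta)) +i*
     (pweight q o * sin (\sum_i zeta i (o i) + theta)))%C)) ?sum_complex// => o _.
  rewrite big_split/= -(rmorph_prod (real_complex R)) -cis_sum mulrCA -cisD addrC.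
  exact: scale_cis.
have -> : expR (- ((\sum_i s2 i) / 2)) * cos theta =
   complex.Re (cis theta * \prod_i psi i).
  have -> : \prod_i psi i = (expR (- ((\sum_i s2 i) / 2)))%:C%C.
    by rewrite mulr_suml -sumrN expR_sum (rmorph_prod (real_complex R)).
  by rewrite [cis theta * _]mulrC scale_cis.
have ReB (u v : R[i]) : complex.Re u - complex.Re v = complex.Re (u - v).
  by case: u; case: v.
rewrite -lecR ReB -mulrBr.
apply: le_trans (normr_Re _) _; rewrite normrM norm_cis mul1r.
apply: le_trans (norm_prodB _ _ _) _ => //.
rewrite mulr_sumr (rmorph_sum (real_complex R)); exact: ler_sum.
Qed.

End CharacteristicFunction.

(** * Fourier and Laplace transforms of the Gaussian law *)

Section GaussianFourier.
Context {R : realType}.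
Local Notation mu := (@lebesgue_measure R).
Local Notation gamma := (normal_prob (0 : R) 1).
Local Notation w := (normal_pdf (0 : R) 1).

Lemma normal_pdf01E x : w x = normal_peak 1 * expR (- (x ^+ 2 / 2)).
Proof.
rewrite normal_pdfE ?oner_eq0// /normal_fun subr0 expr1n.
by rewrite mulNr.
Qed.

Lemma bounded_integrable_normal01 (f : R -> R) (M : R) :
  measurable_fun setT f -> (forall x, `|f x| <= M) ->
  (gamma : {measure set _ -> \bar R}).-integrable setT (fun x => (f x)%:E).
Proof.
move=> mf fM; rewrite -[fun x => _]/(EFin \o f); apply: measurable_bounded_integrable => //.
  by rewrite (@le_lt_trans _ _ 1%E)// ?ltry// probability_le1.
exists M; split; first exact: num_real.
by move=> y My x _; apply: (le_trans (fM x)); exact: ltW.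
Qed.

(** By uniqueness, the Radon-Nikodym derivative of the law is its density almost
everywhere. *)
Lemma integral_normal01 (f : R -> R) (M : R) :
  measurable_fun setT f -> (forall x, `|f x| <= M) ->
  (\int[gamma]_x (f x)%:E = \int[mu]_x (f x * w x)%:E)%E.
Proof.
move=> mf fM.
have intf := bounded_integrable_normal01 mf fM.
rewrite -(Radon_Nikodym_change_of_variables (@normal_prob_dominates R 0 1))//.
apply: ae_eq_integral => //.
- apply: emeasurable_funM; first exact/measurable_EFinP.
  apply: (measurable_int mu).
  by apply: Radon_Nikodym_integrable; exact: normal_prob_dominates.
- apply/measurable_EFinP; apply: measurable_funM => //.
  exact: measurable_normal_pdf.
- under [X in ae_eq _ _ _ X]eq_fun do rewrite EFinM.
  apply: ae_eqe_mul2l => /=.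
  rewrite Radon_NikodymE//=; first exact: normal_prob_dominates.
  move=> domi; case: cid => /= h [h1 h2 h3].
  apply: integral_ae_eq => //=.
  + by apply/measurable_EFinP; exact: measurable_normal_pdf.
  + by move=> E E01 mE; rewrite -h3.
Qed.

Section Fourier.
Variable theta : R.

(* f b x integrates to exp(b^2/2) times the characteristic function, which is to
be shown constant in b; its derivative df in b is also a derivative in x, so
that the integral of df over [-N, N] is a boundary term. *)
Let f (b x : R) := expR (b ^+ 2 / 2) * (cos (b * x + theta) * w x).
Let df (b x : R) :=
  expR (b ^+ 2 / 2) * ((b * cos (b * x + theta) - x * sin (b * x + theta)) * w x).

Let wE : w = fun x => normal_peak 1 * expR (- (x ^+ 2 / 2)).
Proof. by apply/funext => x; exact: normal_pdf01E. Qed.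

Let f_derive_b x b : is_derive b (1 : R) (f ^~ x) (df b x).
Proof.
rewrite /f /df; apply: is_derive_eq.
by rewrite /GRing.scale/=; field.
Qed.

Let primitive_derive b x : is_derive x (1 : R)
  (fun x => expR (b ^+ 2 / 2) * (sin (b * x + theta) * w x)) (df b x).
Proof.
rewrite wE /df wE; apply: is_derive_eq.
by rewrite /GRing.scale/=; field.
Qed.

Let w_ge0 x : 0 <= w x. Proof. exact: normal_pdf_ge0. Qed.

Let w_sym x : w (- x) = w x. Proof. by rewrite wE sqrrN. Qed.

Let cw : continuous w. Proof. exact: continuous_normal_pdf. Qed.

Let cderiv (g dg : R -> R) : (forall x, is_derive x (1 : R) g (dg x)) -> continuous g.
Proof.
move=> gd x; apply: differentiable_continuous; apply/derivable1_diffP.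
by have [] := gd x.
Qed.

Let cf b : continuous (f b).
Proof.
move=> x; apply: differentiable_continuous; apply/derivable1_diffP.
by rewrite /f wE; apply: ex_derive.
Qed.

Let cdf b : continuous (df b).
Proof.
move=> x; apply: differentiable_continuous; apply/derivable1_diffP.
by rewrite /df wE; apply: ex_derive.
Qed.

Section Truncation.
Variable N : R.
Hypothesis N0 : 0 < N.
Let NN : - N < N. Proof. by rewrite gtrN. Qed.
Let D := `[(- N), N]%classic.
Let mD : measurable D. Proof. exact: measurable_itv. Qed.

Let intD (g : R -> R) : continuous g -> mu.-integrable D (EFin \o g).
Proof.
move=> cg; apply: continuous_compact_integrable; first exact: segment_compact.
exact: continuous_subspaceT.
Qed.

Let F (b : R) := (\int[mu]_(x in D) f b x)%R.

Let FTC b : (\int[mu]_(x in D) df b x)%R = expR (b ^+ 2 / 2) *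
  ((sin (b * N + theta) - sin (b * - N + theta)) * w N).
Proof.
rewrite /Rintegral.
rewrite (@continuous_FTC2 _ (df b)
  (fun x => expR (b ^+ 2 / 2) * (sin (b * x + theta) * w x)) _ _ NN).
- by rewrite /= w_sym; ring.
- exact/continuous_subspaceT/cdf.
- have cg := cderiv (primitive_derive b).
  split; first by move=> x _; have [] := primitive_derive b x.
  + by apply: cvg_at_right_filter; exact: cg.
  + by apply: cvg_at_left_filter; exact: cg.
- by move=> x _; rewrite derive1E; apply: derive_val; exact: primitive_derive.
Qed.

Let df_bound b x B : `|b| <= B -> D x -> `|df b x| <= expR (B ^+ 2 / 2) * (B + N) * normal_peak 1.
Proof.
move=> bB; rewrite /D/= in_itv/= -ler_norml => xN.
have B0 : 0 <= B by apply: le_trans bB.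
rewrite normrM -mulrA; apply: ler_pM => //.
  rewrite ger0_norm ?expR_ge0// ler_expR ler_pM2r// -[leLHS]real_normK ?num_real//.
  by rewrite ler_pXn2r ?nnegrE.
rewrite normrM; apply: ler_pM => //.
  apply: le_trans (ler_normB _ _) _; rewrite !normrM.
  by apply: lerD; rewrite -[leRHS]mulr1 ler_pM ?cos_max ?sin_max.
by rewrite ger0_norm ?w_ge0// normal_pdf_ub ?oner_eq0.
Qed.

Let F_derive b : is_derive b (1 : R) F (expR (b ^+ 2 / 2) *
  ((sin (b * N + theta) - sin (b * - N + theta)) * w N)).
Proof.
have d1E c x : partial1of2 f c x = df c x.
  by rewrite partial1of2E; apply: derive_val; exact: f_derive_b.
pose G (_ : R) : R := expR ((`|b| + 1) ^+ 2 / 2) * (`|b| + 1 + N) * normal_peak 1.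
have bI : `]b - 1, b + 1[%classic b by rewrite /= in_itv/=; lra.
have bd c x : `]b - 1, b + 1[%classic c -> D x ->
    `|partial1of2 f c x| <= G x.
  rewrite /= in_itv/= => /andP[c1 c2] Dx; rewrite d1E; apply: df_bound => //.
  have -> : c = b + (c - b) by ring.
  by apply: le_trans (ler_normD _ _) _; rewrite lerD2l ler_norml; lra.
have fder c x : derivable (f ^~ x) c 1 by have [] := f_derive_b x c.
have h := @derivable_under_integral R _ _ mu f D mD b (b - 1) (b + 1) bI (fun c _ => intD (@cf c))
  (fun c x _ _ => fder c x).
have h2 := @differentiation_under_integral R _ _ mu f D mD b (b - 1) (b + 1) bI (fun c _ => intD (@cf c))
  (fun c x _ _ => fder c x).
have G0 x : 0 <= G x.
  apply: mulr_ge0; last exact: normal_peak_ge0.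
  by apply: mulr_ge0; [exact: expR_ge0|rewrite !addr_ge0// ltW].
have intG : mu.-integrable D (EFin \o G) by apply: intD; exact: cst_continuous.
have {}h : derivable F b 1 := h _ G0 intG bd.
apply: DeriveDef; first exact: h.
rewrite -derive1E (h2 _ G0 intG bd) -FTC.
by apply: eq_Rintegral => x _; exact: d1E.
Qed.

(** On [-N, N] the dependence on b is only through the boundary terms, which are
controlled by the density at N. *)
Lemma gauss_fourier_truncated b :
  `|F b - F 0| <= `|b| * (expR (b ^+ 2 / 2) * (2 * w N)).
Proof.
have cF := cderiv F_derive.
have dFle c : `|c| <= `|b| -> `|expR (c ^+ 2 / 2) *
  ((sin (c * N + theta) - sin (c * - N + theta)) * w N)| <= expR (b ^+ 2 / 2) * (2 * w N).
  move=> cb; rewrite normrM; apply: ler_pM => //.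
    rewrite ger0_norm ?expR_ge0// ler_expR ler_pM2r// -[leLHS]real_normK ?num_real//.
    by rewrite -[leRHS]real_normK ?num_real// ler_pXn2r ?nnegrE.
  rewrite normrM; apply: ler_pM => //; last by rewrite ger0_norm.
  apply: le_trans (ler_normB _ _) _.
  by apply: le_trans (lerD (sin_max _) (sin_max _)) _; lra.
have [b0|b0|->] := ltgtP b 0; last by rewrite subrr !normr0 mul0r.
- have [c] := MVT b0 (fun x _ => F_derive x) (continuous_subspaceT cF).
  rewrite in_itv/= => /andP[c1 c2] E.
  rewrite distrC E sub0r normrM normrN mulrC ler_wpM2l// dFle//.
  by rewrite !ltr0_norm// lerN2 ltW.
- have [c] := MVT b0 (fun x _ => F_derive x) (continuous_subspaceT cF).
  rewrite in_itv/= => /andP[c1 c2] E.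
  rewrite E subr0 normrM mulrC ler_wpM2l// dFle//.
  by rewrite !gtr0_norm// ltW.
Qed.

End Truncation.

Let intf b : mu.-integrable setT (EFin \o f b).
Proof.
have iw := @integrable_normal_pdf R 0 1.
apply: (@le_integrable _ _ _ mu setT measurableT _
  (fun x => (expR (b ^+ 2 / 2))%:E * (w x)%:E)%E); last exact: integrableZl.
- by apply/measurable_EFinP; apply: continuous_measurable_fun; exact: cf.
- move=> x _ /=; rewrite lee_fin !normrM ler_wpM2l// ler_piMl// cos_max//.
Qed.

Let w_decay (n : nat) : w n.+1%:R <= normal_peak 1 * expR (- n%:R).
Proof.
rewrite wE ler_wpM2l ?normal_peak_ge0// ler_expR lerN2 -natr1.
by have := sqr_ge0 (n%:R : R); rewrite !expr2; lra.
Qed.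

Let cvg_truncated b :
  (\int[mu]_(x in `[(- n.+1%:R), n.+1%:R]) f b x)%R @[n --> \oo] --> (\int[mu]_x f b x)%R.
Proof.
pose D n := `[(- n.+1%:R : R), n.+1%:R]%classic.
have mD n : measurable (D n) by exact: measurable_itv.
have mf n : measurable_fun setT (fun x => (EFin \o f b \_ (D n)) x).
  apply/measurable_EFinP; apply: (iffLR (measurable_restrictT _ (mD n))).
  by apply: measurable_funTS; apply: continuous_measurable_fun; exact: cf.
have mfb : measurable_fun setT (EFin \o f b) := measurable_int _ (intf b).
have cv : {ae mu, forall x, setT x ->
    (EFin \o f b \_ (D n)) x @[n --> \oo] --> (EFin \o f b) x}.
  apply: aeW => x _; apply: cvg_near_cst; near=> n.
  rewrite /= patchE mem_set// /D /= in_itv/= -ler_norml.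
  apply: (@le_trans _ _ n%:R); last by rewrite ler_nat.
  by near: n; exact: nbhs_infty_ger.
have dom : {ae mu, forall x n, setT x ->
    (`|(EFin \o f b \_ (D n)) x| <= (abse \o (EFin \o f b)) x)%E}.
  apply: aeW => x n _ /=; rewrite lee_fin patchE; case: ifPn => // _.
  by rewrite normr0.
have iab : mu.-integrable setT (abse \o (EFin \o f b)) by exact: integrable_abse.
have [_ _] := @dominated_convergence _ _ _ mu setT measurableT
  (fun n x => (EFin \o f b \_ (D n)) x) (EFin \o f b) (abse \o (EFin \o f b))
  mf mfb cv iab dom.
move=> h; under eq_fun do rewrite Rintegral_mkcond.
apply: fine_cvg; rewrite fineK; first exact: h.
exact: integrable_fin_num (intf b).
Unshelve. all: by end_near.
Qed.

Let Rint_gauss_fourier b :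
  (\int[mu]_x f b x)%R = (\int[mu]_x f 0 x)%R.
Proof.
apply/eqP; rewrite -subr_eq0; apply/eqP.
have h1 := cvgB (cvg_truncated (b := b)) (cvg_truncated (b := 0)).
pose K := `|b| * (expR (b ^+ 2 / 2) * (2 * normal_peak 1)).
have K0 : 0 <= K.
  by rewrite mulr_ge0// mulr_ge0 ?expR_ge0// mulr_ge0// normal_peak_ge0.
have h2 : K * expR (- n%:R) @[n --> \oo] --> (0 : R).
  by rewrite -[0](mulr0 K); apply: cvgMr; exact: cvgn_expR.
rewrite -(cvg_lim (@Rhausdorff R) (h1 _)); apply: (cvg_lim (@Rhausdorff R)).
apply/cvgr0Pnorm_le => e e0.
move/cvgr0Pnorm_le : h2 => /(_ _ e0); apply: filterS => n.
apply: le_trans; apply: le_trans (gauss_fourier_truncated (ltr0Sn _ n) b) _.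
rewrite [leRHS]ger0_norm ?(mulr_ge0 K0 (expR_ge0 _))// /K.
rewrite -!mulrA. by rewrite ler_wpM2l// ler_wpM2l ?expR_ge0// ler_wpM2l// w_decay.
Qed.

(** Letting N tend to infinity in [gauss_fourier_truncated]: exp(b^2/2) times the
characteristic function at b does not depend on b. *)
Lemma gauss_fourier b :
  (\int[gamma]_x (cos (b * x + theta))%:E = (expR (- (b ^+ 2 / 2)) * cos theta)%:E)%E.
Proof.
rewrite (@integral_normal01 _ 1); last 2 first.
- apply: continuous_measurable_fun => x.
  apply: differentiable_continuous; apply/derivable1_diffP.
  by apply: ex_derive.
- by move=> x; exact: cos_max.
have -> : (\int[mu]_x (cos (b * x + theta) * w x)%:E =
    \int[mu]_x ((expR (- (b ^+ 2 / 2)))%:E * (f b x)%:E))%E.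
  apply: eq_integral => x _; rewrite /f -EFinM; congr EFin.
  by rewrite [RHS]mulrA -expRD addNr expR0 mul1r.
rewrite integralZl//; last exact: (intf b).
rewrite EFinM; congr (_ * _)%E.
have := congr1 EFin (Rint_gauss_fourier b); rewrite /Rintegral.
rewrite fineK; last exact: integrable_fin_num (intf b).
move=> ->; rewrite fineK; last exact: integrable_fin_num (intf 0).
have -> : (\int[mu]_x (f 0 x)%:E = \int[mu]_x ((cos theta)%:E * (w x)%:E))%E.
  apply: eq_integral => x _; rewrite /f expr0n/= !mul0r add0r expR0 mul1r.
  by rewrite EFinM.
rewrite integralZl//; last exact: integrable_normal_pdf.
by rewrite integral_normal_pdf mule1.
Qed.

End Fourier.

(** The Laplace transform of the square of a standard Gaussian variable: the
integrand is proportional to a Gaussian density of smaller variance. *)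
Lemma gauss_laplace (s : R) : 0 <= s ->
  (\int[gamma]_x (expR (- (s * x ^+ 2)))%:E = ((Num.sqrt (1 + 2 * s))^-1)%:E)%E.
Proof.
move=> s0; have s1 : 0 < 1 + 2 * s by lra.
rewrite (@integral_normal01 _ 1); last 2 first.
- apply: continuous_measurable_fun => x.
  apply: differentiable_continuous; apply/derivable1_diffP.
  by apply: ex_derive.
- by move=> x; rewrite ger0_norm ?expR_ge0// expR_le1 oppr_le0 mulr_ge0// sqr_ge0.
set sg := (Num.sqrt (1 + 2 * s))^-1.
have sg0 : 0 < sg by rewrite invr_gt0 sqrtr_gt0.
have sg2 : sg ^+ 2 = (1 + 2 * s)^-1 by rewrite exprVn sqr_sqrtr// ltW.
have -> : (\int[mu]_x (expR (- (s * x ^+ 2)) * w x)%:E =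
    \int[mu]_x (sg%:E * (normal_pdf 0 sg x)%:E))%E.
  apply: eq_integral => x _; rewrite -EFinM; congr EFin.
  rewrite normal_pdf01E mulrCA -expRD normal_pdfE ?gt_eqF// /normal_fun subr0.
  rewrite [RHS]mulrA; congr (_ * expR _); last first.
    by rewrite sg2; field; rewrite gt_eqF.
  rewrite /normal_peak expr1n mul1r -mulrnAr sqrtrM ?sqr_ge0// sqrtr_sqr gtr0_norm//.
  by rewrite invfM mulrA mulfV ?mul1r// gt_eqF.
rewrite integralZl//; last exact: integrable_normal_pdf.
by rewrite integral_normal_pdf mule1.
Qed.

End GaussianFourier.

(** * The chi-square distribution function against polynomials in exp(- s) *)

Section StepPolynomial.
Context {R : realType}.

Lemma bernoulli_ineq (t : R) (n : nat) : t <= 1 -> 1 - n%:R * t <= (1 - t) ^+ n.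
Proof.
move=> t1; elim: n => [|n IH]; first by rewrite mul0r subr0 expr0.
rewrite exprS -natr1; have [h|h] := leP 0 (1 - n%:R * t).
  have h2 : (1 - t) * (1 - n%:R * t) <= (1 - t) * (1 - t) ^+ n.
    by rewrite ler_wpM2l// subr_ge0.
  apply: le_trans h2.
  have : 0 <= n%:R * t ^+ 2 by rewrite mulr_ge0// sqr_ge0.
  rewrite expr2; nra.
have t0 : 0 < t.
  rewrite ltNge; apply/negP => t0; move: h; apply/negP; rewrite -leNgt subr_ge0.
  by apply: (@le_trans _ _ 0); rewrite ?ler01// mulr_ge0_le0.
apply: (@le_trans _ _ 0); first by rewrite mulrDl mul1r; lra.
by rewrite mulr_ge0 ?exprn_ge0 ?subr_ge0.
Qed.

(** A polynomial close to the indicator function of y >= b on the unit interval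
away from ]a, b[: the classical 1 - (1 - y^N)^M with M y^N small for y <= a and
large for y >= b. *)
Lemma step_polynomial (a b e : R) : 0 < a -> a < b -> 0 < e ->
  exists p : {poly R}, forall y, 0 <= y <= 1 ->
    [/\ 0 <= p.[y] <= 1, (b <= y -> 1 - e <= p.[y]) & (y <= a -> p.[y] <= e)].
Proof.
move=> a0 ab e0; have [a1|a1] := leP 1 a.
  exists 0 => y /andP[y0 y1]; rewrite horner0; split; [by rewrite lexx ler01| |].
    by move=> yb; lra.
  by move=> _; exact: ltW.
pose c := (a + b) / 2.
have c0 : 0 < c by rewrite /c; lra.
have ac : 0 < a / c < 1 by rewrite divr_gt0//= ltr_pdivrMr// /c; lra.
have b0 : 0 < b := lt_trans a0 ab.
have cb : 0 < c / b < 1 by rewrite divr_gt0//= ltr_pdivrMr// /c; lra.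
have pow_lt z : 0 < z < 1 -> \forall N \near \oo, z ^+ N <= e / 2.
  move=> /andP[z0 z1]; have /cvgr0Pnorm_le : z ^+ n @[n --> \oo] --> (0 : R).
    by apply: cvg_expr; rewrite gtr0_norm.
  move=> /(_ (e / 2)) /(_ (divr_gt0 e0 (ltr0Sn _ _))) ; apply: filterS => N.
  by rewrite ger0_norm// exprn_ge0// ltW.
near \oo => N.
have h1 : (a / c) ^+ N <= e / 2 by near: N; exact: pow_lt.
have h2 : a ^+ N <= e / 2 by near: N; apply: pow_lt; rewrite a0.
have h3 : (c / b) ^+ N <= e / 2 by near: N; exact: pow_lt.
pose M := (Num.trunc (c ^- N)).+1.
have cN0 : 0 < c ^- N by rewrite invr_gt0 exprn_gt0.
have /andP[M1 M2] : c ^- N <= M%:R <= c ^- N + 1.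
  have := Num.Theory.truncn_itv (ltW cN0) => /andP[m1 m2].
  by rewrite (ltW m2)/= /M -natr1 lerD2r.
exists (1 - (1 - 'X^N) ^+ M) => y /andP[y0 y1].
rewrite !hornerE.
have yN0 : 0 <= y ^+ N by rewrite exprn_ge0.
have yN1 : y ^+ N <= 1 by rewrite exprn_ile1.
have q0 : 0 <= (1 - y ^+ N) ^+ M by rewrite exprn_ge0// subr_ge0.
have q1 : (1 - y ^+ N) ^+ M <= 1 by rewrite exprn_ile1// ?subr_ge0//; lra.
split; first by lra.
- move=> yb.
  rewrite lerD2l lerN2.
  have k : 1 + M%:R * y ^+ N <= (1 + y ^+ N) ^+ M.
    have := @bernoulli_ineq (- y ^+ N) M; rewrite mulrN !opprK; apply.
    by apply: (@le_trans _ _ 0) => //; rewrite oppr_le0.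
  have k2 : (1 - y ^+ N) ^+ M * (1 + M%:R * y ^+ N) <= 1.
    apply: (@le_trans _ _ ((1 - y ^+ N) ^+ M * (1 + y ^+ N) ^+ M)).
      by rewrite ler_wpM2l.
    rewrite -exprMn exprn_ile1//; have : 0 <= y ^+ N * y ^+ N by rewrite mulr_ge0.
      nra.
    nra.
  have bN : 0 < b ^+ N by rewrite exprn_gt0.
  have k3 : b ^+ N <= y ^+ N by rewrite lerXn2r// nnegrE// ltW.
  have k4 : (b / c) ^+ N <= M%:R * y ^+ N.
    rewrite expr_div_n mulrC; apply: ler_pM => //; exact: ltW.
  have k5 : (1 - y ^+ N) ^+ M * (b / c) ^+ N <= 1.
    apply: le_trans k2; rewrite ler_wpM2l//; lra.
  have k6 : 0 < (b / c) ^+ N by rewrite exprn_gt0// divr_gt0.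
  have : (1 - y ^+ N) ^+ M <= (c / b) ^+ N.
    rewrite -[c / b]invf_div exprVn -[leRHS]mul1r.
    by rewrite ler_pdivlMr.
  lra.
- move=> ya.
  have k1 : y ^+ N <= a ^+ N by rewrite lerXn2r// nnegrE ltW.
  have k2 := bernoulli_ineq M yN1.
  have k3 : M%:R * y ^+ N <= (c ^- N + 1) * a ^+ N.
    by apply: ler_pM.
  have k4 : (c ^- N + 1) * a ^+ N = (a / c) ^+ N + a ^+ N.
    by rewrite (expr_div_n a c) mulrDl mul1r [X in X + _]mulrC.
  lra.
Unshelve. all: by end_near.
Qed.

End StepPolynomial.

Section ChiSquare.
Context {R : realType}.
Local Notation gamma := (normal_prob (0 : R) 1).

Definition chi_cdf (l : nat) (x : R) : \bar R := chi_square l [set s : R | s <= x].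

Lemma chi_cdf0 x : chi_cdf 0 x = (0 <= x)%R%:R%:E.
Proof. by rewrite /chi_cdf /= diracE; congr (_%:R%:E); rewrite mem_setE. Qed.

Lemma chi_cdfS l x : chi_cdf l.+1 x = (\int[gamma]_z chi_cdf l (x - z ^+ 2))%E.
Proof.
apply: eq_integral => z _; congr chi_square.
by apply/funext => s /=; rewrite lerBrDl.
Qed.

Lemma chi_cdf_props l :
  [/\ forall x, (0 <= chi_cdf l x <= 1)%E,
      {homo chi_cdf l : x y / x <= y >-> (x <= y)%E} &
      measurable_fun setT (chi_cdf l)].
Proof.
have meas (f : R -> \bar R) : (forall x, (0 <= f x <= 1)%E) ->
    {homo f : x y / x <= y >-> (x <= y)%E} -> measurable_fun setT f.
  move=> f01 fh; have ffin x : f x \is a fin_num.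
    by have /andP[f0 f1] := f01 x; rewrite ge0_fin_numE// (le_lt_trans f1)// ltry.
  rewrite (_ : f = EFin \o (fine \o f)); last by apply/funext => x /=; rewrite fineK.
  apply/measurable_EFinP; apply: nondecreasing_measurable => // x y xy.
  by apply: fine_le => //; exact: fh.
have comp (f : R -> \bar R) x : measurable_fun setT f ->
    measurable_fun setT (fun z : R => f (x - z ^+ 2)).
  move=> mf; apply: (measurableT_comp mf).
  by apply: measurable_funB => //; exact: measurable_funX.
elim: l => [|l [H1 H2 H3]].
  have H1 x : (0 <= chi_cdf 0 x <= 1)%E.
    by rewrite chi_cdf0 !lee_fin ler0n/= lern1 leq_b1.
  have H2 : {homo chi_cdf 0 : x y / x <= y >-> (x <= y)%E}.
    move=> x y xy; rewrite !chi_cdf0 lee_fin ler_nat.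
    by case: (leP 0 x) => // x0; rewrite (le_trans x0 xy).
  by split => //; exact: meas.
have H1' x : (0 <= chi_cdf l.+1 x <= 1)%E.
  rewrite chi_cdfS; apply/andP; split.
    by apply: integral_ge0 => z _; have /andP[] := H1 (x - z ^+ 2).
  apply: (@le_trans _ _ (\int[gamma]_z cst 1%E z)%E).
    apply: ge0_le_integral => //=.
    - by move=> z _; have /andP[] := H1 (x - z ^+ 2).
    - exact: comp.
    - by move=> z _; have /andP[] := H1 (x - z ^+ 2).
  by rewrite integral_cst//= mul1e probability_le1.
have H2' : {homo chi_cdf l.+1 : x y / x <= y >-> (x <= y)%E}.
  move=> x y xy; rewrite !chi_cdfS; apply: ge0_le_integral => //=.
  - by move=> z _; have /andP[] := H1 (x - z ^+ 2).
  - exact: comp.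
  - exact: comp.
  - by move=> z _; apply: H2; rewrite lerD2r.
by split => //; exact: meas.
Qed.

(** The Laplace transform of the chi-square law at integer points, extended
linearly to polynomials in exp(- s), after a shift by c. *)
Definition chi_poly (l : nat) (p : {poly R}) (c : R) : R :=
  \sum_(k < size p) p`_k * (Num.sqrt (1 + 2 * k%:R))^-1 ^+ l * expR (- (k%:R * c)).

Lemma chi_poly0 p c : chi_poly 0 p c = p.[expR (- c)].
Proof.
rewrite horner_coef; apply: eq_bigr => k _.
by rewrite expr0 mulr1 -expRM_natl mulrN.
Qed.

Lemma chi_polyS l p c :
  (\int[gamma]_z (chi_poly l p (c + z ^+ 2))%:E = (chi_poly l.+1 p c)%:E)%E /\
  (gamma : {measure set _ -> \bar R}).-integrable setT
    (fun z => (chi_poly l p (c + z ^+ 2))%:E).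
Proof.
have cont (k : nat) : measurable_fun setT (fun z : R => expR (- (k%:R * z ^+ 2))).
  apply: continuous_measurable_fun => x.
  apply: differentiable_continuous; apply/derivable1_diffP.
  by apply: ex_derive.
have int1 (k : nat) : (gamma : {measure set _ -> \bar R}).-integrable setT
    (fun z => (expR (- (k%:R * z ^+ 2)))%:E).
  apply: (bounded_integrable_normal01 (M := 1)) => // x.
  by rewrite ger0_norm ?expR_ge0// expR_le1 oppr_le0 mulr_ge0// sqr_ge0.
pose h (k : 'I_(size p)) (z : R) : \bar R :=
  ((p`_k * (Num.sqrt (1 + 2 * k%:R))^-1 ^+ l * expR (- (k%:R * c)))%:E *
   (expR (- (k%:R * z ^+ 2)))%:E)%E.
have ih k : (gamma : {measure set _ -> \bar R}).-integrable setT (h k).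
  exact: integrableZl.
have -> : (fun z => (chi_poly l p (c + z ^+ 2))%:E) = (fun z => \sum_k h k z)%E.
  apply/funext => z; rewrite sumEFin; congr EFin; apply: eq_bigr => k _.
  by rewrite -!mulrA -expRD mulrDr opprD.
split; last exact: integrable_sum.
rewrite integral_sum// -sumEFin; apply: eq_bigr => k _.
rewrite /h integralZl// gauss_laplace// -EFinM; congr EFin.
by rewrite exprSr; ring.
Qed.

(** An inequality between the indicator of s <= x and a polynomial in exp(- s)
propagates to the chi-square law by integrating one Gaussian square at a time;
c stands for the squares already present. *)
Lemma chi_cdf_le_poly l p x e :
  (forall s, 0 <= s -> (s <= x)%R%:R <= p.[expR (- s)] + e) ->
  forall c, 0 <= c -> (chi_cdf l (x - c) <= (chi_poly l p c + e)%:E)%E.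
Proof.
move=> H; elim: l => [|l IH] c c0.
  by rewrite chi_cdf0 chi_poly0 lee_fin subr_ge0 H.
have [H1 _ H3] := chi_cdf_props l.
have [E I] := chi_polyS l p c.
rewrite chi_cdfS EFinD -E.
have Ie : (gamma : {measure set _ -> \bar R}).-integrable setT (fun=> e%:E).
  exact: (bounded_integrable_normal01 (M := `|e|)).
have -> : e%:E = (\int[gamma]_z e%:E)%E.
  by rewrite integral_cst//= [X in (_ * X)%E]probability_setT mule1.
rewrite -integralD//.
have P z : (chi_cdf l (x - c - z ^+ 2) <= (chi_poly l p (c + z ^+ 2))%:E + e%:E)%E.
  by rewrite -EFinD -addrA -opprD IH// addr_ge0// sqr_ge0.
apply: ge0_le_integral => //=.
- by move=> z _; have /andP[] := H1 (x - c - z ^+ 2).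
- apply: (measurableT_comp H3).
  by apply: measurable_funB => //; exact: measurable_funX.
- by apply: emeasurable_funD => //; exact: measurable_int I.
Qed.

Lemma chi_poly_le_cdf l p x e :
  (forall s, 0 <= s -> p.[expR (- s)] <= (s <= x)%R%:R + e) ->
  forall c, 0 <= c -> ((chi_poly l p c)%:E <= chi_cdf l (x - c) + e%:E)%E.
Proof.
move=> H; elim: l => [|l IH] c c0.
  by rewrite chi_cdf0 chi_poly0 -EFinD lee_fin subr_ge0 H.
have [H1 _ H3] := chi_cdf_props l.
have [E I] := chi_polyS l p c.
have Ie : (gamma : {measure set _ -> \bar R}).-integrable setT (fun=> e%:E).
  exact: (bounded_integrable_normal01 (M := `|e|)).
have mG : measurable_fun setT (fun z : R => chi_cdf l (x - c - z ^+ 2)).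
  apply: (measurableT_comp H3).
  by apply: measurable_funB => //; exact: measurable_funX.
have IG : (gamma : {measure set _ -> \bar R}).-integrable setT
    (fun z => chi_cdf l (x - c - z ^+ 2)).
  apply: (@le_integrable _ _ _ _ setT measurableT _ (cst 1%E)) => //.
    by move=> z _ /=; have /andP[g0 g1] := H1 (x - c - z ^+ 2); rewrite gee0_abs// normr1.
  exact: (bounded_integrable_normal01 (f := fun=> 1) (M := `|1|)).
rewrite chi_cdfS -E.
have -> : e%:E = (\int[gamma]_z e%:E)%E.
  by rewrite integral_cst//= [X in (_ * X)%E]probability_setT mule1.
rewrite -integralD//.
apply: le_integral => //; first exact: integrableD.
move=> z _; rewrite -addrA -opprD; apply: IH.
by rewrite addr_ge0// sqr_ge0.
Qed.

End ChiSquare.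

(** * Central limit theorem for the squared norm in a triangular array *)

Section TriangularArray.
Context {R : realType} {A : finType} (l : nat).
Variable q : forall n, 'I_n -> A -> R.
Hypothesis q_ge0 : forall n (i : 'I_n) a, 0 <= q i a.
Hypothesis q_sum : forall n (i : 'I_n), \sum_a q i a = 1.
Variable f : forall n, 'I_l -> 'I_n -> A -> R.
Variable tau : nat -> R.
Hypothesis f_centred : \forall n \near \oo, forall a (i : 'I_n),
  mexp (@q n) i (@f n a i) = 0.
Hypothesis f_cov : \forall n \near \oo, forall a b : 'I_l,
  \sum_(i < n) mexp (@q n) i (fun y => @f n a i y * @f n b i y) = (a == b)%:R.
Hypothesis f_small : \forall n \near \oo, forall a (i : 'I_n) y, `|@f n a i y| <= tau n.
Hypothesis tau0 : tau n @[n --> \oo] --> (0 : R).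

Local Notation gamma := (normal_prob (0 : R) 1).
Local Notation Ex n := (pexp (@q n)).

Definition array_sum n (a : 'I_l) (o : {ffun 'I_n -> A}) : R :=
  \sum_i @f n a i (o i).

Definition array_sqnorm n (o : {ffun 'I_n -> A}) : R :=
  \sum_a (@array_sum n a o) ^+ 2.

(** Every linear combination of the coordinates of the row sum is a sum of
small independent centred variables of total variance |t|^2. *)
Lemma cvg_array_cos (t : 'I_l -> R) (theta : R) :
  Ex n (fun o => cos (\sum_a t a * @array_sum n a o + theta)) @[n --> \oo] -->
  expR (- ((\sum_a t a ^+ 2) / 2)) * cos theta.
Proof.
pose K := \sum_a `|t a|; pose s := \sum_a t a ^+ 2.
have K0 : 0 <= K by exact: sumr_ge0.
have h1 : K * tau n @[n --> \oo] --> (0 : R).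
  by rewrite -[0](mulr0 K); exact: cvgMr.
have h2 : K * tau n * s @[n --> \oo] --> (0 : R).
  by rewrite -[0](mul0r s); exact: cvgMl.
apply/cvgrPdist_le => e e0.
move/cvgr0Pnorm_le : h1 => /(_ _ ltr01) h1.
move/cvgr0Pnorm_le : h2 => /(_ _ e0) h2.
near=> n.
have fc : forall a (i : 'I_n), mexp (@q n) i (@f n a i) = 0 by near: n; exact: f_centred.
have fv : forall a b : 'I_l,
  \sum_(i < n) mexp (@q n) i (fun y => @f n a i y * @f n b i y) = (a == b)%:R.
  by near: n; exact: f_cov.
have fs : forall a (i : 'I_n) y, `|@f n a i y| <= tau n by near: n; exact: f_small.
have k1 : `|K * tau n| <= 1 by near: n; exact: h1.
have k2 : `|K * tau n * s| <= e by near: n; exact: h2.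
rewrite distrC.
pose zeta (i : 'I_n) y := \sum_a t a * @f n a i y.
have -> : Ex n (fun o => cos (\sum_a t a * @array_sum n a o + theta)) =
    Ex n (fun o => cos (\sum_i zeta i (o i) + theta)).
  apply: eq_bigr => o _; congr (_ * cos (_ + _)).
  rewrite /zeta exchange_big/=; apply: eq_bigr => a _.
  by rewrite mulr_sumr.
have z0 i : mexp (@q n) i (zeta i) = 0.
  rewrite /mexp /zeta; under eq_bigr do rewrite mulr_sumr.
  rewrite exchange_big big1// => a _.
  transitivity (t a * mexp (@q n) i (@f n a i)); last by rewrite fc mulr0.
  by rewrite /mexp mulr_sumr; apply: eq_bigr => y _; rewrite mulrCA.
have zs : \sum_i mexp (@q n) i (fun y => zeta i y ^+ 2) = s.
  transitivity (\sum_a \sum_b t a * t b *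
      \sum_(i < n) mexp (@q n) i (fun y => @f n a i y * @f n b i y)).
    under [RHS]eq_bigr do under eq_bigr do rewrite mulr_sumr.
    under [RHS]eq_bigr do rewrite exchange_big/=.
    rewrite [RHS]exchange_big/=; apply: eq_bigr => i _.
    rewrite /mexp.
    under [RHS]eq_bigr do under eq_bigr do rewrite mulr_sumr.
    under [RHS]eq_bigr do rewrite exchange_big/=.
    rewrite [RHS]exchange_big/=; apply: eq_bigr => y _.
    rewrite expr2 /zeta mulr_suml mulr_sumr; apply: eq_bigr => a _.
    rewrite !mulr_sumr; apply: eq_bigr => b _.
    by ring.
  apply: eq_bigr => a _; rewrite (bigD1 a)//= fv eqxx mulr1 expr2 big1 ?addr0//.
  by move=> b ba; rewrite fv eq_sym (negbTE ba) mulr0.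
have zt i y : `|zeta i y| <= `|K * tau n|.
  apply: le_trans (ler_norm _); rewrite /K mulr_suml.
  apply: le_trans (ler_norm_sum _ _ _) _; apply: ler_sum => a _.
  by rewrite normrM ler_wpM2l.
have := @pexp_cos_gauss R _ A (@q n) (@q_ge0 n) (@q_sum n) zeta _ theta
  (introT andP (conj (normr_ge0 _) k1)) zt z0.
rewrite /= zs => /le_trans; apply; apply: le_trans k2.
by rewrite [leRHS]normrM ler_wpM2l// ler_norm.
Unshelve. all: by end_near.
Qed.

(** Gaussian linearisation: exp(- s u^2) cos A is the average over a Gaussian g of
cos(sqrt(2 s) g u + A), so that squares are traded one coordinate at a
time for characteristic functions. *)
Lemma cvg_array_laplace_partial (s : R) (k : nat) : 0 <= s -> (k <= l)%N ->
  forall (t : 'I_l -> R) (theta : R), (forall a : 'I_l, (a < k)%N -> t a = 0) ->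
  Ex n (fun o => cos (\sum_a t a * @array_sum n a o + theta) *
    expR (- (s * \sum_(a < l | (a < k)%N) (@array_sum n a o) ^+ 2))) @[n --> \oo] -->
  expR (- ((\sum_a t a ^+ 2) / 2)) * cos theta * (Num.sqrt (1 + 2 * s))^-1 ^+ k.
Proof.
move=> s0; elim: k => [|k IH] kl t theta tk.
  rewrite expr0 mulr1; have := @cvg_array_cos t theta; apply: cvg_trans.
  apply: near_eq_cvg; apply: nearW => n; apply: eq_bigr => o _; congr (_ * _).
  by rewrite [X in expR (- (s * X))]big_pred0 ?mulr0 ?oppr0 ?expR0 ?mulr1.
pose ko := Ordinal kl; pose r := Num.sqrt (2 * s).
have r2 : r ^+ 2 = 2 * s by rewrite sqr_sqrtr// mulr_ge0.
pose tg (g : R) (a : 'I_l) := t a + (a == ko)%:R * (r * g).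
pose H n (g : R) := Ex n (fun o => cos (\sum_a tg g a * @array_sum n a o + theta) *
    expR (- (s * \sum_(a < l | (a < k)%N) (@array_sum n a o) ^+ 2))).
have tg0 g (a : 'I_l) : (a < k)%N -> tg g a = 0.
  move=> ak; rewrite /tg tk 1?ltnW// add0r -val_eqE/= ltn_eqF// mul0r//.
have tgE n g (o : {ffun 'I_n -> A}) : \sum_a tg g a * @array_sum n a o =
    (r * @array_sum n ko o) * g + \sum_a t a * @array_sum n a o.
  rewrite /tg; under eq_bigr do rewrite mulrDl.
  rewrite big_split/= addrC; congr (_ + _).
  rewrite (bigD1 ko)//= eqxx mul1r big1 ?addr0; first by ring.
  by move=> a /negbTE ->; rewrite !mul0r.
have tg2 g : \sum_a tg g a ^+ 2 = \sum_a t a ^+ 2 + 2 * (s * g ^+ 2).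
  rewrite (bigD1 ko)//= [in RHS](bigD1 ko)//= /tg eqxx tk//= expr0n/= !add0r mul1r.
  rewrite exprMn r2 mulrA addrC; congr (_ + _).
  by apply: eq_bigr => a /negbTE ->; rewrite mul0r addr0.
have bnd n (o : {ffun 'I_n -> A}) : 0 <= expR (- (s * \sum_(a < l | (a < k)%N)
    (@array_sum n a o) ^+ 2)) <= 1.
  rewrite expR_ge0 expR_le1 oppr_le0 mulr_ge0// sumr_ge0// => a _.
  exact: sqr_ge0.
have cosm (b c : R) : measurable_fun setT (fun g : R => cos (b * g + c)).
  apply: continuous_measurable_fun => x.
  apply: differentiable_continuous; apply/derivable1_diffP.
  by apply: ex_derive.
(* the coefficient of each outcome in the finite sum defining the expectation *)
pose h n (o : {ffun 'I_n -> A}) := pweight (@q n) o *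
  expR (- (s * \sum_(a < l | (a < k)%N) (@array_sum n a o) ^+ 2)).
have HE n g : (H n g)%:E = (\sum_o (h n o)%:E * (cos ((r * @array_sum n ko o) * g +
    (\sum_a t a * @array_sum n a o + theta)))%:E)%E.
  rewrite sumEFin; congr EFin; apply: eq_bigr => o _.
  by rewrite tgE addrA [cos _ * _]mulrC mulrA.
have icos (b c : R) : (gamma : {measure set _ -> \bar R}).-integrable setT
    (fun g => (cos (b * g + c))%:E).
  by apply: (bounded_integrable_normal01 (M := 1)) => // x; exact: cos_max.
have stepE n : (Ex n (fun o => cos (\sum_a t a * @array_sum n a o + theta) *
    expR (- (s * \sum_(a < l | (a < k.+1)%N) (@array_sum n a o) ^+ 2))))%:E =
    (\int[gamma]_g (H n g)%:E)%E.
  under eq_integral do rewrite HE.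
  rewrite integral_sum//; last by move=> o; exact: integrableZl.
  rewrite /pexp -sumEFin; apply: eq_bigr => o _.
  rewrite integralZl// gauss_fourier -EFinM /h; congr EFin.
  rewrite [X in expR (- (s * X))](bigD1 ko)//=.
  rewrite [X in expR (- (s * (_ + X)))](eq_bigl (fun a : 'I_l => (a < k)%N)); last first.
    by move=> a; rewrite -val_eqE/= andbC -ltn_neqAle.
  rewrite mulrDr opprD expRD exprMn r2.
  have -> : 2 * s * @array_sum n ko o ^+ 2 / 2 = s * @array_sum n ko o ^+ 2 by field.
  by ring.
have Hm n : measurable_fun setT (fun g => (H n g)%:E).
  under eq_fun do rewrite HE.
  apply: emeasurable_sum => o.
  exact: measurable_int (integrableZl measurableT _ (icos _ _)).
pose Hlim (g : R) := expR (- ((\sum_a t a ^+ 2) / 2)) * cos theta *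
  (Num.sqrt (1 + 2 * s))^-1 ^+ k * expR (- (s * g ^+ 2)).
have Hcv g : H n g @[n --> \oo] --> Hlim g.
  have := IH (ltnW kl) (tg g) theta (tg0 g); rewrite tg2.
  rewrite (_ : (_ + 2 * _) / 2 = (\sum_a t a ^+ 2) / 2 + s * g ^+ 2); last by field.
  rewrite opprD expRD => hcv.
  rewrite (_ : Hlim g = expR (- ((\sum_a t a ^+ 2) / 2)) * expR (- (s * g ^+ 2)) *
    cos theta * (Num.sqrt (1 + 2 * s))^-1 ^+ k)//.
  by rewrite /Hlim; ring.
have Hbd n g : `|H n g| <= 1.
  apply: pexp_norm_le => // o; rewrite normrM.
  by have /andP[? ?] := bnd n o; rewrite -[leRHS]mulr1 ler_pM ?cos_max// ger0_norm.
have ilap : (gamma : {measure set _ -> \bar R}).-integrable setT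
    (fun g => (expR (- (s * g ^+ 2)))%:E).
  apply: (bounded_integrable_normal01 (M := 1)) => [|x]; last first.
    by rewrite ger0_norm ?expR_ge0// expR_le1 oppr_le0 mulr_ge0// sqr_ge0.
  apply: continuous_measurable_fun => x.
  apply: differentiable_continuous; apply/derivable1_diffP.
  by apply: ex_derive.
have HlimE g : (Hlim g)%:E = ((expR (- ((\sum_a t a ^+ 2) / 2)) * cos theta *
  (Num.sqrt (1 + 2 * s))^-1 ^+ k)%:E * (expR (- (s * g ^+ 2)))%:E)%E by [].
have HcvE : {ae gamma, forall g, setT g ->
    (fun n => (H n g)%:E) @ \oo --> (Hlim g)%:E}.
  by apply: aeW => g _; apply: cvg_EFin; [exact: nearW|exact: Hcv].
have HbdE : {ae gamma, forall g n, setT g -> (`|(H n g)%:E| <= cst 1 g)%E}.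
  by apply: aeW => g n _; rewrite /= lee_fin.
have i1 : (gamma : {measure set _ -> \bar R}).-integrable setT (cst 1%E).
  by apply: (bounded_integrable_normal01 (M := 1) (f := fun=> 1)) => // x; rewrite normr1.
have [_ _] := @dominated_convergence _ _ _ gamma setT measurableT
  (fun n g => (H n g)%:E) (fun g => (Hlim g)%:E) (cst 1%E) Hm
  (measurable_int _ (integrableZl measurableT _ ilap)) HcvE i1 HbdE.
have -> : (\int[gamma]_g (Hlim g)%:E)%E = (expR (- ((\sum_a t a ^+ 2) / 2)) * cos theta *
    (Num.sqrt (1 + 2 * s))^-1 ^+ k.+1)%:E.
  under eq_integral do rewrite HlimE.
  by rewrite integralZl// gauss_laplace// -EFinM exprSr mulrA.
under eq_fun do rewrite -stepE.
by move/fine_cvg.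
Qed.

Lemma cvg_array_laplace (s : R) : 0 <= s ->
  Ex n (fun o => expR (- (s * @array_sqnorm n o))) @[n --> \oo] -->
  (Num.sqrt (1 + 2 * s))^-1 ^+ l.
Proof.
move=> s0; have := @cvg_array_laplace_partial s l s0 (leqnn l) (fun=> 0) 0 (fun _ _ => erefl).
rewrite cos0 mulr1 [X in expR (- (X / 2))]big1 => [|a _]; last by rewrite expr0n.
rewrite mul0r oppr0 expR0 mul1r; apply: cvg_trans; apply: near_eq_cvg.
apply: nearW => n; apply: eq_bigr => o _; congr (_ * _).
rewrite [X in cos (X + _)]big1 => [|a _]; last by rewrite mul0r.
by rewrite addr0 cos0 mul1r; congr (expR (- (_ * _))); apply: eq_bigl => a; rewrite ltn_ord.
Qed.

Lemma cvg_array_poly (p : {poly R}) :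
  Ex n (fun o => p.[expR (- @array_sqnorm n o)]) @[n --> \oo] --> chi_poly l p 0.
Proof.
have -> : (fun n => Ex n (fun o => p.[expR (- @array_sqnorm n o)])) =
    (fun n => \sum_(k < size p) p`_k * Ex n (fun o => expR (- (k%:R * @array_sqnorm n o)))).
  apply/funext => n; under eq_bigr do rewrite -pexpZ.
  rewrite -pexp_sum; apply: eq_bigr => o _; congr (_ * _).
  rewrite horner_coef; apply: eq_bigr => k _.
  by rewrite -expRM_natl mulrN.
rewrite /chi_poly; apply: cvg_big => [|k _]; first exact: add_continuous.
rewrite mulr0 oppr0 expR0 mulr1; apply: cvgMr.
exact: cvg_array_laplace.
Qed.

(** The distribution function of the squared norm is squeezed between
expectations of polynomials in exp(- s), which converge to those of the
chi-square law; the shift eta is the width of the ramp of the polynomial. *)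
Lemma array_sqnorm_cdf (x eta e : R) : 0 < eta -> 0 < e ->
  \forall n \near \oo,
    ((pprob (@q n) (fun o => @array_sqnorm n o <= x))%:E <= chi_cdf l (x + eta) + e%:E)%E /\
    (chi_cdf l x <= (pprob (@q n) (fun o => @array_sqnorm n o <= x + eta) + e)%:E)%E.
Proof.
move=> eta0 e0.
have ab : expR (- (x + eta)) < expR (- x) by rewrite ltr_expR; lra.
have e3 : 0 < e / 3 by lra.
have [p pP] := step_polynomial (expR_gt0 (- (x + eta))) ab e3.
have exp01 s : 0 <= s -> 0 <= expR (- s) <= 1.
  by move=> s_ge0; rewrite expR_ge0/= expR_le1 oppr_le0.
have up s : 0 <= s -> (s <= x)%R%:R <= p.[expR (- s)] + e / 3.
  move=> /exp01 /pP [/andP[p0 p1] h _]; case: (leP s x) => sx /=; last by lra.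
  by have := h; rewrite ler_expR lerN2 => /(_ sx); lra.
have dn s : 0 <= s -> p.[expR (- s)] <= (s <= x + eta)%R%:R + e / 3.
  move=> /exp01 /pP [/andP[p0 p1] _ h]; case: (leP s (x + eta)) => sx /=; first by lra.
  by have := h; rewrite ler_expR lerN2 => /(_ (ltW sx)); lra.
have c1 : (chi_cdf l x <= (chi_poly l p 0 + e / 3)%:E)%E.
  by have := chi_cdf_le_poly l up (lexx 0); rewrite subr0.
have c2 : ((chi_poly l p 0)%:E <= chi_cdf l (x + eta) + (e / 3)%:E)%E.
  by have := chi_poly_le_cdf l dn (lexx 0); rewrite subr0.
have /cvgrPdist_le /(_ _ e3) := @cvg_array_poly p.
apply: filterS => n; rewrite ler_norml => /andP[h1 h2].
have sq0 (o : {ffun 'I_n -> A}) : 0 <= @array_sqnorm n o.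
  by apply: sumr_ge0 => a _; rewrite sqr_ge0.
have u1 : pprob (@q n) (fun o => @array_sqnorm n o <= x) <=
    Ex n (fun o => p.[expR (- @array_sqnorm n o)]) + e / 3.
  rewrite -(pexp_cst (q_sum (n:=n)) (e / 3)) -pexpD.
  by apply: ler_pexp => // o; exact: up.
have u2 : Ex n (fun o => p.[expR (- @array_sqnorm n o)]) <=
    pprob (@q n) (fun o => @array_sqnorm n o <= x + eta) + e / 3.
  rewrite -(pexp_cst (q_sum (n:=n)) (e / 3)) -pexpD.
  by apply: ler_pexp => // o; exact: dn.
split.
- apply: (@le_trans _ _ ((chi_poly l p 0)%:E + (2 * (e / 3))%:E)%E).
    by rewrite -EFinD lee_fin; lra.
  apply: le_trans (leeD c2 (lexx _)) _.
  rewrite -addeA leeD2l// -EFinD lee_fin; lra.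
- by apply: (le_trans c1); rewrite lee_fin; lra.
Qed.

End TriangularArray.

(** * The finite law of the binary clusters *)

Section FiniteValued.
Context {R : realType} d (T : measurableType d) (P : probability T R).
Context {F : finType} (g : T -> F).
Hypothesis mg : forall o, measurable [set w | g w = o].

Definition fin_mass (o : F) : R := fine (P [set w | g w = o]).

Lemma fin_massE o : (fin_mass o)%:E = P [set w | g w = o].
Proof. by rewrite fineK// fin_num_measure. Qed.

Lemma fin_mass_ge0 o : 0 <= fin_mass o.
Proof. by rewrite -lee_fin fin_massE. Qed.

Let finite_valuedE (h : F -> R) :
  (fun w => (h (g w))%:E) =
  (fun w => \sum_o (h o)%:E * (\1_[set w | g w = o] w)%:E)%E.
Proof.
apply/funext => w; rewrite (bigD1 (g w))//= indicE mem_set// mule1.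
rewrite big1 ?adde0// => o og; rewrite indicE memNset ?mule0//= => gw.
by rewrite gw eqxx in og.
Qed.

Let int1 o : P.-integrable setT (fun w => (\1_[set w | g w = o] w)%:E).
Proof.
apply/integrableP; split; first by apply/measurable_EFinP; exact: measurable_indic.
under eq_integral do rewrite /= ger0_norm//.
rewrite integral_indic// setIT.
by apply: (le_lt_trans (probability_le1 P (mg o))); rewrite ltry.
Qed.

Lemma expectation_finite_valued (h : F -> R) :
  ('E_P[fun w => h (g w)] = (\sum_o fin_mass o * h o)%:E)%E.
Proof.
rewrite unlock finite_valuedE integral_sum//; last first.
  by move=> o; exact: integrableZl.
rewrite -sumEFin; apply: eq_bigr => o _.
by rewrite integralZl// integral_indic// setIT EFinM fin_massE muleC.
Qed.

Lemma measurable_finite_valued (B : pred F) : measurable [set w | B (g w)].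
Proof.
rewrite (_ : [set w | B (g w)] = \bigcup_(o in [set` B]) [set w | g w = o]).
  by apply: fin_bigcup_measurable.
apply/seteqP; split => [w Bw|w]; first by exists (g w).
by case=> o oB /= ->.
Qed.

Lemma prob_finite_valued (B : pred F) :
  P [set w | B (g w)] = (\sum_o fin_mass o * (B o)%:R)%:E.
Proof.
rewrite -expectation_finite_valued -expectation_indic; last first.
  exact: measurable_finite_valued.
congr expectation; apply/funext => w; rewrite indicE.
case: (boolP (B (g w))) => Bw; first by rewrite mem_set.
by rewrite memNset//=; exact/negP.
Qed.

Lemma fin_mass_sum : \sum_o fin_mass o = 1.
Proof.
apply: EFin_inj; have := prob_finite_valued xpredT.
rewrite (_ : [set w | _] = setT); last by apply/seteqP; split.
by rewrite probability_setT => ->; congr EFin; apply: eq_bigr => o _; rewrite mulr1.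
Qed.

End FiniteValued.

Section BinaryClusters.
Context {R : realType} d (T : measurableType d) (P : probability T R) (n m : nat).
Variable Y : 'I_n -> 'I_m -> {RV P >-> R}.
Hypothesis Y_binary : forall i j w, Y i j w = 0 \/ Y i j w = 1.
Hypothesis Y_indep : independent_vectors P (fun i j => Y i j : T -> R).

Local Notation A := {ffun 'I_m -> bool}.

Definition bits (i : 'I_n) (w : T) : A := [ffun j => Y i j w == 1].
Definition outcome (w : T) : {ffun 'I_n -> A} := [ffun i => bits i w].
Definition cluster_law (i : 'I_n) : A -> R := fin_mass P (bits i).

Lemma bitsE i j w : Y i j w = (bits i w j)%:R.
Proof.
rewrite ffunE; case: (Y_binary i j w) => ->; last by rewrite eqxx.
by rewrite eq_sym oner_eq0.
Qed.

Let bits_cell i (a : A) :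
  [set w | bits i w = a] = \bigcap_(j in [set: 'I_m]) (Y i j @^-1` [set (a j)%:R]).
Proof.
apply/seteqP; split => [w /= <- j _ /=|w /= Ha]; first by rewrite bitsE.
apply/ffunP => j; have := Ha j I; rewrite /= bitsE => /eqP.
by rewrite eqr_nat; case: (bits i w j); case: (a j).
Qed.

Lemma measurable_bits i a : measurable [set w | bits i w = a].
Proof.
by rewrite bits_cell; apply: fin_bigcap_measurable.
Qed.

(* The cell of a value of the cluster is an event of the generated sigma-algebra
that appears in the independence hypothesis. *)
Let sigma_bits i a : g_sigma_preimage (fun j => Y i j : T -> R) [set w | bits i w = a].
Proof.
rewrite bits_cell /g_sigma_preimage; set G := \big[_/_]_(_ < _) _.
apply: (@fin_bigcap_measurable _ (g_sigma_algebraType G)) => // j _.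
apply: sub_sigma_algebra; rewrite /G (bigD1 j)//=; left.
by exists [set (a j)%:R] => //; rewrite setTI.
Qed.

Let outcome_cell o : [set w | outcome w = o] =
  \bigcap_(i in [set` [set: 'I_n]%SET]) [set w | bits i w = o i].
Proof.
apply/seteqP; split => [w /= <- i _ /=|w /= Ha]; first by rewrite ffunE.
by apply/ffunP => i; rewrite ffunE Ha//= inE.
Qed.

Lemma measurable_outcome o : measurable [set w | outcome w = o].
Proof.
rewrite outcome_cell; apply: fin_bigcap_measurable => // i _.
exact: measurable_bits.
Qed.

Lemma cluster_law_ge0 i a : 0 <= cluster_law i a.
Proof. by apply: fin_mass_ge0; exact: measurable_bits. Qed.

Lemma cluster_law_sum i : \sum_a cluster_law i a = 1.
Proof. by apply: fin_mass_sum; exact: measurable_bits. Qed.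

(** Independence of the clusters: the outcome of the whole sample has the
product law. *)
Lemma outcome_mass o : fin_mass P outcome o = pweight cluster_law o.
Proof.
apply: EFin_inj; rewrite fin_massE; last exact: measurable_outcome.
rewrite outcome_cell (Y_indep (J := [set: 'I_n]%SET)); last by move=> i _; exact: sigma_bits.
rewrite /pweight -prodEFin; apply: eq_big => [i|i _]; first by rewrite inE.
by rewrite /cluster_law fin_massE//; exact: measurable_bits.
Qed.

Lemma prob_outcome (B : pred {ffun 'I_n -> A}) :
  P [set w | B (outcome w)] = (pprob cluster_law B)%:E.
Proof.
rewrite prob_finite_valued; last exact: measurable_outcome.
by congr EFin; apply: eq_bigr => o _; rewrite outcome_mass.
Qed.

Lemma measurable_outcome_pred (B : pred {ffun 'I_n -> A}) :
  measurable [set w | B (outcome w)].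
Proof. by apply: measurable_finite_valued; exact: measurable_outcome. Qed.

Section Moments.
Variables (i : 'I_n) (mean : 'I_m -> R).
Hypothesis Y_mean : forall j, ('E_P[Y i j] = (mean j)%:E)%E.

Lemma mexp_bits_centred j :
  mexp cluster_law i (fun a => (a j)%:R - mean j) = 0.
Proof.
have h : mexp cluster_law i (fun a => (a j)%:R) = mean j.
  apply: EFin_inj; rewrite -Y_mean -expectation_finite_valued; last exact: measurable_bits.
  by congr expectation; apply/funext => w; rewrite bitsE.
transitivity (mexp cluster_law i (fun a => (a j)%:R) - \sum_a cluster_law i a * mean j).
  by rewrite /mexp -sumrB; apply: eq_bigr => a _; rewrite mulrBr.
by rewrite -mulr_suml cluster_law_sum mul1r h subrr.
Qed.

Lemma covariance_bits j k : covariance P (Y i j) (Y i k) =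
  (mexp cluster_law i (fun a => ((a j)%:R - mean j) * ((a k)%:R - mean k)))%:E.
Proof.
rewrite unlock !Y_mean. rewrite /= -expectation_finite_valued; last exact: measurable_bits.
congr expectation; apply/funext => w.
by rewrite -[LHS]/((Y i j w - mean j) * (Y i k w - mean k)) !bitsE.
Qed.

Lemma variance_bits j : ('V_P[Y i j])%E = (mean j * (1 - mean j))%:E.
Proof.
rewrite /variance covariance_bits; congr EFin.
have := mexp_bits_centred j.
have -> : mexp cluster_law i (fun a => ((a j)%:R - mean j) * ((a j)%:R - mean j)) =
  (1 - 2 * mean j) * mexp cluster_law i (fun a => (a j)%:R - mean j)
  + \sum_a cluster_law i a * (mean j * (1 - mean j)).
  rewrite /mexp mulr_sumr -big_split/=; apply: eq_bigr => a _.
  by case: (a j) => /=; ring.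
by move=> ->; rewrite -mulr_suml cluster_law_sum mul1r mulr0 add0r.
Qed.

Lemma mexp_bits_cov (C : 'M[R]_m) j k :
  (forall j, 0 < mean j < 1) ->
  correlation P (Y i j) (Y i k) = C j k ->
  mexp cluster_law i (fun a => ((a j)%:R - mean j) * ((a k)%:R - mean k)) =
  Num.sqrt (mean j * (1 - mean j)) * Num.sqrt (mean k * (1 - mean k)) * C j k.
Proof.
move=> mean01 <-; rewrite /correlation covariance_bits !variance_bits /=.
have v0 j' : Num.sqrt (mean j' * (1 - mean j')) != 0.
  by have /andP[? ?] := mean01 j'; rewrite gt_eqF// sqrtr_gt0 mulr_gt0// subr_gt0.
by field; rewrite !v0.
Qed.

End Moments.
End BinaryClusters.

(** * Measurability of the Wald statistic *)

Section MeasurableMatrices.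
Context {R : realType} d (T : measurableType d).
Implicit Types a b c : nat.

(** The formula through the real power of the absolute value is also valid at 0,
where the factor f w makes it vanish. *)
Lemma measurable_inv (f : T -> R) :
  measurable_fun setT f -> measurable_fun setT (fun w => (f w)^-1).
Proof.
move=> mf.
rewrite (_ : (fun w => (f w)^-1) = (fun w => f w * (`|f w| `^ (-1)) ^+ 2)).
  apply: measurable_funM => //; apply: measurable_funX.
  apply: (measurableT_comp (measurable_powR _)).
  exact: measurableT_comp.
apply/funext => w; rewrite powR_inv1// -normfV real_normK ?num_real//.
have [->|fw] := eqVneq (f w) 0; first by rewrite invr0 mul0r.
by field.
Qed.

Lemma measurable_sqrt (f : T -> R) :
  measurable_fun setT f -> measurable_fun setT (fun w => Num.sqrt (f w)).
Proof.
have ms : measurable_fun [set: R] (@Num.sqrt R).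
  by apply: nondecreasing_measurable => // x y xy; exact: ler_wsqrtr.
exact: measurableT_comp ms.
Qed.

Lemma measurable_fsum (I : finType) (f : I -> T -> R) :
  (forall i, measurable_fun setT (f i)) ->
  measurable_fun setT (fun w => \sum_i f i w).
Proof. by move=> mf; exact: measurable_sum. Qed.

Lemma measurable_fprod (I : finType) (f : I -> T -> R) :
  (forall i, measurable_fun setT (f i)) ->
  measurable_fun setT (fun w => \prod_i f i w).
Proof. by move=> mf; exact: measurable_prod. Qed.

Lemma measurable_mx_cst a b (A : 'M[R]_(a, b)) : measurable_mx (fun _ : T => A).
Proof. by move=> i j. Qed.

Lemma measurable_mx_add a b (A B : T -> 'M[R]_(a, b)) :
  measurable_mx A -> measurable_mx B -> measurable_mx (fun w => A w + B w).
Proof.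
move=> mA mB i j; under eq_fun do rewrite mxE.
exact: measurable_funD.
Qed.

Lemma measurable_mx_opp a b (A : T -> 'M[R]_(a, b)) :
  measurable_mx A -> measurable_mx (fun w => - A w).
Proof.
move=> mA i j; under eq_fun do rewrite mxE.
exact: measurableT_comp.
Qed.

Lemma measurable_mx_sub a b (A B : T -> 'M[R]_(a, b)) :
  measurable_mx A -> measurable_mx B -> measurable_mx (fun w => A w - B w).
Proof. by move=> mA mB; apply: measurable_mx_add => //; exact: measurable_mx_opp. Qed.

Lemma measurable_mx_mul a b c (A : T -> 'M[R]_(a, b)) (B : T -> 'M[R]_(b, c)) :
  measurable_mx A -> measurable_mx B -> measurable_mx (fun w => A w *m B w).
Proof.
move=> mA mB i j; under eq_fun do rewrite mxE.
by apply: measurable_fsum => k; exact: measurable_funM.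
Qed.

Lemma measurable_mx_sum (I : finType) a b (A : I -> T -> 'M[R]_(a, b)) :
  (forall i, measurable_mx (A i)) -> measurable_mx (fun w => \sum_i A i w).
Proof.
move=> mA i j; under eq_fun do rewrite summxE.
by apply: measurable_fsum => k; exact: mA.
Qed.

Lemma measurable_mx_tr a b (A : T -> 'M[R]_(a, b)) :
  measurable_mx A -> measurable_mx (fun w => (A w)^T).
Proof. by move=> mA i j; under eq_fun do rewrite mxE; exact: mA. Qed.

Lemma measurable_mx_diag a (A : T -> 'rV[R]_a) :
  measurable_mx A -> measurable_mx (fun w => diag_mx (A w)).
Proof.
move=> mA i j; under eq_fun do rewrite mxE -mulr_natr.
by apply: measurable_funM.
Qed.

Lemma measurable_mx_map a b (A : T -> 'M[R]_(a, b)) (f : R -> R) :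
  (forall g : T -> R, measurable_fun setT g -> measurable_fun setT (f \o g)) ->
  measurable_mx A -> measurable_mx (fun w => map_mx f (A w)).
Proof. by move=> mf mA i j; under eq_fun do rewrite mxE; apply: mf; exact: mA. Qed.

Lemma measurable_det a (A : T -> 'M[R]_a) :
  measurable_mx A -> measurable_fun setT (fun w => \det (A w)).
Proof.
move=> mA; apply: measurable_fsum => s; apply: measurable_funM => //.
by apply: measurable_fprod => i; exact: mA.
Qed.

Lemma measurable_mx_adj a (A : T -> 'M[R]_a) :
  measurable_mx A -> measurable_mx (fun w => \adj (A w)).
Proof.
move=> mA i j; under eq_fun do rewrite mxE.
apply: measurable_funM => //; apply: measurable_det => k k'.
by under eq_fun do rewrite !mxE; exact: mA.
Qed.

(** The formula with the adjugate matrix, completed by a term that vanishes unless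
the determinant is 0: there the inverse is the matrix itself by convention. *)
Lemma measurable_mx_inv a (A : T -> 'M[R]_a) :
  measurable_mx A -> measurable_mx (fun w => invmx (A w)).
Proof.
move=> mA i j; have mD := measurable_det mA; have mJ := measurable_mx_adj mA.
rewrite (_ : (fun w => _) = (fun w => (\det (A w))^-1 * \adj (A w) i j +
    (1 - \det (A w) * (\det (A w))^-1) * A w i j)).
  apply: measurable_funD; apply: measurable_funM => //.
  - exact: measurable_inv.
  - by apply: measurable_funB => //; apply: measurable_funM => //; exact: measurable_inv.
apply/funext => w; rewrite /invmx unitmxE unitfE; case: eqVneq => [->|D0].
  by rewrite invr0 !mul0r subr0 mul1r add0r.
by rewrite mxE divff// subrr mul0r addr0.
Qed.

Lemma measurable_frobenius a b (A : T -> 'M[R]_(a, b)) :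
  measurable_mx A -> measurable_fun setT (fun w => frobenius (A w)).
Proof.
move=> mA; apply: measurable_sqrt; apply: measurable_fsum => i.
by apply: measurable_fsum => j; exact: measurable_funX.
Qed.

Section GEEMeasurable.
Context (m p : nat).

Lemma measurable_gee_pi (X : 'M[R]_(m, p)) (b : T -> 'cV[R]_p) :
  measurable_mx b -> measurable_mx (fun w => gee_pi X (b w)).
Proof.
move=> mb i j; under eq_fun do rewrite mxE.
have me : measurable_fun setT (fun w => expR ((row i X *m b w) 0 0)).
  apply: measurableT_comp => //.
  by apply: (@measurable_mx_mul 1 p 1 (fun _ => row i X) b) => //; exact: measurable_mx_cst.
by apply: measurable_funM => //; apply: measurable_inv; exact: measurable_funD.
Qed.

Lemma measurable_gee_var (X : 'M[R]_(m, p)) (b : T -> 'cV[R]_p) :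
  measurable_mx b -> measurable_mx (fun w => gee_var X (b w)).
Proof.
move=> mb i j; under eq_fun do rewrite mxE.
have mp := measurable_gee_pi X mb.
by apply: measurable_funM => //; apply: measurable_funB.
Qed.

Lemma measurable_gee_Ahalf (X : 'M[R]_(m, p)) (b : T -> 'cV[R]_p) :
  measurable_mx b -> measurable_mx (fun w => gee_Ahalf X (b w)).
Proof.
move=> mb; apply: measurable_mx_diag; apply: measurable_mx_map.
  by move=> g mg; exact: measurable_sqrt.
exact: measurable_gee_var.
Qed.

Lemma measurable_gee_Anhalf (X : 'M[R]_(m, p)) (b : T -> 'cV[R]_p) :
  measurable_mx b -> measurable_mx (fun w => gee_Anhalf X (b w)).
Proof.
move=> mb; apply: measurable_mx_diag; apply: measurable_mx_map.
  by move=> g mg; apply: measurable_inv; exact: measurable_sqrt.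
exact: measurable_gee_var.
Qed.

Context (n : nat) (X : 'I_n -> 'M[R]_(m, p)) (Y : T -> 'I_n -> 'cV[R]_m).
Context (Rh : T -> 'M[R]_m) (b : T -> 'cV[R]_p).
Hypothesis mY : forall i, measurable_mx (fun w => Y w i).
Hypothesis mRh : measurable_mx Rh.
Hypothesis mb : measurable_mx b.

Let mQ := measurable_mx_inv mRh.
Let mAh i := measurable_gee_Ahalf (X i) mb.
Let mAn i := measurable_gee_Anhalf (X i) mb.
Let mres i : measurable_mx (fun w => Y w i - gee_pi (X i) (b w)).
Proof. by apply: measurable_mx_sub => //; exact: measurable_gee_pi. Qed.

Lemma measurable_gee_S : measurable_mx (fun w => gee_S X (Y w) (Rh w) (b w)).
Proof.
apply: measurable_mx_sum => i.
by do 4 (apply: measurable_mx_mul => //).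
Qed.

Let meps i : measurable_mx (fun w => gee_eps (X i) (Y w i) (b w)).
Proof. exact: measurable_mx_mul. Qed.

Lemma measurable_gee_sandwich :
  measurable_mx (fun w => gee_sandwich X (Y w) (Rh w) (b w)).
Proof.
have mX i : measurable_mx (fun _ : T => X i) by exact: measurable_mx_cst.
have mXt i : measurable_mx (fun _ : T => (X i)^T) by exact: measurable_mx_cst.
have mH : measurable_mx (fun w => gee_H X (Rh w) (b w)).
  by apply: measurable_mx_sum => i; repeat (apply: measurable_mx_mul => //).
have mM : measurable_mx (fun w => gee_M X (Y w) (Rh w) (b w)).
  apply: measurable_mx_sum => i; repeat (apply: measurable_mx_mul => //).
  exact: measurable_mx_tr.
apply: measurable_mx_mul; last exact: measurable_mx_inv.
by apply: measurable_mx_mul => //; exact: measurable_mx_inv.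
Qed.

Lemma measurable_gee_wald l (L : 'M[R]_(l, p)) :
  measurable_fun setT (fun w => gee_wald X (Y w) (Rh w) L (b w)).
Proof.
have mL : measurable_mx (fun _ : T => L) by exact: measurable_mx_cst.
have mLt : measurable_mx (fun _ : T => L^T) by exact: measurable_mx_cst.
have mLb : measurable_mx (fun w => L *m b w) by exact: measurable_mx_mul.
apply: (@measurable_mx_mul _ _ _ (fun w => (L *m b w)^T *m _) (fun w => L *m b w)) => //.
apply: measurable_mx_mul; first exact: measurable_mx_tr.
apply: measurable_mx_inv; apply: measurable_mx_mul => //.
by apply: measurable_mx_mul => //; exact: measurable_gee_sandwich.
Qed.

End GEEMeasurable.
End MeasurableMatrices.

(** * Bilinear expansions of the estimating equations *)

Section GEEExpansion.
Context {R : realType} (m p : nat).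
Implicit Types (X : 'M[R]_(m, p)) (b v u : 'cV[R]_p) (y : 'cV[R]_m) (Q : 'M[R]_m).

Definition gee_sd X b (j : 'I_m) : R := Num.sqrt (gee_var X b 0 j).

Lemma gee_piE X b j : gee_pi X b j 0 = logit_pi ((X *m b) j 0).
Proof. by rewrite mxE -row_mul mxE. Qed.

Lemma gee_pi01 X b j : 0 < gee_pi X b j 0 < 1.
Proof. by rewrite gee_piE logit_pi_gt0 logit_pi_lt1. Qed.

Lemma gee_sdE X b j :
  gee_sd X b j = Num.sqrt (gee_pi X b j 0 * (1 - gee_pi X b j 0)).
Proof. by rewrite /gee_sd mxE. Qed.

Lemma gee_sd_gt0 X b j : 0 < gee_sd X b j.
Proof.
have /andP[h0 h1] := gee_pi01 X b j.
by rewrite gee_sdE sqrtr_gt0 mulr_gt0// subr_gt0.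
Qed.

Lemma gee_sd_sqr X b j :
  gee_sd X b j ^+ 2 = gee_pi X b j 0 * (1 - gee_pi X b j 0).
Proof.
have /andP[h0 h1] := gee_pi01 X b j.
by rewrite gee_sdE sqr_sqrtr//; apply: mulr_ge0; lra.
Qed.

Lemma gee_sd_le X b j : gee_sd X b j <= 1 / 2.
Proof.
have h : gee_sd X b j ^+ 2 <= (1 / 2) ^+ 2.
  by rewrite gee_sd_sqr; have := sqr_ge0 (gee_pi X b j 0 - 1/2); nra.
have s0 := gee_sd_gt0 X b j.
by rewrite leNgt; apply/negP => h1; nra.
Qed.

Lemma gee_sd_shift X b v j :
  gee_sd X (b + v) j = gee_sd X b j / logit_g (gee_pi X b j 0) ((X *m v) j 0).
Proof.
have /andP[h0 h1] := gee_pi01 X b j.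
have g0 : 0 < logit_g (gee_pi X b j 0) ((X *m v) j 0).
  by rewrite logit_g_gt0// !ltW.
rewrite !gee_sdE gee_piE mulmxDr mxE logit_var_shift -gee_piE.
rewrite sqrtrM; last by apply: mulr_ge0; lra.
by rewrite -exprVn sqrtr_sqr ger0_norm// invr_ge0 ltW.
Qed.

Lemma gee_pi_shift X b v j :
  let d := (X *m v) j 0 in
  gee_pi X (b + v) j 0 - gee_pi X b j 0 =
  gee_sd X b j ^+ 2 * ((expR (d / 2) - expR (- (d / 2)))
    / logit_g (gee_pi X b j 0) d).
Proof.
by rewrite /= gee_sd_sqr !gee_piE mulmxDr mxE logit_pi_shift mulrA.
Qed.

Lemma vdot_trmx_mul X v w : vdot v (X^T *m w) = \sum_j (X *m v) j 0 * w j 0.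
Proof. by rewrite -vdot_mull vdotE. Qed.

Lemma mul_diag_mxE a c (D : 'rV[R]_a) (B : 'M[R]_(a, c)) i j :
  (diag_mx D *m B) i j = D 0 i * B i j.
Proof. by rewrite mul_diag_mx mxE. Qed.

Lemma Ahalf_mulE X b c (B : 'M[R]_(m, c)) j k :
  (gee_Ahalf X b *m B) j k = gee_sd X b j * B j k.
Proof. by rewrite mul_diag_mxE mxE. Qed.

Lemma Anhalf_mulE X b c (B : 'M[R]_(m, c)) j k :
  (gee_Anhalf X b *m B) j k = (gee_sd X b j)^-1 * B j k.
Proof. by rewrite mul_diag_mxE mxE. Qed.

Lemma gee_epsE X y b j :
  gee_eps X y b j 0 = (gee_sd X b j)^-1 * (y j 0 - gee_pi X b j 0).
Proof. by rewrite /gee_eps Anhalf_mulE !mxE. Qed.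

Section Sample.
Context (n : nat) (X : 'I_n -> 'M[R]_(m, p)) (Y : 'I_n -> 'cV[R]_m).
Context (Rh : 'M[R]_m) (b : 'cV[R]_p).
Local Notation Q := (invmx Rh).
Local Notation sd i j := (gee_sd (X i) b j).
Local Notation res i k := (Y i k 0 - gee_pi (X i) b k 0).

Lemma vdot_sumr (I : finType) v (w : I -> 'cV[R]_p) :
  vdot v (\sum_i w i) = \sum_i vdot v (w i).
Proof. by rewrite /vdot mulmx_sumr summxE. Qed.

(** The three bilinear forms are written in coordinates because all estimates are
made entry by entry of the working correlation matrix, with sums over the
clusters left intact so that cancellations between clusters are kept. *)
Lemma vdot_gee_S v : vdot v (gee_S X Y Rh b) =
  \sum_i \sum_j \sum_k (X i *m v) j 0 * (sd i j * Q j k / sd i k * res i k).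
Proof.
rewrite vdot_sumr; apply: eq_bigr => i _; rewrite -!mulmxA vdot_trmx_mul.
apply: eq_bigr => j _; rewrite Ahalf_mulE [(invmx Rh *m _) _ _]mxE !mulr_sumr; apply: eq_bigr => k _.
by rewrite Anhalf_mulE [X in _ * (_ * (_ * (_ * X)))]mxE [X in _ + X]mxE; ring.
Qed.

Lemma vdot_gee_H v u : vdot v (gee_H X Rh b *m u) =
  \sum_i \sum_j \sum_k (X i *m v) j 0 * (sd i j * Q j k * sd i k) * (X i *m u) k 0.
Proof.
rewrite mulmx_suml vdot_sumr; apply: eq_bigr => i _.
rewrite -!mulmxA vdot_trmx_mul.
apply: eq_bigr => j _; rewrite Ahalf_mulE [(invmx Rh *m _) _ _]mxE !mulr_sumr; apply: eq_bigr => k _.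
by rewrite Ahalf_mulE; ring.
Qed.

Lemma gee_H_tr : Q^T = Q -> (gee_H X Rh b)^T = gee_H X Rh b.
Proof.
move=> Qsym; rewrite /gee_H (raddf_sum (@trmx R p p)); apply: eq_bigr => i _.
by rewrite /= !trmx_mul trmxK Qsym /gee_Ahalf tr_diag_mx !mulmxA.
Qed.

Lemma vdot_gee_M v u : vdot v (gee_M X Y Rh b *m u) =
  \sum_i (\sum_j \sum_k (X i *m v) j 0 * (sd i j * Q j k / sd i k * res i k)) *
         (\sum_j \sum_k (X i *m u) j 0 * (sd i j * Q k j / sd i k * res i k)).
Proof.
rewrite mulmx_suml vdot_sumr; apply: eq_bigr => i _.
set eps := gee_eps (X i) (Y i) b.
pose w : 'cV[R]_m := Q *m eps.
have -> : (X i)^T *m gee_Ahalf (X i) b *m Q *m eps *m eps^T *m Q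
    *m gee_Ahalf (X i) b *m X i *m u =
  ((eps^T *m (Q *m (gee_Ahalf (X i) b *m (X i *m u)))) 0 0) *:
  ((X i)^T *m (gee_Ahalf (X i) b *m (Q *m eps))).
  rewrite -!mulmxA [eps^T *m _]mx11_scalar !mul_mx_scalar -!scalemxAr.
  by rewrite -[(_ *m _) 0 0 in RHS]/((eps^T *m _) 0 0) -mx11_scalar.
rewrite vdotZr mulrC; congr (_ * _).
  rewrite vdot_trmx_mul; apply: eq_bigr => j _.
  rewrite Ahalf_mulE [(invmx Rh *m _) _ _]mxE !mulr_sumr; apply: eq_bigr => k _.
  by rewrite gee_epsE; ring.
rewrite mxE exchange_big/=; apply: eq_bigr => k _.
rewrite [(invmx Rh *m _) _ _]mxE mulr_sumr; apply: eq_bigr => j _.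
by rewrite [eps^T _ _]mxE Ahalf_mulE gee_epsE; ring.
Qed.

End Sample.
End GEEExpansion.

(** * Deterministic comparison at the root of the estimating equation *)

Lemma inj_unitmx {F : fieldType} k (A : 'M[F]_k) :
  (forall v : 'cV_k, A *m v = 0 -> v = 0) -> A \in unitmx.
Proof.
move=> inj; rewrite -unitmx_tr -row_free_unit -kermx_eq0; apply/eqP/row_matrixP => i.
rewrite row0; apply: trmx_inj; rewrite linear0; apply: inj.
by apply: trmx_inj; rewrite trmx_mul trmxK -row_mul mulmx_ker row0 linear0.
Qed.

Section L2More.
Context {R : realType}.

Lemma l2_triangle (I : finType) (f g : I -> R) :
  l2 (fun i => f i + g i) <= l2 f + l2 g.
Proof.
rewrite ler_l2P ?addr_ge0 ?l2_ge0//.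
have -> : \sum_i (f i + g i) ^+ 2 =
    \sum_i f i ^+ 2 + 2 * (\sum_i f i * g i) + \sum_i g i ^+ 2.
  by rewrite mulr_sumr -!big_split/=; apply: eq_bigr => i _; ring.
have := ler_norm (\sum_i f i * g i); have := l2_cauchy_schwarz f g.
by rewrite sqrrD !l2_sqr; lra.
Qed.

Lemma l2_sum_le (I J : finType) (f : J -> I -> R) :
  l2 (fun i => \sum_j f j i) <= \sum_j l2 (f j).
Proof.
have H (s : seq J) : l2 (fun i => \sum_(j <- s) f j i) <= \sum_(j <- s) l2 (f j).
  elim: s => [|j s IH].
    rewrite big_nil ler_l2P// big1 ?expr0n// => i _.
    by rewrite big_nil expr0n.
  rewrite big_cons; apply: le_trans (lerD (lexx _) IH).
  apply: le_trans (l2_triangle _ _); apply: le_l2 => i.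
  by rewrite big_cons.
exact: H.
Qed.

Lemma l2_mul_le (I : finType) (f g : I -> R) c : 0 <= c ->
  (forall i, `|g i| <= c) -> l2 (fun i => f i * g i) <= c * l2 f.
Proof.
move=> c0 gc; rewrite -l2Z//; apply: le_l2 => i.
by rewrite !normrM (ger0_norm c0) mulrC ler_wpM2r.
Qed.

Lemma l2_slice (I J : finType) (f : I -> J -> R) j :
  l2 (fun i => f i j) <= l2 (fun ij : I * J => f ij.1 ij.2).
Proof.
rewrite ler_l2P ?l2_ge0// l2_sqr -(pair_bigA _ (fun i j => f i j ^+ 2))/=.
by apply: ler_sum => i _; rewrite (bigD1 j)//= lerDl sumr_ge0// => k _; rewrite sqr_ge0.
Qed.

End L2More.

(** The weights of the estimating equation are ratios of standard deviations;
their expansions are those of a factor g at one index over a factor g at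
another. *)
Section TaylorProducts.
Context {R : realType}.
Variables (q1 q2 d1 d2 : R).
Hypotheses (q1_01 : 0 <= q1 <= 1) (q2_01 : 0 <= q2 <= 1).
Hypotheses (d1_le : `|d1| <= 1/2) (d2_le : `|d2| <= 1/2).

Let ratV := (logit_g q1 d1)^-1.
Let gk := logit_g q2 d2.

Let norm_mul_le (x y : R) : 2 * (`|x| * `|y|) <= x ^+ 2 + y ^+ 2.
Proof.
rewrite -[x ^+ 2]real_normK ?num_real// -[y ^+ 2]real_normK ?num_real//.
by have := sqr_ge0 (`|x| - `|y|); nra.
Qed.

Lemma logit_ratio_lip : `|ratV * gk - 1| <= 3 * `|d1| + `|d2|.
Proof.
have h1 := logit_gV_lip q1_01 d1_le; have h2 := logit_g_lip q2_01 d2_le.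
have -> : ratV * gk - 1 = (ratV - 1) + (gk - 1) + (ratV - 1) * (gk - 1) by ring.
apply: le_trans (ler_normD _ _) _; rewrite normrM.
have h3 := ler_normD (ratV - 1) (gk - 1).
have h4 : `|ratV - 1| * `|gk - 1| <= 2 * `|d1| * (1/2).
  by apply: ler_pM => //; apply: le_trans h2 _.
move: h1 h2 h3 h4; rewrite -/ratV -/gk; lra.
Qed.

Lemma logit_ratio_taylor :
  `|1 - ratV * gk - (q1 - 1/2) * d1 + (q2 - 1/2) * d2| <= 3 * (d1 ^+ 2 + d2 ^+ 2).
Proof.
have h1 := logit_gV_lip q1_01 d1_le; have h2 := logit_g_lip q2_01 d2_le.
have h3 := logit_gV_taylor q1_01 d1_le; have h4 := logit_g_taylor q2_01 d2_le.
rewrite -/ratV -/gk in h1 h2 h3 h4.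
have -> : 1 - ratV * gk - (q1 - 1/2) * d1 + (q2 - 1/2) * d2 =
  - ((ratV - 1 + (q1 - 1/2) * d1) + (gk - 1 - (q2 - 1/2) * d2) + (ratV - 1) * (gk - 1)).
  by ring.
rewrite normrN; apply: le_trans (ler_normD _ _) _; rewrite normrM.
have h5 := ler_normD (ratV - 1 + (q1 - 1/2) * d1) (gk - 1 - (q2 - 1/2) * d2).
have h6 : `|ratV - 1| * `|gk - 1| <= 2 * `|d1| * `|d2| by apply: ler_pM.
have := norm_mul_le d1 d2; have := sqr_ge0 d1; have := sqr_ge0 d2.
move: h3 h4 h5 h6; lra.
Qed.

Lemma logit_mean_lip (a D : R) : 0 <= a <= 1/4 ->
  D = a * ((expR (d2 / 2) - expR (- (d2 / 2))) / gk) -> `|D| <= `|d2|.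
Proof.
move=> /andP[a0 a1] ->; have := logit_sinh_taylor q2_01 d2_le.
rewrite -/gk; set S := _ / gk => h; rewrite normrM (ger0_norm a0).
have h1 : `|S| <= `|d2| + 4 * d2 ^+ 2.
  by have := ler_normD (S - d2) d2; rewrite subrK; lra.
have h2 : d2 ^+ 2 <= `|d2| * (1/2).
  by rewrite -[d2 ^+ 2]real_normK ?num_real// expr2 ler_wpM2l.
have h3 := normr_ge0 S; have : a * `|S| <= 1/4 * `|S| by rewrite ler_wpM2r.
lra.
Qed.

Lemma logit_mean_taylor (a D : R) : 0 <= a <= 1/4 ->
  D = a * ((expR (d2 / 2) - expR (- (d2 / 2))) / gk) ->
  `|ratV * gk * D - a * d2| <= 4 * (d1 ^+ 2 + d2 ^+ 2).
Proof.
move=> a01 DE; have DL := logit_mean_lip a01 DE; have /andP[a0 a1] := a01.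
have -> : ratV * gk * D - a * d2 = (ratV * gk - 1) * D + (D - a * d2) by ring.
apply: le_trans (ler_normD _ _) _; rewrite normrM.
have h1 : `|D - a * d2| <= d2 ^+ 2.
  have := logit_sinh_taylor q2_01 d2_le; rewrite DE -mulrBr normrM (ger0_norm a0) -/gk => h.
  have := sqr_ge0 d2 => h2; apply: (@le_trans _ _ (1/4 * (4 * d2 ^+ 2))); last by lra.
  by apply: ler_pM.
have h2 : `|ratV * gk - 1| * `|D| <= (3 * `|d1| + `|d2|) * `|d2|.
  by apply: ler_pM => //; exact: logit_ratio_lip.
have h3 : `|d2| * `|d2| = d2 ^+ 2 by rewrite -expr2 real_normK ?num_real.
have := norm_mul_le d1 d2; have := sqr_ge0 d1; have := sqr_ge0 d2.
have h4 : (3 * `|d1| + `|d2|) * `|d2| = 3 * (`|d1| * `|d2|) + d2 ^+ 2.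
  by rewrite -h3; ring.
rewrite h4 in h2; move: h1 h2; lra.
Qed.

End TaylorProducts.

Lemma norm_sum6 {R : realType} (a b c d e f : R) :
  `|a + b - c + d + e + f| <= `|a| + `|b| + `|c| + `|d| + `|e| + `|f|.
Proof.
do 3 (apply: le_trans (ler_normD _ _) _; apply: lerD => //).
by apply: le_trans (ler_normB _ _) _; apply: lerD => //; exact: ler_normD.
Qed.

(** 34 = 1 + 2 + 2 + 12 + 1 + 16 collects the six terms of the linearization. *)
Lemma sum6_le {R : realType} (a b c d e f x1 x2 x3 x : R) :
  a <= x1 -> b <= 2 * x2 -> c <= 2 * x2 -> d <= 12 * x -> e <= x3 -> f <= 16 * x ->
  x1 <= x -> x2 <= x -> x3 <= x -> a + b + c + d + e + f <= 34 * x.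
Proof. lra. Qed.

Lemma perturbed_lower_bound {R : realType} (a x y t s : R) :
  `|x - y| <= t -> a * s <= y -> t <= a / 2 * s -> a / 2 * s <= x.
Proof.
rewrite ler_norml => /andP[h1 _] h2 h3.
have : a * s = a / 2 * s + a / 2 * s by field.
lra.
Qed.

Lemma sum2_const {R : realType} m (c : R) :
  \sum_(j < m) \sum_(k < m) c = m%:R ^+ 2 * c.
Proof.
by rewrite !sumr_const !card_ord -mulrnA expr2 -natrM mulr_natl.
Qed.

(* The bilinear forms are only used through their expansions; conversion tests
must not unfold the matrix products. *)
#[local] Opaque vdot gee_S gee_H gee_M.

Lemma mulmx_diff (R : realType) p (A B : 'M[R]_p) (x z : 'cV[R]_p) :
  A *m x = B *m z -> A *m (x - z) = B *m z - A *m z.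
Proof. by move=> E; rewrite mulmxBr E. Qed.

Lemma vdot_tr_diff (R : realType) p (A B : 'M[R]_p) (v z : 'cV[R]_p) :
  B^T = B -> A^T *m v = B *m z - A^T *m z ->
  vdot v (A *m v) = vdot z (B *m v) - vdot z (A *m v).
Proof.
move=> Bs E; rewrite -[X in vdot v (X *m v)]trmxK -vdot_mull E vdotC vdotBr; congr (_ - _).
  by rewrite vdotC vdot_mull Bs.
by rewrite -vdot_mull vdotC.
Qed.

Section CoreBounds.
Context {R : realType} (m p n l : nat).
Variables (X : 'I_n -> 'M[R]_(m, p)) (Y : 'I_n -> 'cV[R]_m).
Variables (Rh Rb : 'M[R]_m) (b0 delta : 'cV[R]_p).
Local Notation Q := (invmx Rh).
Local Notation Qb := (invmx Rb).
Local Notation bh := (b0 + delta).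
Local Notation H := (gee_H X Rb b0).
Local Notation Hh := (gee_H X Rh bh).
Let xv (i : 'I_n) (j : 'I_m) (v : 'cV[R]_p) : R := (X i *m v) j 0.
Let pi i j := gee_pi (X i) b0 j 0.
Let sd i j := gee_sd (X i) b0 j.
Let dd i j := xv i j delta.
Let rho i j k := sd i j / sd i k.
Let e i j := Y i j 0 - pi i j.
Let kap i j := pi i j - 1/2.
Let g i j := logit_g (pi i j) (dd i j).
Let D i j := gee_pi (X i) bh j 0 - pi i j.
Let th i j k := (g i j)^-1 * g i k.
(** The Euclidean norm of all linear predictors: the natural norm for directions,
since the information matrix is comparable to its square. *)
Definition design_norm (v : 'cV[R]_p) : R :=
  l2 (fun ij : 'I_n * 'I_m => (X ij.1 *m v) ij.2 0).

(* C bounds the deterministic quantities, eps everything that vanishes in the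
limit. The largest change of a linear predictor is at most Dm, and Dm times the
Euclidean norm of all changes controls the quadratic remainders. *)
Variables (C eps Dm : R).
Hypothesis C1 : 1 <= C.
Hypothesis eps01 : 0 <= eps <= 1/2.
Hypothesis Dm_le : Dm <= eps.
Hypothesis dd_le : forall i j, `|dd i j| <= Dm.
Hypothesis Dm_l2 : Dm * design_norm delta <= eps.
Hypothesis dQ : forall j k, `|Q j k - Qb j k| <= eps.
Hypothesis dQ_l2 : forall j k, `|Q j k - Qb j k| * design_norm delta <= eps.
Hypothesis Qb_le : forall j k, `|Qb j k| <= C.
Hypothesis rho_le : forall i j k, rho i j k <= C.
Hypothesis Y01 : forall i j, Y i j 0 = 0 \/ Y i j 0 = 1.

Let pi01 i j : 0 <= pi i j <= 1.
Proof. by have /andP[? ?] := gee_pi01 (X i) b0 j; rewrite /pi !ltW. Qed.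
Let sd_gt0 i j : 0 < sd i j. Proof. exact: gee_sd_gt0. Qed.
Let rho_ge0 i j k : 0 <= rho i j k.
Proof. by rewrite divr_ge0// ltW. Qed.
Let C0 : 0 <= C. Proof. exact: le_trans ler01 C1. Qed.
Let eps0 : 0 <= eps. Proof. by case/andP: eps01. Qed.
Let epsC : eps <= C. Proof. by have := C1; have := eps01; lra. Qed.
Let dd_half i j : `|dd i j| <= 1/2.
Proof. by have := dd_le i j; have := Dm_le; have := eps01; lra. Qed.
Let e1 i j : `|e i j| <= 1.
Proof.
have /andP[h0 h1] := pi01 i j; rewrite /e.
by case: (Y01 i j) => ->; rewrite ler_norml; lra.
Qed.
Let g_gt0 i j : 0 < g i j. Proof. exact: logit_g_gt0. Qed.
Let Q_le j k : `|Q j k| <= 2 * C.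
Proof.
have := ler_normD (Q j k - Qb j k) (Qb j k); rewrite subrK.
by have := dQ j k; have := Qb_le j k; have := epsC; lra.
Qed.
Let sd2_le i j : 0 <= sd i j ^+ 2 <= 1/4.
Proof.
have := gee_sd_le (X i) b0 j; have := sd_gt0 i j; rewrite -/(sd i j) => h0 h1.
by rewrite sqr_ge0/= expr2; nra.
Qed.
Let DE i j : D i j = sd i j ^+ 2 *
  ((expR (dd i j / 2) - expR (- (dd i j / 2))) / g i j).
Proof. exact: gee_pi_shift. Qed.
Let D_le i j : `|D i j| <= eps.
Proof.
apply: le_trans (logit_mean_lip (pi01 i j) (dd_half i j) (sd2_le i j) (DE i j)) _.
by apply: le_trans Dm_le.
Qed.
Let th_lip i j k : `|th i j k - 1| <= 4 * eps.
Proof.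
apply: le_trans (logit_ratio_lip (pi01 i j) (pi01 i k) (dd_half i j) (dd_half i k)) _.
by have := dd_le i j; have := dd_le i k; have := Dm_le; lra.
Qed.
Let th_le i j k : `|th i j k| <= 3.
Proof.
have := ler_normD (th i j k - 1) 1; rewrite subrK normr1.
by have := th_lip i j k; have := eps01; lra.
Qed.
Let Dm0 (i : 'I_n) (j : 'I_m) : 0 <= Dm.
Proof. exact: le_trans (normr_ge0 _) (dd_le i j). Qed.

Section Linearization.
Variable z : 'cV[R]_p.
Hypothesis z_le : design_norm z <= C.
Let zz i j := xv i j z.
Hypothesis rand1 : forall j k,
  `|(Q j k - Qb j k) * \sum_i zz i j * rho i j k * e i k| <= eps.
Hypothesis rand2 : forall j k,
  `|\sum_i zz i j * rho i j k * (kap i j * dd i j) * e i k| <= eps.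
Hypothesis rand3 : forall j k,
  `|\sum_i zz i j * rho i j k * (kap i k * dd i k) * e i k| <= eps.

Let zz_slice j : l2 (fun i => zz i j) <= C.
Proof. exact: le_trans (l2_slice (fun i j => zz i j) j) z_le. Qed.

Let quad_sum j k k' : \sum_i `|zz i j| * (`|dd i k| * `|dd i k'|) <= C * eps.
Proof.
have [n0|n0] := posnP n.
  rewrite big1 ?mulr_ge0// => i _; exfalso; have := ltn_ord i.
  by rewrite [X in (_ < X)%N]n0.
have Dm_ge0 : 0 <= Dm := Dm0 (Ordinal n0) k.
apply: (@le_trans _ _ (Dm * \sum_i `|zz i j| * `|dd i k|)).
  rewrite mulr_sumr; apply: ler_sum => i _.
  by rewrite mulrA mulrC; apply: ler_pM => //; rewrite mulr_ge0.
apply: (@le_trans _ _ (Dm * (C * design_norm delta))); last first.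
  by rewrite mulrCA ler_wpM2l.
rewrite ler_wpM2l//; apply: le_trans (l2_cauchy_schwarz_norm _ _) _.
apply: ler_pM; rewrite ?l2_ge0//.
exact: l2_slice (fun i j => dd i j) k.
Qed.

Let rem_sum (r : 'I_n -> R) (K : R) j k : 0 <= K ->
  (forall i, `|r i| <= K * (dd i j ^+ 2 + dd i k ^+ 2)) ->
  `|\sum_i zz i j * rho i j k * r i| <= 2 * (K * C ^+ 2 * eps).
Proof.
move=> K0 rK; apply: le_trans (ler_norm_sum _ _ _) _.
apply: (@le_trans _ _ (C * K * (\sum_i `|zz i j| * (`|dd i j| * `|dd i j|) +
     \sum_i `|zz i j| * (`|dd i k| * `|dd i k|)))).
  rewrite -big_split/= mulr_sumr; apply: ler_sum => i _.
  rewrite normrM [`|zz i j * _|]normrM (ger0_norm (rho_ge0 _ _ _)) -mulrDr -!expr2 !real_normK ?num_real//.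
  set x := `|zz i j|; set t := _ + _; rewrite -/x.
  rewrite (_ : x * rho i j k * `|r i| = rho i j k * (x * `|r i|)); last by ring.
  rewrite (_ : C * K * (x * t) = C * (x * (K * t))); last by ring.
  apply: ler_pM; rewrite ?rho_ge0 ?mulr_ge0 ?rho_le ?normr_ge0//.
  by rewrite ler_wpM2l ?normr_ge0// rK.
have := quad_sum j j j; have := quad_sum j k k.
move=> h1 h2; apply: (@le_trans _ _ (C * K * (C * eps + C * eps))).
  by rewrite ler_wpM2l ?mulr_ge0// lerD.
by rewrite le_eqVlt; apply/orP; left; apply/eqP; ring.
Qed.

(** Expanding the estimating equation at its root in the direction z, each entry
(j, k) contributes six terms: the error of the working correlation times the
noise (rand1), the first order change of the weights times the noise (rand2 and
rand3), the two quadratic remainders, and the error of the working correlation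
times the change of the mean. The linear term is the information matrix. *)
Lemma gee_linearization : gee_S X Y Rh bh = 0 ->
  `|vdot z (gee_S X Y Rb b0) - vdot z (H *m delta)| <= 34 * m%:R ^+ 2 * C ^+ 3 * eps.
Proof.
move=> S0.
have S0' : vdot z (gee_S X Y Rh bh) = 0 by rewrite S0 vdotr0.
pose T i j k := zz i j * rho i j k * (Qb j k * e i k - Qb j k * (sd i k ^+ 2 * dd i k)
    - th i j k * Q j k * (e i k - D i k)).
have TE : \sum_j \sum_k \sum_i T i j k = \sum_i \sum_j \sum_k T i j k.
  rewrite [RHS]exchange_big/=; apply: eq_bigr => j _.
  by rewrite [RHS]exchange_big.
have -> : vdot z (gee_S X Y Rb b0) - vdot z (H *m delta) = \sum_j \sum_k \sum_i T i j k.
  rewrite TE -[LHS]subr0 -[X in _ - X = _]S0' !vdot_gee_S vdot_gee_H -!sumrB; apply: eq_bigr => i _.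
  rewrite -!sumrB; apply: eq_bigr => j _; rewrite -!sumrB; apply: eq_bigr => k _.
  rewrite !gee_sd_shift -/(xv i j delta) -/(xv i k delta) -/(pi i j) -/(pi i k).
  rewrite -/(sd i j) -/(sd i k) -/(dd i j) -/(dd i k) -/(g i j) -/(g i k).
  rewrite -/(xv i j z) -/(zz i j) /T /th /rho /D /e.
  have := sd_gt0 i k; have := g_gt0 i j; have := g_gt0 i k => h1 h2 h3.
  by rewrite -/(pi i k); field; rewrite !gt_eqF.
have Tjk j k : `|\sum_i T i j k| <= 34 * C ^+ 3 * eps.
  pose A1 := (Q j k - Qb j k) * \sum_i zz i j * rho i j k * e i k.
  pose A2 := \sum_i zz i j * rho i j k * (kap i j * dd i j) * e i k.
  pose A3 := \sum_i zz i j * rho i j k * (kap i k * dd i k) * e i k.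
  pose A4 := \sum_i zz i j * rho i j k *
    ((1 - th i j k - kap i j * dd i j + kap i k * dd i k) * e i k).
  pose A5 := \sum_i zz i j * (rho i j k * sd i k ^+ 2 * dd i k).
  pose A6 := \sum_i zz i j * rho i j k * (th i j k * D i k - sd i k ^+ 2 * dd i k).
  have -> : \sum_i T i j k = - A1 + Q j k * A2 - Q j k * A3 + Q j k * A4
      + (Q j k - Qb j k) * A5 + Q j k * A6.
    rewrite /A1 /A2 /A3 /A4 /A5 /A6 !mulr_sumr -!sumrN -!big_split/=.
    by apply: eq_bigr => i _; rewrite /T; ring.
  have a1 : `|A1| <= eps by exact: rand1.
  have a2 : `|Q j k * A2| <= 2 * C * eps by rewrite normrM ler_pM ?rand2.
  have a3 : `|Q j k * A3| <= 2 * C * eps by rewrite normrM ler_pM ?rand3.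
  have a4 : `|Q j k * A4| <= 2 * C * (2 * (3 * C ^+ 2 * eps)).
    rewrite normrM ler_pM//; apply: rem_sum => // i.
    rewrite normrM -[leRHS]mulr1; apply: ler_pM => //.
    exact: logit_ratio_taylor.
  have a6 : `|Q j k * A6| <= 2 * C * (2 * (4 * C ^+ 2 * eps)).
    rewrite normrM ler_pM//; apply: rem_sum => // i.
    exact: (logit_mean_taylor (pi01 i j) (pi01 i k) (dd_half i j) (dd_half i k) (sd2_le i k) (DE i k)).
  have a5 : `|(Q j k - Qb j k) * A5| <= C ^+ 2 * eps.
    rewrite normrM.
    apply: (@le_trans _ _ (`|Q j k - Qb j k| * (C * (C * design_norm delta)))); last first.
      set x := `|Q j k - _|; rewrite (_ : x * (C * (C * design_norm delta)) =
        C ^+ 2 * (x * design_norm delta)); last by ring.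
      by rewrite ler_wpM2l ?exprn_ge0// dQ_l2.
    rewrite ler_wpM2l//; apply: le_trans (l2_cauchy_schwarz _ _) _.
    apply: ler_pM; rewrite ?l2_ge0//.
    apply: (@le_trans _ _ (C * l2 (fun i => dd i k))).
      rewrite -l2Z//; apply: le_l2 => i; rewrite normrM [leRHS]normrM.
      rewrite ler_wpM2r// normrM (ger0_norm (rho_ge0 _ _ _)) (ger0_norm C0) -[leRHS]mulr1.
      apply: ler_pM; rewrite ?rho_le//.
      by have /andP[? ?] := sd2_le i k; rewrite ger0_norm//; lra.
    by rewrite ler_wpM2l//; exact: l2_slice (fun i j => dd i j) k.
  have C2 : C <= C ^+ 2 by rewrite expr2 ler_peMl.
  have C3 : C ^+ 2 <= C ^+ 3 by rewrite [leRHS]exprS ler_peMl// exprn_ge0.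
  have c1 : eps <= C ^+ 3 * eps by rewrite ler_peMl//; have := C1; lra.
  have c2 : C * eps <= C ^+ 3 * eps by rewrite ler_wpM2r//; lra.
  have c3 : C ^+ 2 * eps <= C ^+ 3 * eps by rewrite ler_wpM2r.
  have c4 : C * (C ^+ 2 * eps) = C ^+ 3 * eps by rewrite mulrA -exprS.
  apply: le_trans (norm_sum6 _ _ _ _ _ _) _; rewrite normrN.
  have b4 : 2 * C * (2 * (3 * C ^+ 2 * eps)) = 12 * (C * (C ^+ 2 * eps)) by ring.
  have b6 : 2 * C * (2 * (4 * C ^+ 2 * eps)) = 16 * (C * (C ^+ 2 * eps)) by ring.
  rewrite b4 c4 in a4; rewrite b6 c4 in a6; rewrite -!mulrA in a2 a3; rewrite -[leRHS]mulrA.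
  exact: sum6_le a1 a2 a3 a4 a5 a6 c1 c2 c3.
apply: le_trans (ler_norm_sum _ _ _) _.
apply: (@le_trans _ _ (\sum_(j < m) \sum_(k < m) 34 * C ^+ 3 * eps)).
  apply: ler_sum => j _; apply: le_trans (ler_norm_sum _ _ _) _.
  by apply: ler_sum => k _; exact: Tjk.
rewrite sum2_const le_eqVlt; apply/orP; left; apply/eqP.
by ring.
Qed.

End Linearization.

Let bilinear_bound (W : 'I_n -> 'I_m -> 'I_m -> R) (K : R) v u : 0 <= K ->
  (forall i j k, `|W i j k| <= K) ->
  `|\sum_i \sum_j \sum_k xv i j v * W i j k * xv i k u|
    <= m%:R ^+ 2 * (K * (design_norm v * design_norm u)).
Proof.
move=> K0 WK; rewrite exchange_big/=.
apply: le_trans (ler_norm_sum _ _ _) _; rewrite -sum2_const.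
apply: ler_sum => j _; rewrite exchange_big/=.
apply: le_trans (ler_norm_sum _ _ _) _; apply: ler_sum => k _.
apply: (@le_trans _ _ (K * \sum_i `|xv i j v| * `|xv i k u|)).
  apply: le_trans (ler_norm_sum _ _ _) _; rewrite mulr_sumr; apply: ler_sum => i _.
  rewrite normrM [`|xv i j v * _|]normrM.
  rewrite (_ : forall x y w : R, x * w * y = w * (x * y)) => [|x y w]; last by ring.
  by apply: ler_wpM2r; [rewrite mulr_ge0|exact: WK].
rewrite ler_wpM2l//; apply: le_trans (l2_cauchy_schwarz_norm _ _) _.
apply: ler_pM; rewrite ?l2_ge0//.
  exact: (l2_slice (fun i j => xv i j v) j).
exact: (l2_slice (fun i j => xv i j u) k).
Qed.

Let gV_ge0 i j : 0 <= (g i j)^-1. Proof. by rewrite invr_ge0 ltW. Qed.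
Let gV_le2 i j : (g i j)^-1 <= 2. Proof. exact: logit_gV_le. Qed.
Let gV_lip i j : `|(g i j)^-1 - 1| <= 2 * eps.
Proof.
apply: le_trans (logit_gV_lip (pi01 i j) (dd_half i j)) _.
by rewrite ler_wpM2l//; exact: le_trans Dm_le.
Qed.
Let sd_le1 i j : sd i j <= 1.
Proof. by have := gee_sd_le (X i) b0 j; rewrite -/(sd i j); lra. Qed.

(** The perturbation is relative to the design norm in both directions, hence
does not degrade with the number of covariates. *)
Lemma gee_H_perturb v u : `|vdot v (Hh *m u) - vdot v (H *m u)| <=
  10 * m%:R ^+ 2 * C * eps * (design_norm v * design_norm u).
Proof.
pose W i j k := sd i j * sd i k * ((g i j)^-1 * (g i k)^-1 * Q j k - Qb j k).
have -> : vdot v (Hh *m u) - vdot v (H *m u) =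
    \sum_i \sum_j \sum_k xv i j v * W i j k * xv i k u.
  apply: etrans (congr2 (fun x y => x - y) (vdot_gee_H X Rh bh v u) (vdot_gee_H X Rb b0 v u)) _.
  rewrite -sumrB; apply: eq_bigr => i _.
  rewrite -sumrB; apply: eq_bigr => j _; rewrite -sumrB; apply: eq_bigr => k _.
  rewrite !gee_sd_shift -/(xv i j delta) -/(xv i k delta) -/(pi i j) -/(pi i k).
  rewrite -/(sd i j) -/(sd i k) -/(dd i j) -/(dd i k) -/(g i j) -/(g i k).
  by rewrite -/(xv i j v) -/(xv i k u) /W; ring.
apply: le_trans (bilinear_bound (K := 10 * (C * eps)) _ _ _ _) _.
- by rewrite !mulr_ge0.
- move=> i j k; rewrite /W normrM -[leRHS]mul1r; apply: ler_pM => //.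
    rewrite normrM !ger0_norm ?(ltW (sd_gt0 _ _))// -[leRHS]mul1r.
    by apply: ler_pM; rewrite ?(ltW (sd_gt0 _ _)) ?sd_le1.
  set x := (g i j)^-1; set y := (g i k)^-1.
  have -> : x * y * Q j k - Qb j k = x * y * (Q j k - Qb j k)
    + ((x - 1) * y + (y - 1)) * Qb j k by ring.
  apply: le_trans (ler_normD _ _) _.
  have h1 : `|x * y * (Q j k - Qb j k)| <= 2 * 2 * eps.
    rewrite normrM; apply: ler_pM => //; rewrite normrM; apply: ler_pM => //.
      by rewrite ger0_norm ?gV_ge0 ?gV_le2.
    by rewrite ger0_norm ?gV_ge0 ?gV_le2.
  have h2 : `|((x - 1) * y + (y - 1)) * Qb j k| <= (2 * eps * 2 + 2 * eps) * C.
    rewrite normrM; apply: ler_pM => //; apply: le_trans (ler_normD _ _) _.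
    apply: lerD; last exact: gV_lip.
    rewrite normrM; apply: ler_pM => //; first exact: gV_lip.
    by rewrite ger0_norm ?gV_ge0 ?gV_le2.
  have h3 : eps <= C * eps by rewrite ler_peMl.
  have h4 : (2 * eps * 2 + 2 * eps) * C = 6 * (C * eps) by ring.
  rewrite h4 in h2; apply: le_trans (lerD h1 h2) _.
  by move: h3; set t := C * eps; lra.
- rewrite le_eqVlt; apply/orP; left; apply/eqP; ring.
Qed.

Section Sandwich.
Variable c : R.
Hypothesis c0 : 0 < c.
Hypothesis Qb_sym : Qb^T = Qb.
Hypothesis H_low : forall v, c * design_norm v ^+ 2 <= vdot v (H *m v).
Hypothesis design_inj : forall v, design_norm v = 0 -> v = 0.
Hypothesis eps_small : 10 * m%:R ^+ 2 * C * eps <= c / 2.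
Variables (L : 'M[R]_(l, p)) (z : 'I_l -> 'cV[R]_p).
Hypothesis z_le : forall a, design_norm (z a) <= C.
Hypothesis zE : forall a, H *m z a = (row a L)^T.

Let H_sym : H^T = H. Proof. exact: gee_H_tr. Qed.

Lemma gee_Hh_low v : c / 2 * design_norm v ^+ 2 <= vdot v (Hh *m v).
Proof.
have h1 := gee_H_perturb v v; have h2 := H_low v.
have h3 : 10 * m%:R ^+ 2 * C * eps * (design_norm v * design_norm v) <=
    c / 2 * (design_norm v ^+ 2).
  by rewrite -expr2 ler_wpM2r// sqr_ge0.
exact: perturbed_lower_bound h1 h2 h3.
Qed.

Lemma gee_Hh_unit : Hh \in unitmx.
Proof.
apply: inj_unitmx => v Hv; apply: design_inj.
have := gee_Hh_low v; rewrite Hv vdotr0 => h.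
have h1 : design_norm v ^+ 2 <= 0.
  by rewrite -(pmulr_rle0 _ (divr_gt0 c0 (ltr0Sn R 1))).
by apply/eqP; rewrite -sqrf_eq0 eq_le h1 sqr_ge0.
Qed.

Let K1 : R := 20 * m%:R ^+ 2 * C ^+ 2 / c.

(* Both kinds of solutions of the perturbed system satisfy this energy inequality,
and the lower bound of the perturbed form then bounds the difference. *)
Let perturb_solution a D' : vdot D' (Hh *m D') <=
    10 * m%:R ^+ 2 * C * eps * (design_norm D' * design_norm (z a)) ->
  design_norm D' <= K1 * eps.
Proof.
move=> h; have := gee_Hh_low D'; set x := design_norm D' in h *.
have x0 : 0 <= x by exact: l2_ge0.
have h2 : 10 * m%:R ^+ 2 * C * eps * (x * design_norm (z a)) <=
   10 * m%:R ^+ 2 * C * eps * (x * C).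
  by rewrite ler_wpM2l ?mulr_ge0 ?exprn_ge0// ler_wpM2l.
move=> /le_trans /(_ (le_trans h h2)) {h h2}.
have [->|xn0] := eqVneq x 0; first by rewrite !mulr_ge0 ?exprn_ge0 ?invr_ge0// ltW.
have xp : 0 < x by rewrite lt_neqAle eq_sym xn0.
have -> : c / 2 * x ^+ 2 = x * (c / 2 * x) by ring.
have -> : 10 * m%:R ^+ 2 * C * eps * (x * C) = x * (c / 2 * (K1 * eps)).
  by rewrite /K1; field; rewrite gt_eqF.
by rewrite ler_pM2l// ler_pM2l// divr_gt0.
Qed.

(* The estimated information matrix need not be symmetric, so the sandwich
involves the directions obtained from both its inverse and the transpose. *)
Let zh a := invmx Hh *m (row a L)^T.
Let zh' a := (invmx Hh)^T *m (row a L)^T.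

Let zh_close a : design_norm (zh a - z a) <= K1 * eps.
Proof.
apply: (perturb_solution (a := a)).
have E1 : Hh *m zh a = H *m z a.
  apply: etrans (esym (zE a)); apply: etrans (mulmxA _ _ _) _.
  by rewrite (mulmxV gee_Hh_unit) mul1mx.
have E := mulmx_diff E1.
move: (zh a - z a) E => v ->.
rewrite vdotBr; apply: le_trans (ler_norm _) _.
by rewrite distrC; exact: gee_H_perturb.
Qed.

Let zh'_close a : design_norm (zh' a - z a) <= K1 * eps.
Proof.
apply: (perturb_solution (a := a)).
have E1 : Hh^T *m zh' a = H *m z a.
  apply: etrans (esym (zE a)); apply: etrans (mulmxA _ _ _) _.
  by rewrite -trmx_mul (mulVmx gee_Hh_unit) trmx1 mul1mx.
have E := mulmx_diff E1.
move: (zh' a - z a) E => v E.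
rewrite (vdot_tr_diff H_sym E); apply: le_trans (ler_norm _) _.
by rewrite distrC [design_norm v * _]mulrC; exact: gee_H_perturb.
Qed.

Let P (al : 'I_n -> 'I_m -> 'I_m -> R) v i := \sum_j \sum_k xv i j v * al i j k.

Let P_slice al v K : 0 <= K -> (forall i j k, `|al i j k| <= K) ->
  l2 (P al v) <= m%:R ^+ 2 * (K * design_norm v).
Proof.
move=> K0 alK; rewrite -sum2_const.
apply: le_trans (l2_sum_le (fun j i => \sum_k xv i j v * al i j k)) _.
apply: ler_sum => j _; apply: le_trans (l2_sum_le (fun k i => xv i j v * al i j k)) _.
apply: ler_sum => k _; apply: le_trans (l2_mul_le _ K0 (fun i => alK i j k)) _.
by rewrite ler_wpM2l//; exact: (l2_slice (fun i j => xv i j v) j).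
Qed.

Let al0 i j k := rho i j k * Qb j k * e i k.

Let P_close al v a : (forall i j k, `|al i j k - al0 i j k| <= 15 * C ^+ 2 * eps) ->
  design_norm (v - z a) <= K1 * eps ->
  l2 (fun i => P al v i - P al0 (z a) i) <= m%:R ^+ 2 * (9 * C ^+ 2 * K1 + 15 * C ^+ 3) * eps.
Proof.
move=> al_close v_close.
have CC0 : 0 <= C ^+ 2 by rewrite exprn_ge0.
have al0_le i j k : `|al0 i j k| <= C ^+ 2.
  rewrite /al0 normrM -[leRHS]mulr1; apply: ler_pM => //.
  by rewrite normrM (ger0_norm (rho_ge0 _ _ _)) expr2; apply: ler_pM.
have al_le i j k : `|al i j k| <= 9 * C ^+ 2.
  have := ler_normD (al i j k - al0 i j k) (al0 i j k); rewrite subrK.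
  have h1 : 15 * C ^+ 2 * eps <= 15 * C ^+ 2 * (1/2).
    by rewrite ler_wpM2l ?mulr_ge0//; case/andP: eps01.
  by have := al_close i j k; have := al0_le i j k; move: h1; lra.
have -> : (fun i => P al v i - P al0 (z a) i) = (fun i => P al (v - z a) i +
    P (fun i j k => al i j k - al0 i j k) (z a) i).
  apply/funext => i; rewrite /P -sumrB -big_split/=; apply: eq_bigr => j _.
  rewrite -sumrB -big_split/=; apply: eq_bigr => k _.
  have -> : xv i j (v - z a) = xv i j v - xv i j (z a).
    by rewrite /xv mulmxBr [LHS]mxE [X in _ + X]mxE.
  by ring.
apply: le_trans (l2_triangle _ _) _.
rewrite -mulrA mulrDl mulrDr; apply: lerD.
  apply: le_trans (P_slice _ _ al_le) _; first by rewrite mulr_ge0.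
  by rewrite ler_wpM2l ?exprn_ge0// -mulrA ler_wpM2l ?mulr_ge0.
apply: le_trans (P_slice _ _ al_close) _; first by rewrite !mulr_ge0.
rewrite ler_wpM2l ?exprn_ge0//.
apply: (@le_trans _ _ (15 * C ^+ 2 * eps * C)).
  by rewrite ler_wpM2l// !mulr_ge0.
by rewrite le_eqVlt; apply/orP; left; apply/eqP; ring.
Qed.

Let K3 : R := m%:R ^+ 2 * (9 * C ^+ 2 * K1 + 15 * C ^+ 3).

Let K10 : 0 <= K1. Proof. by rewrite !mulr_ge0 ?exprn_ge0 ?invr_ge0// ltW. Qed.
Let K30 : 0 <= K3.
Proof. by apply: mulr_ge0; [exact: exprn_ge0|apply: addr_ge0; apply: mulr_ge0; rewrite ?K10 ?mulr_ge0 ?exprn_ge0]. Qed.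

Hypothesis lln : forall a b,
  `|\sum_i P al0 (z a) i * P al0 (z b) i - (a == b)%:R| <= eps.

(** With the two directions close to z a, the estimated sandwich is a sum over the
clusters of products of two contributions, each l2-close to its value at the
true parameter; there the law of large numbers lln applies. *)
Lemma gee_sandwich_close a b :
  `|(L *m gee_sandwich X Y Rh bh *m L^T) a b - (a == b)%:R| <=
  (K3 * (2 * (m%:R ^+ 2 * C ^+ 3) + K3) + 1) * eps.
Proof.
have -> : (L *m gee_sandwich X Y Rh bh *m L^T) a b =
    vdot (zh' a) (gee_M X Y Rh bh *m zh b).
  rewrite mulmx_tr_entry /gee_sandwich -!mulmxA -/(zh b).
  by rewrite [in RHS]/zh' vdot_mull trmxK.
rewrite vdot_gee_M.
pose al i j k := rho i j k * (th i j k * Q j k * (e i k - D i k)).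
pose al' i j k := rho i j k * (th i j k * Q k j * (e i k - D i k)).
have aw (q : R) i j k : gee_sd (X i) bh j * q / gee_sd (X i) bh k *
   (Y i k 0 - gee_pi (X i) bh k 0) = rho i j k * (th i j k * q * (e i k - D i k)).
  rewrite !gee_sd_shift -/(xv i j delta) -/(xv i k delta) -/(pi i j) -/(pi i k).
  rewrite -/(sd i j) -/(sd i k) -/(dd i j) -/(dd i k) -/(g i j) -/(g i k).
  rewrite /th /rho /D /e -/(pi i k).
  have := sd_gt0 i k; have := g_gt0 i j; have := g_gt0 i k => h1 h2 h3.
  by field; rewrite !gt_eqF.
rewrite (eq_bigr (fun i => P al (zh' a) i * P al' (zh b) i)); last first.
  move=> i _; congr (_ * _); apply: eq_bigr => j _; apply: eq_bigr => k _;
    by rewrite aw.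
have close (q : 'I_m -> 'I_m -> R) i j k : `|q j k| <= 2 * C -> `|q j k - Qb j k| <= eps ->
   `|rho i j k * (th i j k * q j k * (e i k - D i k)) - al0 i j k| <= 15 * C ^+ 2 * eps.
  move=> q1 q2.
  have -> : rho i j k * (th i j k * q j k * (e i k - D i k)) - al0 i j k =
    rho i j k * (- (th i j k * (q j k * D i k)) + (th i j k - 1) * (q j k * e i k)
      + (q j k - Qb j k) * e i k) by rewrite /al0; ring.
  rewrite normrM (ger0_norm (rho_ge0 _ _ _)).
  have -> : 15 * C ^+ 2 * eps = C * (15 * (C * eps)) by ring.
  apply: ler_pM => //.
  apply: le_trans (ler_normD _ _) _.
  have h0 := ler_normD (- (th i j k * (q j k * D i k))) ((th i j k - 1) * (q j k * e i k)).
  rewrite normrN in h0.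
  have h1 : `|th i j k * (q j k * D i k)| <= 3 * (2 * C * eps).
    by rewrite normrM; apply: ler_pM => //; rewrite normrM; apply: ler_pM.
  have h2 : `|(th i j k - 1) * (q j k * e i k)| <= 4 * eps * (2 * C * 1).
    by rewrite normrM; apply: ler_pM => //; rewrite normrM; apply: ler_pM.
  have h3 : `|(q j k - Qb j k) * e i k| <= eps * 1.
    by rewrite normrM; apply: ler_pM.
  have h4 : eps <= C * eps by rewrite ler_peMl.
  have e5 : 3 * (2 * C * eps) = 6 * (C * eps) by ring.
  have e6 : 4 * eps * (2 * C * 1) = 8 * (C * eps) by ring.
  rewrite e5 in h1; rewrite e6 in h2; rewrite mulr1 in h3.
  apply: le_trans (lerD (le_trans h0 (lerD h1 h2)) h3) _.
  by move: h4; set t := C * eps; lra.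
have QbC j k : Qb k j = Qb j k by rewrite -[in LHS]Qb_sym mxE.
have pa := P_close (fun i j k => close Q i j k (Q_le j k) (dQ j k)) (zh'_close a).
have pb : l2 (fun i => P al' (zh b) i - P al0 (z b) i) <= K3 * eps.
  apply: P_close (zh_close b) => i j k.
  apply: (close (fun j k => Q k j)); first exact: Q_le.
  by rewrite -QbC; exact: dQ.
have l0 b' : l2 (P al0 (z b')) <= m%:R ^+ 2 * C ^+ 3.
  apply: le_trans (P_slice (K := C ^+ 2) _ _ _) _; first by rewrite exprn_ge0.
    move=> i j k; rewrite /al0 normrM -[leRHS]mulr1; apply: ler_pM => //.
    by rewrite normrM (ger0_norm (rho_ge0 _ _ _)) expr2; apply: ler_pM.
  by rewrite ler_wpM2l ?exprn_ge0// [leRHS]exprSr ler_wpM2l ?exprn_ge0.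
set f1 := P al (zh' a) in pa *; set f2 := P al' (zh b) in pb *.
set g1 := P al0 (z a) in pa *; set g2 := P al0 (z b) in pb *.
have -> : \sum_i f1 i * f2 i - (a == b)%:R =
  \sum_i (f1 i - g1 i) * (f2 i - g2 i) + \sum_i (f1 i - g1 i) * g2 i
  + \sum_i g1 i * (f2 i - g2 i) + (\sum_i g1 i * g2 i - (a == b)%:R).
  rewrite addrA; congr (_ - _); rewrite -!big_split/=; apply: eq_bigr => i _; ring.
have KE : (K3 * (2 * (m%:R ^+ 2 * C ^+ 3) + K3) + 1) * eps =
  (K3 * eps) * K3 + (K3 * eps) * (m%:R ^+ 2 * C ^+ 3)
  + (m%:R ^+ 2 * C ^+ 3) * (K3 * eps) + eps by ring.
have mC0 : 0 <= m%:R ^+ 2 * C ^+ 3 by rewrite mulr_ge0 ?exprn_ge0.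
rewrite KE.
apply: le_trans (ler_normD _ _) _; apply: lerD; last exact: lln.
apply: le_trans (ler_normD _ _) _; apply: lerD; last first.
  apply: le_trans (l2_cauchy_schwarz _ _) _.
  by apply: ler_pM; [exact: l2_ge0|exact: l2_ge0|exact: (l0 a)|exact: pb].
apply: le_trans (ler_normD _ _) _; apply: lerD.
  apply: le_trans (l2_cauchy_schwarz _ _) _.
  apply: ler_pM; [exact: l2_ge0|exact: l2_ge0|exact: pa|].
  apply: (le_trans pb); rewrite -[leRHS]mulr1 ler_wpM2l//.
  by have := eps01; lra.
apply: le_trans (l2_cauchy_schwarz _ _) _.
by apply: ler_pM; [exact: l2_ge0|exact: l2_ge0|exact: pa|exact: (l0 b)].
Qed.

End Sandwich.
End CoreBounds.

#[local] Transparent vdot gee_S gee_H gee_M.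

(** * From the score to the Wald statistic *)

Section QuadraticForm.
Context {R : realType} (l : nat).

Let l1 (x : 'cV[R]_l) : R := \sum_a `|x a 0|.

Let l1_ge0 x : 0 <= l1 x. Proof. exact: sumr_ge0. Qed.

Let near_id (B : 'M[R]_l) (s : R) (x : 'cV[R]_l) a :
  (forall a b, `|B a b - (a == b)%:R| <= s) ->
  `|x a 0 - (B *m x) a 0| <= s * l1 x.
Proof.
move=> Bs.
have -> : x a 0 - (B *m x) a 0 = \sum_b ((a == b)%:R - B a b) * x b 0.
  rewrite mxE [RHS](eq_bigr (fun b => (a == b)%:R * x b 0 - B a b * x b 0)); last by move=> b _; rewrite mulrBl.
  rewrite sumrB; congr (_ - _); rewrite (bigD1 a)//= eqxx mul1r big1 ?addr0// => b.
  by rewrite eq_sym => /negbTE ->; rewrite mul0r.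
apply: le_trans (ler_norm_sum _ _ _) _; rewrite /l1 mulr_sumr; apply: ler_sum => b _.
by rewrite normrM distrC ler_wpM2r.
Qed.

Let near_id_l1 (B : 'M[R]_l) (s : R) (x : 'cV[R]_l) : l%:R * s <= 1/2 ->
  (forall a b, `|B a b - (a == b)%:R| <= s) -> l1 x <= 2 * l1 (B *m x).
Proof.
move=> ls Bs.
have h : l1 x <= l1 (B *m x) + l%:R * s * l1 x.
  apply: (@le_trans _ _ (\sum_a (`|(B *m x) a 0| + s * l1 x))).
    apply: ler_sum => a _; have := ler_normD ((B *m x) a 0) (x a 0 - (B *m x) a 0).
    rewrite addrCA subrr addr0 => h; apply: (le_trans h); rewrite lerD2l.
    exact: near_id.
  by rewrite big_split/= lerD2l sumr_const card_ord -mulrA -[leLHS]mulr_natl.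
have := ler_wpM2r (l1_ge0 x) ls.
by move: h; set t := l%:R * s * l1 x; lra.
Qed.

(** A matrix B close to the identity can be inverted in a quadratic form at the
cost of an error of the order of the distance: if x solves B x = V then
x - V = (1 - B) x is small. *)
Lemma quadform_close (B : 'M[R]_l) (V : 'cV[R]_l) (U : 'I_l -> R) (s Ku : R) :
  1 <= Ku -> 0 <= s <= 1 -> l%:R * s <= 1/2 ->
  (forall a b, `|B a b - (a == b)%:R| <= s) ->
  (forall a, `|V a 0 - U a| <= s) -> (forall a, `|U a| <= Ku) ->
  B \in unitmx /\
  `|(V^T *m invmx B *m V) 0 0 - \sum_a U a ^+ 2|
    <= (3 * l%:R * Ku + 8 * l%:R ^+ 2 * Ku ^+ 2) * s.
Proof.
move=> Ku1 /andP[s0 s1] ls Bs VU UK.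
have Bu : B \in unitmx.
  apply: inj_unitmx => v Bv; have := near_id_l1 v ls Bs.
  have -> : l1 (B *m v) = 0 by rewrite Bv /l1 big1// => a _; rewrite mxE normr0.
  rewrite mulr0 => h; apply/matrixP => a j; rewrite ord1 mxE.
  apply/eqP; rewrite -normr_eq0 eq_le normr_ge0 andbT; apply: le_trans h.
  by rewrite /l1 (bigD1 a)//= lerDl sumr_ge0.
split=> //.
set x := invmx B *m V; have Bx : B *m x = V by rewrite /x mulKVmx.
have VK a : `|V a 0| <= 2 * Ku.
  have := ler_normD (V a 0 - U a) (U a); rewrite subrK.
  by have := VU a; have := UK a; lra.
have xK : l1 x <= 4 * (l%:R * Ku).
  have := near_id_l1 x ls Bs; rewrite Bx => h; apply: (le_trans h).
  have : l1 V <= \sum_(a < l) 2 * Ku by apply: ler_sum.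
  rewrite sumr_const card_ord -[leRHS]mulr_natl.
  by rewrite (_ : l%:R * (2 * Ku) = 2 * (l%:R * Ku)); [lra|ring].
have -> : (V^T *m invmx B *m V) 0 0 = \sum_a V a 0 * x a 0.
  by rewrite -mulmxA -/x mxE; apply: eq_bigr => a _; rewrite mxE.
rewrite -sumrB; apply: le_trans (ler_norm_sum _ _ _) _.
apply: (@le_trans _ _ (\sum_(a < l) (3 * Ku * s + 2 * Ku * (s * (4 * (l%:R * Ku)))))).
  apply: ler_sum => a _.
  have -> : V a 0 * x a 0 - U a ^+ 2 =
    (V a 0 - U a) * (V a 0 + U a) + V a 0 * (x a 0 - V a 0) by ring.
  apply: le_trans (ler_normD _ _) _; apply: lerD.
    rewrite normrM mulrC; apply: ler_pM => //.
    by apply: le_trans (ler_normD _ _) _; have := VK a; have := UK a; lra.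
  rewrite normrM; apply: ler_pM => //.
  rewrite -[in X in X <= _]Bx; apply: le_trans (near_id _ _ Bs) _.
  by rewrite ler_wpM2l.
rewrite sumr_const card_ord -[leLHS]mulr_natl le_eqVlt; apply/orP; left; apply/eqP; ring.
Qed.

End QuadraticForm.

(** The Wald statistic only depends on the row space of the contrast matrix: this
allows the contrasts to be normalized so that the score has identity covariance. *)
Lemma gee_wald_mull (R : realType) (m p n l : nat) (X : 'I_n -> 'M[R]_(m, p))
  (Y : 'I_n -> 'cV[R]_m) (Rh : 'M[R]_m) (b : 'cV[R]_p) (L : 'M[R]_(l, p))
  (T : 'M[R]_l) : T \in unitmx ->
  (T *m L) *m gee_sandwich X Y Rh b *m (T *m L)^T \in unitmx ->
  gee_wald X Y Rh (T *m L) b = gee_wald X Y Rh L b.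
Proof.
rewrite /gee_wald; move: (gee_sandwich _ _ _ _) => S Tu.
have -> : T *m L *m S *m (T *m L)^T = T *m (L *m S *m L^T) *m T^T.
  by rewrite trmx_mul !mulmxA.
move: (L *m S *m L^T) => G.
have -> : T *m L *m b = T *m (L *m b) by rewrite mulmxA.
move: (L *m b) => v; rewrite !unitmx_mul unitmx_tr => /andP[/andP[_ Gu] _].
have TTu : T^T \in unitmx by rewrite unitmx_tr.
have -> : invmx (T *m G *m T^T) = invmx T^T *m (invmx G *m invmx T).
  have Bu : T *m G *m T^T \in unitmx by rewrite !unitmx_mul Tu Gu.
  apply: (can_inj (mulKmx Bu)); rewrite mulmxV// -!mulmxA (mulmxA T^T) mulmxV// mul1mx.
  by rewrite (mulmxA G) mulmxV// mul1mx mulmxV.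
rewrite trmx_mul; congr (_ 0 0).
by rewrite -!mulmxA (mulmxA T^T) mulmxV// mul1mx (mulmxA (invmx T)) mulVmx// mul1mx.
Qed.

Section WaldApproximation.
Context {R : realType} (m : nat).

(** The contribution of a cluster to the estimating function in the
direction z. *)
Definition gee_score p (X : 'M[R]_(m, p)) (Rb : 'M[R]_m) (b : 'cV[R]_p)
    (y : 'cV[R]_m) (z : 'cV[R]_p) : R :=
  \sum_j \sum_k (X *m z) j 0 *
    (gee_sd X b j / gee_sd X b k * invmx Rb j k * (y k 0 - gee_pi X b k 0)).

Lemma vdot_gee_S_score n p (X : 'I_n -> 'M[R]_(m, p)) (Y : 'I_n -> 'cV[R]_m)
  (Rb : 'M[R]_m) (b z : 'cV[R]_p) :
  vdot z (gee_S X Y Rb b) = \sum_i gee_score (X i) Rb b (Y i) z.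
Proof.
rewrite vdot_gee_S; apply: eq_bigr => i _; apply: eq_bigr => j _.
apply: eq_bigr => k _; congr (_ * (_ * _)).
by rewrite -!mulrA [(_)^-1 * _]mulrC.
Qed.

(** In the normalized directions z the contrast of the estimator is H-dual to the
estimation error, which the linearization identifies with the score, and the
sandwich is close to the identity; [quadform_close] combines the two. The
constant is uniform over all samples and depends only on the bounds. *)
Lemma gee_wald_close (l : nat) (C c : R) : 1 <= C -> 0 < c ->
  exists Kf : R -> R, forall Ku, 1 <= Ku -> 0 < Kf Ku /\
  forall p n (X : 'I_n -> 'M[R]_(m, p)) (Y : 'I_n -> 'cV[R]_m)
    (Rh Rb : 'M[R]_m) (b0 delta : 'cV[R]_p) (L : 'M[R]_(l, p)) (T : 'M[R]_l)
    (z : 'I_l -> 'cV[R]_p) (eps Dm : R),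
  [/\ 0 <= eps, Kf Ku * eps <= 1, Dm <= eps & Dm * design_norm X delta <= eps] ->
  (forall i j, `|(X i *m delta) j 0| <= Dm) ->
  (forall j k, `|invmx Rh j k - invmx Rb j k| <= eps /\
     `|invmx Rh j k - invmx Rb j k| * design_norm X delta <= eps) ->
  [/\ forall j k, `|invmx Rb j k| <= C,
      forall i j k, gee_sd (X i) b0 j / gee_sd (X i) b0 k <= C,
      (forall i j, Y i j 0 = 0 \/ Y i j 0 = 1) & (invmx Rb)^T = invmx Rb] ->
  (forall v, c * design_norm X v ^+ 2 <= vdot v (gee_H X Rb b0 *m v)) ->
  (forall v, design_norm X v = 0 -> v = 0) ->
  [/\ forall a, design_norm X (z a) <= C,
      forall a, gee_H X Rb b0 *m z a = (row a (T *m L))^T,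
      T \in unitmx & L *m b0 = 0] ->
  (forall a b, `|\sum_i gee_score (X i) Rb b0 (Y i) (z a) *
       gee_score (X i) Rb b0 (Y i) (z b) - (a == b)%:R| <= eps) ->
  (forall a j k,
   [/\ `|(invmx Rh j k - invmx Rb j k) *
           \sum_i (X i *m z a) j 0 * (gee_sd (X i) b0 j / gee_sd (X i) b0 k) *
              (Y i k 0 - gee_pi (X i) b0 k 0)| <= eps,
       `|\sum_i (X i *m z a) j 0 * (gee_sd (X i) b0 j / gee_sd (X i) b0 k) *
              ((gee_pi (X i) b0 j 0 - 1 / 2) * (X i *m delta) j 0) *
              (Y i k 0 - gee_pi (X i) b0 k 0)| <= eps &
       `|\sum_i (X i *m z a) j 0 * (gee_sd (X i) b0 j / gee_sd (X i) b0 k) *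
              ((gee_pi (X i) b0 k 0 - 1 / 2) * (X i *m delta) k 0) *
              (Y i k 0 - gee_pi (X i) b0 k 0)| <= eps]) ->
  (forall a, `|\sum_i gee_score (X i) Rb b0 (Y i) (z a)| <= Ku) ->
  gee_S X Y Rh (b0 + delta) = 0 ->
  `|gee_wald X Y Rh L (b0 + delta)
      - \sum_a (\sum_i gee_score (X i) Rb b0 (Y i) (z a)) ^+ 2| <= Kf Ku * eps.
Proof.
move=> C1 c0.
have C0 : 0 <= C by apply: le_trans C1.
pose K1 : R := m%:R ^+ 2 *
         (9 * C ^+ 2 * (20 * m%:R ^+ 2 * C ^+ 2 / c) + 15 * C ^+ 3) *
         (2 * (m%:R ^+ 2 * C ^+ 3) +
          m%:R ^+ 2 *
          (9 * C ^+ 2 * (20 * m%:R ^+ 2 * C ^+ 2 / c) + 15 * C ^+ 3)) + 1.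
pose K2 : R := 34 * m%:R ^+ 2 * C ^+ 3.
have p1 : 0 <= K1.
  by rewrite /K1 !(addr_ge0, mulr_ge0, exprn_ge0, invr_ge0)// ltW.
have p2 : 0 <= K2 by rewrite /K2 !(mulr_ge0, exprn_ge0).
exists (fun Ku => 2 + 20 * m%:R ^+ 2 * C / c + (K1 + K2) + 2 * l%:R * (K1 + K2)
  + (3 * l%:R * Ku + 8 * l%:R ^+ 2 * Ku ^+ 2) * (K1 + K2)) => Ku Ku1.
pose K3 : R := 3 * l%:R * Ku + 8 * l%:R ^+ 2 * Ku ^+ 2.
have p3 : 0 <= K3.
  have Ku0 : 0 <= Ku by apply: le_trans Ku1.
  by rewrite /K3 !(addr_ge0, mulr_ge0, exprn_ge0).
have p4 : 0 <= 20 * m%:R ^+ 2 * C / c.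
  by rewrite !(mulr_ge0, exprn_ge0, invr_ge0)// ltW.
have p12 : 0 <= K1 + K2 by exact: addr_ge0.
have p5 : 0 <= 2 * l%:R * (K1 + K2) by apply: mulr_ge0 => //; rewrite mulr_ge0.
have p6 : 0 <= K3 * (K1 + K2) by exact: mulr_ge0.
pose K : R := 2 + 20 * m%:R ^+ 2 * C / c + (K1 + K2) + 2 * l%:R * (K1 + K2)
  + K3 * (K1 + K2).
rewrite -/K3 -/K; split; first by move: p1 p2 p4 p5 p6; rewrite /K; lra.
move=> p n X Y Rh Rb b0 delta L T z eps Dm [e0 Keps Dm_le Dm_l2] dd_le dQ
  [Qb_le rho_le Y01 Qb_sym] H_low inj [z_le zE Tu Lb0] lln rnd Ule S0.
have small x : x <= K -> x * eps <= 1.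
  by move=> xK; apply: le_trans Keps; rewrite ler_wpM2r.
have eps01 : 0 <= eps <= 1/2.
  have : 2 * eps <= 1 by apply: small; move: p1 p2 p4 p5 p6; rewrite /K; lra.
  by rewrite e0/=; lra.
have epsc : 10 * m%:R ^+ 2 * C * eps <= c / 2.
  have : 20 * m%:R ^+ 2 * C / c * eps <= 1.
    by apply: small; move: p1 p2 p4 p5 p6; rewrite /K; lra.
  rewrite mulrAC ler_pdivrMr// mul1r.
  rewrite (_ : 20 * m%:R ^+ 2 * C * eps = 2 * (10 * m%:R ^+ 2 * C * eps)); last by ring.
  by lra.
have e1 : (K1 + K2) * eps <= 1.
  by apply: small; move: p1 p2 p4 p5 p6; rewrite /K; lra.
have e2 : l%:R * ((K1 + K2) * eps) <= 1/2.
  have : 2 * l%:R * (K1 + K2) * eps <= 1.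
    by apply: small; move: p1 p2 p4 p5 p6; rewrite /K; lra.
  rewrite (_ : 2 * l%:R * (K1 + K2) * eps = 2 * (l%:R * ((K1 + K2) * eps))); last by ring.
  by lra.
have dQ1 j k := (dQ j k).1; have dQ2 j k := (dQ j k).2.
have close := gee_sandwich_close C1 eps01 Dm_le dd_le dQ1 Qb_le rho_le Y01 c0
  Qb_sym H_low inj epsc z_le zE lln.
have [K1e K2e] : K1 * eps <= (K1 + K2) * eps /\ K2 * eps <= (K1 + K2) * eps.
  by split; rewrite ler_wpM2r// ?lerDl ?lerDr.
have Uclose a : `|(T *m L *m (b0 + delta)) a 0 -
    \sum_i gee_score (X i) Rb b0 (Y i) (z a)| <= (K1 + K2) * eps.
  have -> : (T *m L *m (b0 + delta)) a 0 = vdot (z a) (gee_H X Rb b0 *m delta).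
    rewrite mulmxDr -[T *m L *m b0]mulmxA Lb0 mulmx0 add0r mulmx_entry -zE.
    by rewrite vdot_mull gee_H_tr.
  rewrite -vdot_gee_S_score distrC; apply: le_trans K2e.
  apply: (gee_linearization C1 eps01 Dm_le dd_le Dm_l2 dQ1 dQ2 Qb_le rho_le Y01
    (z_le a)) => //.
  - by move=> j k; have [] := rnd a j k.
  - by move=> j k; have [] := rnd a j k.
  - by move=> j k; have [] := rnd a j k.
have es : 0 <= (K1 + K2) * eps <= 1 by rewrite e1 andbT; exact: mulr_ge0.
have Bclose a b := le_trans (close a b) K1e.
have [Bu h] := quadform_close Ku1 es e2 Bclose Uclose Ule.
rewrite -(gee_wald_mull Tu Bu) /gee_wald; apply: le_trans h _.
rewrite mulrA -/K3; apply: ler_wpM2r => //.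
by move: p1 p2 p4 p5 p6; rewrite /K; lra.
Qed.

End WaldApproximation.

(** * Normalizing the score *)

Section PositiveInverse.
Context {R : realType} (m : nat).

Lemma posdef_unit (A : 'M[R]_m) (c : R) : 0 < c ->
  (forall v, c * vdot v v <= vdot v (A *m v)) -> A \in unitmx.
Proof.
move=> c0 low; apply: inj_unitmx => v Av; apply/eqP.
have := low v; rewrite Av vdotr0 pmulr_rle0// => h.
by rewrite -vdot_eq0 eq_le h vdot_ge0.
Qed.

(** The lower bound for the inverse is obtained from the nonnegativity of the
form at w - v/d, where A w = v. *)
Lemma posdef_inverse (A : 'M[R]_m) (c d : R) : 0 < c -> 0 < d -> A^T = A ->
  (forall v, c * vdot v v <= vdot v (A *m v)) ->
  (forall v, vdot v (A *m v) <= d * vdot v v) ->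
  [/\ (invmx A)^T = invmx A,
      forall v, d^-1 * vdot v v <= vdot v (invmx A *m v) &
      forall j k, `|invmx A j k| <= c^-1].
Proof.
move=> c0 d0 Asym low up; have Au := posdef_unit c0 low.
split; first by rewrite trmx_inv Asym.
- move=> v; set w := invmx A *m v.
  have Aw : A *m w = v by rewrite /w mulKVmx.
  have h0 : 0 <= vdot (w - d^-1 *: v) (A *m (w - d^-1 *: v)).
    by apply: le_trans (low _); rewrite mulr_ge0 ?vdot_ge0// ltW.
  have h1 : vdot (w - d^-1 *: v) (A *m (w - d^-1 *: v)) =
      vdot v w - 2 * (d^-1 * vdot v v) + d^-1 ^+ 2 * vdot v (A *m v).
    have vB (x y u : 'cV[R]_m) : vdot (x - y) u = vdot x u - vdot y u.
      by rewrite ![vdot _ u]vdotC vdotBr.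
    have wAv : vdot w (A *m v) = vdot v v by rewrite vdotC vdot_mull Asym Aw.
    rewrite mulmxBr -scalemxAr Aw !vdotBr !vB !vdotZl !vdotZr wAv (vdotC w v).
    by ring.
  have h2 : d^-1 ^+ 2 * vdot v (A *m v) <= d^-1 * vdot v v.
    apply: (@le_trans _ _ (d^-1 ^+ 2 * (d * vdot v v))).
      by rewrite ler_wpM2l ?sqr_ge0.
    by rewrite mulrA expr2 mulfVK ?gt_eqF.
  move: h0; rewrite h1; move: h2.
  move: (d^-1 ^+ 2 * _) (vdot v w) (d^-1 * _) => x y t; lra.
- move=> j k; pose v : 'cV[R]_m := delta_mx k 0; pose u : 'cV[R]_m := delta_mx j 0.
  have n1 i : vnorm (delta_mx i 0 : 'cV[R]_m) = 1.
    rewrite /vnorm /l2 (bigD1 i)//= big1 ?addr0 => [|i' /negbTE h].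
      by rewrite !mxE !eqxx expr1n sqrtr1.
    by rewrite !mxE h expr0n.
  set w := invmx A *m v.
  have Aw : A *m w = v by rewrite /w mulKVmx.
  have -> : invmx A j k = vdot u w.
    by rewrite vdotE (bigD1 j)//= big1 => [|i /negbTE h];
      rewrite /u /w -?colE !mxE ?h ?mul0r// !eqxx mul1r addr0.
  apply: le_trans (vdot_norm_le _ _) _; rewrite n1 mul1r.
  have h : c * vnorm w ^+ 2 <= vnorm w.
    rewrite vnorm_sqr; apply: le_trans (low w) _; rewrite Aw.
    by apply: le_trans (ler_norm _) _; apply: le_trans (vdot_norm_le _ _) _;
      rewrite n1 mulr1.
  have [->|w0] := eqVneq (vnorm w) 0; first by rewrite invr_ge0 ltW.
  have wp : 0 < vnorm w by rewrite lt_neqAle eq_sym w0 vnorm_ge0.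
  rewrite -[leRHS]mulr1 ler_pdivlMl// -(ler_pM2r wp) mul1r.
  by apply: le_trans h; rewrite expr2 mulrA.
Qed.

(** Positivity on nonzero vectors is quantitative in finite dimension: the smallest
eigenvalue is attained. *)
Lemma whitening_posdef (G : 'M[R]_m) : G^T = G ->
  (forall v, v != 0 -> 0 < vdot v (G *m v)) ->
  exists T : 'M[R]_m, T *m G *m T^T = 1%:M.
Proof.
move=> Gsym Gpos; case: m => [|k] in G Gsym Gpos *.
  by exists 0; apply/matrixP => -[].
have [a aG aP] := rayleigh_min Gsym (ltn0Sn _).
apply: (@whitening _ _ _ a) => //.
have [v vE v0] := eigenvalue_vdot aG.
rewrite -(pmulr_lgt0 _ v0) -vE; apply: Gpos.
by rewrite -vdot_eq0 gt_eqF.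
Qed.

End PositiveInverse.

Section Normalization.
Context {R : realType} (m p n l : nat).
Variables (X : 'I_n -> 'M[R]_(m, p)) (Rb R0 : 'M[R]_m) (b0 : 'cV[R]_p).
Variable L : 'M[R]_(l, p).
Local Notation A := {ffun 'I_m -> bool}.
Variable q : 'I_n -> A -> R.
Local Notation Qb := (invmx Rb).
Local Notation H := (gee_H X Rb b0).
Local Notation sd i j := (gee_sd (X i) b0 j).
Local Notation pi i j := (gee_pi (X i) b0 j 0).

Definition bits_col (a : A) : 'cV[R]_m := \col_j (a j)%:R.

Local Notation score i z a := (gee_score (X i) Rb b0 (bits_col a) z).

Variables (al cq r : R).
Hypothesis al0 : 0 < al.
Hypothesis cq0 : 0 < cq.
Hypothesis r0 : 0 < r.
Hypothesis sd_low : forall i j, al <= sd i j.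
Hypothesis Qb_sym : Qb^T = Qb.
Hypothesis Qb_low : forall v, cq * vdot v v <= vdot v (Qb *m v).
Hypothesis R0_low : forall v, r * vdot v v <= vdot v (R0 *m v).
Hypothesis q_cov : forall i j k,
  mexp q i (fun a => ((a j)%:R - pi i j) * ((a k)%:R - pi i k)) =
  sd i j * sd i k * R0 j k.

(* The score of cluster i in the direction z is the pairing of Qb (s i z) with the
standardized residuals, whose covariance is R0. *)
Let s i (z : 'cV[R]_p) : 'cV[R]_m := \col_j (sd i j * (X i *m z) j 0).

Let s_low z : al ^+ 2 * design_norm X z ^+ 2 <= \sum_i vdot (s i z) (s i z).
Proof.
rewrite l2_sqr -(pair_bigA_idem _ (fun i j => (X i *m z) j 0 ^+ 2))/= ?addr0//.
rewrite mulr_sumr; apply: ler_sum => i _; rewrite vdotE mulr_sumr.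
apply: ler_sum => j _; rewrite -expr2 [s i z j 0]mxE exprMn ler_wpM2r ?sqr_ge0//.
by rewrite ler_pXn2r ?nnegrE ?sd_low// ltW//; exact: lt_le_trans (sd_low i j).
Qed.

Lemma gee_H_low v : cq * al ^+ 2 * design_norm X v ^+ 2 <= vdot v (H *m v).
Proof.
rewrite -mulrA; apply: (@le_trans _ _ (cq * \sum_i vdot (s i v) (s i v))).
  by rewrite ler_pM2l// s_low.
rewrite mulr_sumr vdot_gee_H; apply: ler_sum => i _; apply: le_trans (Qb_low _) _.
rewrite vdotE le_eqVlt; apply/orP; left; apply/eqP; apply: eq_bigr => j _.
rewrite [(Qb *m _) j 0]mxE mulr_sumr; apply: eq_bigr => k _.
by rewrite ![s _ _ _ _]mxE; ring.
Qed.

Let t i z := Qb *m s i z.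

Let scoreE i z a : score i z a =
  \sum_k t i z k 0 * (((a k)%:R - pi i k) / sd i k).
Proof.
rewrite /gee_score exchange_big/=; apply: eq_bigr => k _.
rewrite /t [(Qb *m _) k 0]mxE mulr_suml; apply: eq_bigr => j _.
rewrite [bits_col a k 0]mxE [s i z j 0]mxE.
have -> : Qb k j = Qb j k by rewrite -[in LHS]Qb_sym mxE.
by ring.
Qed.

Let score_cov i u v : mexp q i (fun a => score i u a * score i v a) =
  vdot (t i u) (R0 *m t i v).
Proof.
have -> : (fun a => score i u a * score i v a) = (fun a => \sum_k \sum_k'
   (t i u k 0 / sd i k) * (t i v k' 0 / sd i k') * (((a k)%:R - pi i k) * ((a k')%:R - pi i k'))).
  apply/funext => a; rewrite !scoreE mulr_suml; apply: eq_bigr => k _.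
  by rewrite mulr_sumr; apply: eq_bigr => k' _; ring.
rewrite /mexp; under eq_bigr do rewrite mulr_sumr.
rewrite exchange_big vdotE; apply: eq_bigr => k _.
under eq_bigr do rewrite mulr_sumr.
rewrite exchange_big [(R0 *m _) k 0]mxE mulr_sumr; apply: eq_bigr => k' _.
transitivity (t i u k 0 / sd i k * (t i v k' 0 / sd i k') *
   mexp q i (fun a => ((a k)%:R - pi i k) * ((a k')%:R - pi i k'))).
  by rewrite /mexp mulr_sumr; apply: eq_bigr => a _; ring.
have h1 := gee_sd_gt0 (X i) b0 k; have h2 := gee_sd_gt0 (X i) b0 k'.
by rewrite q_cov; field; rewrite !gt_eqF.
Qed.

(** Nondegeneracy of the score in every direction, in the units of the
design. *)
Lemma score_var_low u : r * (cq ^+ 2 * (al ^+ 2 * design_norm X u ^+ 2)) <=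
  \sum_i mexp q i (fun a => score i u a * score i u a).
Proof.
apply: (@le_trans _ _ (r * (cq ^+ 2 * \sum_i vdot (s i u) (s i u)))).
  by rewrite ler_pM2l// ler_pM2l ?exprn_gt0// s_low.
rewrite !mulr_sumr; apply: ler_sum => i _; rewrite score_cov.
apply: le_trans (R0_low _); rewrite ler_pM2l//.
set x := s i u; rewrite /t -/x.
have h : cq * vnorm x ^+ 2 <= vnorm x * vnorm (Qb *m x).
  rewrite vnorm_sqr; apply: le_trans (Qb_low x) _.
  by apply: le_trans (ler_norm _) _; exact: vdot_norm_le.
rewrite -!vnorm_sqr -exprMn ler_pXn2r ?nnegrE ?mulr_ge0 ?vnorm_ge0// ?(ltW cq0)//.
have [->|x0] := eqVneq (vnorm x) 0; first by rewrite mulr0 vnorm_ge0.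
have xp : 0 < vnorm x by rewrite lt_neqAle eq_sym x0 vnorm_ge0.
by rewrite -(ler_pM2l xp); apply: le_trans h; rewrite expr2 mulrCA.
Qed.

Hypothesis design_inj : forall v, design_norm X v = 0 -> v = 0.
Hypothesis L_orth : L *m L^T = 1%:M.

Let Hu : H \in unitmx.
Proof.
apply: inj_unitmx => v Hv; apply: design_inj; have := gee_H_low v.
rewrite Hv vdotr0 pmulr_rle0 ?mulr_gt0 ?exprn_gt0// => h.
by apply/eqP; rewrite -sqrf_eq0 eq_le h sqr_ge0.
Qed.

Let score_col (M : 'M[R]_(p, l)) (x : 'cV[R]_l) i a :
  score i (M *m x) a = \sum_b x b 0 * score i (col b M) a.
Proof.
rewrite /gee_score.
under [RHS]eq_bigr do rewrite mulr_sumr.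
rewrite [RHS]exchange_big/=; apply: eq_bigr => j _.
under [RHS]eq_bigr do rewrite mulr_sumr.
rewrite [RHS]exchange_big/=; apply: eq_bigr => k _.
rewrite mulmxA [(_ *m x) j 0]mxE mulr_suml; apply: eq_bigr => b _.
have -> : (X i *m col b M) j 0 = (X i *m M) j b.
  by rewrite colE mulmxA -colE mxE.
by ring.
Qed.

(** The covariance matrix of the score in the directions H^-1 L^T is positive
definite since L has full rank, and T whitens it. The size of the resulting z
comes for free: unit variance and [score_var_low] bound the design norm. *)
Lemma gee_normalizer : exists (T : 'M[R]_l) (z : 'I_l -> 'cV[R]_p),
  [/\ T \in unitmx,
      forall a, H *m z a = (row a (T *m L))^T,
      forall a b, \sum_i mexp q i (fun w => score i (z a) w * score i (z b) w)
        = (a == b)%:R &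
      forall a, design_norm X (z a) <= (Num.sqrt r * (cq * al))^-1].
Proof.
pose M := invmx H *m L^T.
pose G : 'M[R]_l := \matrix_(a, b)
  \sum_i mexp q i (fun w => score i (col a M) w * score i (col b M) w).
have Gform x y : vdot x (G *m y) =
    \sum_i mexp q i (fun w => score i (M *m x) w * score i (M *m y) w).
  transitivity (\sum_i \sum_a \sum_b x a 0 * y b 0 *
      mexp q i (fun w => score i (col a M) w * score i (col b M) w)).
    rewrite vdotE exchange_big; apply: eq_bigr => a _; rewrite [(G *m y) a 0]mxE mulr_sumr exchange_big.
    by apply: eq_bigr => b _; rewrite [G a b]mxE mulr_suml mulr_sumr; apply: eq_bigr => i _; ring.
  apply: eq_bigr => i _; rewrite /mexp.
  transitivity (\sum_w \sum_a \sum_b x a 0 * y b 0 *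
      (q i w * (score i (col a M) w * score i (col b M) w))).
    rewrite [RHS]exchange_big/=; apply: eq_bigr => a _.
    by rewrite [RHS]exchange_big/=; apply: eq_bigr => b _; rewrite mulr_sumr.
  apply: eq_bigr => w _; rewrite !score_col mulr_suml mulr_sumr.
  apply: eq_bigr => a _; rewrite mulr_sumr mulr_sumr; apply: eq_bigr => b _; ring.
have Gsym : G^T = G.
  apply/matrixP => a b; rewrite !mxE; apply: eq_bigr => i _; congr mexp.
  by apply/funext => w; rewrite mulrC.
have G_gt0 : forall v, v != 0 -> 0 < vdot v (G *m v).
  move=> v v0; rewrite Gform; apply: lt_le_trans (score_var_low _).
  suff dM : 0 < design_norm X (M *m v) by rewrite !mulr_gt0 ?exprn_gt0.
  rewrite lt_neqAle l2_ge0 andbT eq_sym.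
  apply/eqP => /design_inj Mv; move/eqP: v0; apply.
  have HM : L *m (H *m (M *m v)) = v.
    by rewrite /M -!mulmxA mulKVmx// mulmxA L_orth mul1mx.
  by rewrite -HM Mv !mulmx0.
have [T TG] := whitening_posdef Gsym G_gt0.
exists T, (fun a => M *m (row a T)^T).
have cov a b : \sum_i mexp q i (fun w => score i (M *m (row a T)^T) w *
    score i (M *m (row b T)^T) w) = (a == b)%:R.
  by rewrite -Gform -mulmx_tr_entry TG mxE.
split => //.
- have := @unitmx1 R l; rewrite -TG !unitmx_mul.
  by case/andP => /andP[].
- by move=> a; rewrite /M -!mulmxA mulKVmx// row_mul trmx_mul.
- move=> a; have := score_var_low (M *m (row a T)^T); rewrite cov eqxx.
  set x := design_norm _ _ => h.
  have d0 : 0 < Num.sqrt r * (cq * al) by rewrite !mulr_gt0// sqrtr_gt0.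
  have xd0 : 0 <= x * (Num.sqrt r * (cq * al)).
    by apply: mulr_ge0; [exact: l2_ge0|exact: ltW].
  rewrite -[leRHS]mul1r ler_pdivlMr// -(@ler_pXn2r _ 2)// ?nnegrE//.
  rewrite expr1n; apply: le_trans h; rewrite -/x.
  have -> : (x * (Num.sqrt r * (cq * al))) ^+ 2 =
     x ^+ 2 * (Num.sqrt r ^+ 2 * (cq * al) ^+ 2) by ring.
  rewrite sqr_sqrtr ?(ltW r0)//.
  by rewrite le_eqVlt; apply/orP; left; apply/eqP; ring.
Qed.

End Normalization.

(** * Second moments of the random sums *)

Lemma le_sum_term (R : realType) (I : finType) (F : I -> R) i :
  (forall i, 0 <= F i) -> F i <= \sum_i F i.
Proof. by move=> F0; rewrite (bigD1 i)//= lerDl sumr_ge0. Qed.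

Section RandomTerms.
Context {R : realType} (m p n l : nat).
Variables (X : 'I_n -> 'M[R]_(m, p)) (Rb : 'M[R]_m) (b0 : 'cV[R]_p).
Variable z : 'I_l -> 'cV[R]_p.
Local Notation A := {ffun 'I_m -> bool}.
Variable q : 'I_n -> A -> R.
Hypothesis q_ge0 : forall i a, 0 <= q i a.
Hypothesis q_sum : forall i, \sum_a q i a = 1.
Local Notation pi i j := (gee_pi (X i) b0 j 0).
Local Notation rho i j k := (gee_sd (X i) b0 j / gee_sd (X i) b0 k).
Local Notation score a i y := (gee_score (X i) Rb b0 (bits_col y) (z a)).
Local Notation res o i k := (bits_col (o i) k 0 - pi i k).
Hypothesis q_mean : forall i j, mexp q i (fun a => (a j)%:R - pi i j) = 0.
Hypothesis q_cov : forall a b,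
  \sum_i mexp q i (fun y => score a i y * score b i y) = (a == b)%:R.
Variables (C M tau : R).
Hypothesis C0 : 0 <= C.
Hypothesis M0 : 0 < M.
Hypothesis tau0 : 0 < tau.
Hypothesis rho_le : forall i j k, rho i j k <= C.
Hypothesis z_le : forall a, design_norm X (z a) <= C.
Hypothesis X_le : forall i j, \sum_c X i j c ^+ 2 <= M ^+ 2.
Hypothesis score_le : forall a i y, `|score a i y| <= tau.

(* A residual is at most 1 in absolute value. *)
Let pexp_sqr_res (x : 'I_n -> R) k :
  pexp q (fun o => (\sum_i x i * res o i k) ^+ 2) <= \sum_i x i ^+ 2.
Proof.
have h i : mexp q i (fun a => x i * (bits_col a k 0 - pi i k)) = 0.
  transitivity (x i * mexp q i (fun a => (a k)%:R - pi i k)); last by rewrite q_mean mulr0.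
  by rewrite /mexp mulr_sumr; apply: eq_bigr => a _; rewrite [bits_col _ _ _]mxE mulrCA.
rewrite (@pexp_sqr_sum _ _ _ q q_sum (fun i a => x i * (bits_col a k 0 - pi i k)) h).
apply: ler_sum => i _; apply: mexp_le => // a.
rewrite exprMn -[leRHS]mulr1 ler_wpM2l ?sqr_ge0// -real_normK ?num_real// exprn_ile1//.
have /andP[h0 h1] := gee_pi01 (X i) b0 k.
by rewrite mxE; case: (a k) => /=; rewrite ler_norml; lra.
Qed.

Let w a j k i := (X i *m z a) j 0 * rho i j k.

Let w_le a j k : \sum_i w a j k i ^+ 2 <= C ^+ 4.
Proof.
have -> : C ^+ 4 = (C * C) ^+ 2 by ring.
rewrite -ler_l2P ?mulr_ge0//.
apply: (@le_trans _ _ (C * l2 (fun i => (X i *m z a) j 0))).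
  rewrite -l2Z//; apply: le_l2 => i; rewrite /w mulrC normrM [leRHS]normrM.
  have rho0 : 0 <= rho i j k by rewrite divr_ge0// ltW//; exact: gee_sd_gt0.
  by rewrite ler_wpM2r// (ger0_norm rho0) (ger0_norm C0).
rewrite ler_wpM2l//; apply: le_trans (z_le a).
exact: (l2_slice (fun i j => (X i *m z a) j 0) j).
Qed.

Local Notation U a o := (\sum_i score a i (o i)).
Let G a b (o : {ffun 'I_n -> A}) := \sum_i score a i (o i) * score b i (o i) - (a == b)%:R.
Let R1 a j k (o : {ffun 'I_n -> A}) := \sum_i w a j k i * res o i k.
(* The noise with weights perturbed in the direction u is the pairing of u with
the vector V; bounding the norm of V controls all directions at once, which
matters because the estimation error is random. *)
Let V a j k j' c (o : {ffun 'I_n -> A}) := \sum_i (w a j k i * ((pi i j' - 1/2) * X i j' c)) * res o i k.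

Hypothesis q_score_mean : forall a i, mexp q i (fun y => score a i y) = 0.

Let U_var a : pexp q (fun o => (U a o) ^+ 2) <= 1.
Proof.
rewrite (@pexp_sqr_sum _ _ _ q q_sum (fun i y => score a i y) (q_score_mean a)).
have h : \sum_i mexp q i (fun y => score a i y * score a i y) = 1.
  by rewrite q_cov eqxx.
rewrite -h.
by apply: ler_sum => i _; apply: ler_mexp => // y; rewrite expr2.
Qed.

Let G_var a b : pexp q (fun o => (G a b o / tau) ^+ 2) <= 1.
Proof.
pose e i := mexp q i (fun y => score a i y * score b i y).
pose g i y := score a i y * score b i y - e i.
have g0 i : mexp q i (g i) = 0.
  transitivity (mexp q i (fun y => score a i y * score b i y) - \sum_y q i y * e i).
    by rewrite /mexp -sumrB; apply: eq_bigr => y _; rewrite mulrBr.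
  by rewrite -mulr_suml q_sum mul1r subrr.
have -> : (fun o : {ffun 'I_n -> A} => (G a b o / tau) ^+ 2) =
    (fun o => (tau^-1) ^+ 2 * (\sum_i g i (o i)) ^+ 2).
  apply/funext => o; rewrite /G -q_cov -/e -sumrB exprMn mulrC; congr (_ * _).
rewrite pexpZ (@pexp_sqr_sum _ _ _ q q_sum _ g0).
rewrite exprVn mulrC ler_pdivrMr ?exprn_gt0// mul1r.
have sab i : mexp q i (fun y => g i y ^+ 2) <=
    mexp q i (fun y => (score a i y * score b i y) ^+ 2).
  have -> : mexp q i (fun y => (score a i y * score b i y) ^+ 2) =
      mexp q i (fun y => g i y ^+ 2) + 2 * e i * mexp q i (g i) + \sum_y q i y * e i ^+ 2.
    rewrite /mexp mulr_sumr -!big_split/=; apply: eq_bigr => y _; rewrite /g; ring.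
  by rewrite g0 mulr0 addr0 lerDl -mulr_suml q_sum mul1r sqr_ge0.
apply: (@le_trans _ _ (\sum_i tau ^+ 2 * mexp q i (fun y => score a i y * score a i y))).
  apply: ler_sum => i _; apply: le_trans (sab i) _.
  rewrite /mexp mulr_sumr; apply: ler_sum => y _; rewrite [leRHS]mulrCA ler_wpM2l//.
  rewrite exprMn mulrC -expr2 ler_wpM2r ?sqr_ge0//.
  by rewrite -real_normK ?num_real// ler_pXn2r ?nnegrE// ltW.
by rewrite -mulr_sumr q_cov eqxx mulr1.
Qed.

Let R1_var a j k : pexp q (fun o => R1 a j k o ^+ 2) <= C ^+ 4.
Proof. exact: le_trans (pexp_sqr_res _ k) (w_le a j k). Qed.

Let V_var a j k j' : pexp q (fun o => \sum_c (V a j k j' c o / M) ^+ 2) <= C ^+ 4.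
Proof.
rewrite pexp_sum.
apply: (@le_trans _ _ (\sum_c \sum_i (M^-1 * (w a j k i * ((pi i j' - 1/2) * X i j' c))) ^+ 2)).
  apply: ler_sum => c _; apply: le_trans (pexp_sqr_res _ k).
  apply: ler_pexp => // o; rewrite le_eqVlt; apply/orP; left; apply/eqP; congr (_ ^+ 2).
  by rewrite mulrC /V mulr_sumr; apply: eq_bigr => i _; rewrite !mulrA.
apply: le_trans (w_le a j k); rewrite exchange_big/=; apply: ler_sum => i _.
apply: (@le_trans _ _ (\sum_c w a j k i ^+ 2 * M^-1 ^+ 2 * X i j' c ^+ 2)).
  apply: ler_sum => c _; rewrite [leLHS]exprMn [X in _ * X <= _]exprMn mulrCA -mulrA.
  rewrite ler_wpM2l ?sqr_ge0// ler_wpM2l ?sqr_ge0// exprMn -[leRHS]mul1r.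
  rewrite ler_wpM2r ?sqr_ge0// -real_normK ?num_real// exprn_ile1//.
  by have /andP[h0 h1] := gee_pi01 (X i) b0 j'; rewrite ler_norml; lra.
rewrite -mulr_sumr -mulrA -[leRHS]mulr1 ler_wpM2l ?sqr_ge0//.
by rewrite exprVn mulrC ler_pdivrMr ?exprn_gt0// mul1r.
Qed.

Let Z (o : {ffun 'I_n -> A}) := \sum_a U a o ^+ 2 + \sum_a \sum_b (G a b o / tau) ^+ 2 +
  \sum_a \sum_j \sum_k (R1 a j k o ^+ 2 + \sum_j' \sum_c (V a j k j' c o / M) ^+ 2).

Let sqr_term (I : finType) (F : I -> R) i B : 0 <= B ->
  \sum_i F i ^+ 2 <= B ^+ 2 -> `|F i| <= B.
Proof.
move=> B0 h; rewrite -(@ler_pXn2r _ 2)// ?nnegrE// real_normK ?num_real//.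
by apply: le_trans h; apply: (le_sum_term (F := fun i => F i ^+ 2)) => k; exact: sqr_ge0.
Qed.

(** The sum of the squares of all the random quantities, each in its own unit, is
a single variable whose mean is bounded uniformly in the sample: one
application of Markov's inequality then controls all of them. *)
Lemma random_terms : exists Zf : {ffun 'I_n -> A} -> R,
  [/\ forall o, 0 <= Zf o,
      pexp q Zf <= l%:R + l%:R ^+ 2 + l%:R * m%:R ^+ 2 * (C ^+ 4 + m%:R * C ^+ 4) &
      forall o B, 0 <= B -> Zf o <= B ^+ 2 ->
      [/\ forall a, `|U a o| <= B,
          forall a b, `|\sum_i score a i (o i) * score b i (o i) - (a == b)%:R| <= tau * B,
          forall a j k, `|\sum_i (X i *m z a) j 0 * rho i j k * res o i k| <= B &
          forall a j k j' u, `|\sum_i (X i *m z a) j 0 * rho i j k *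
             ((pi i j' - 1/2) * (X i *m u) j' 0) * res o i k| <= M * B * vnorm u]].
Proof.
have t1 o : 0 <= \sum_a U a o ^+ 2 by exact: sum_sqr_ge0.
have t2 o : 0 <= \sum_a \sum_b (G a b o / tau) ^+ 2.
  by apply: sumr_ge0 => a _; exact: sum_sqr_ge0.
have t3 o a j k : 0 <= R1 a j k o ^+ 2 + \sum_j' \sum_c (V a j k j' c o / M) ^+ 2.
  by apply: addr_ge0; rewrite ?sqr_ge0//; apply: sumr_ge0 => j' _; exact: sum_sqr_ge0.
have t4 o : 0 <= \sum_a \sum_j \sum_k
    (R1 a j k o ^+ 2 + \sum_j' \sum_c (V a j k j' c o / M) ^+ 2).
  by apply: sumr_ge0 => a _; apply: sumr_ge0 => j _; apply: sumr_ge0 => k _.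
exists Z; split.
- by move=> o; rewrite /Z !addr_ge0.
- rewrite /Z !pexpD; apply: lerD; first apply: lerD.
  + rewrite pexp_sum; apply: (@le_trans _ _ (\sum_(a < l) 1)); first exact: ler_sum.
    by rewrite sumr_const card_ord.
  + rewrite pexp_sum; apply: (@le_trans _ _ (\sum_(a < l) \sum_(b < l) 1)).
      by apply: ler_sum => a _; rewrite pexp_sum; exact: ler_sum.
    by rewrite sum2_const mulr1.
  + rewrite pexp_sum; apply: (@le_trans _ _ (\sum_(a < l)
       m%:R ^+ 2 * (C ^+ 4 + m%:R * C ^+ 4))); last first.
      by rewrite sumr_const card_ord -[leLHS]mulr_natl mulrA.
    apply: ler_sum => a _; rewrite pexp_sum -sum2_const; apply: ler_sum => j _.
    rewrite pexp_sum; apply: ler_sum => k _; rewrite pexpD; apply: lerD => //.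
    rewrite pexp_sum; apply: (@le_trans _ _ (\sum_(j' < m) C ^+ 4)); first exact: ler_sum.
    by rewrite sumr_const card_ord -[leLHS]mulr_natl.
- move=> o B B0 ZB.
  have z1 : \sum_a U a o ^+ 2 <= B ^+ 2.
    by apply: le_trans ZB; rewrite /Z -addrA lerDl addr_ge0.
  have z2 : \sum_a \sum_b (G a b o / tau) ^+ 2 <= B ^+ 2.
    by apply: le_trans ZB; rewrite /Z addrAC lerDr addr_ge0.
  have z3 a j k : R1 a j k o ^+ 2 + \sum_j' \sum_c (V a j k j' c o / M) ^+ 2 <= B ^+ 2.
    apply: le_trans ZB; rewrite /Z.
    apply: (@le_trans _ _ (\sum_a \sum_j \sum_k
      (R1 a j k o ^+ 2 + \sum_j' \sum_c (V a j k j' c o / M) ^+ 2))); last first.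
      by rewrite lerDr addr_ge0.
    apply: le_trans (le_sum_term a _); last first.
      by move=> a'; apply: sumr_ge0 => ? _; apply: sumr_ge0 => ? _.
    apply: le_trans (le_sum_term j _); last first.
      by move=> j'; apply: sumr_ge0 => ? _.
    exact: (le_sum_term (F := fun k => R1 a j k o ^+ 2 + \sum_j' \sum_c (V a j k j' c o / M) ^+ 2)).
  split.
  + by move=> a; apply: (sqr_term (F := fun a => U a o)).
  + move=> a b; have h : `|G a b o / tau| <= B.
      apply: (sqr_term (F := fun b => G a b o / tau)) => //; apply: le_trans z2.
      apply: (le_sum_term (F := fun a => \sum_b (G a b o / tau) ^+ 2)) => a'.
      exact: sum_sqr_ge0.
    by move: h; rewrite normrM normfV (gtr0_norm tau0) ler_pdivrMr// mulrC.
  + move=> a j k; rewrite -(@ler_pXn2r _ 2)// ?nnegrE// real_normK ?num_real//.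
    apply: le_trans (z3 a j k); rewrite lerDl.
    by apply: sumr_ge0 => j' _; exact: sum_sqr_ge0.
  + move=> a j k j' u.
    have -> : \sum_i (X i *m z a) j 0 * rho i j k *
         ((pi i j' - 1/2) * (X i *m u) j' 0) * res o i k =
        M * \sum_c V a j k j' c o / M * u c 0.
      rewrite mulr_sumr.
      transitivity (\sum_c \sum_i
          (w a j k i * ((pi i j' - 1/2) * X i j' c)) * res o i k * u c 0); last first.
        apply: eq_bigr => c _; rewrite -mulr_suml -/(V a j k j' c o).
        by field; rewrite gt_eqF.
      rewrite exchange_big/=; apply: eq_bigr => i _.
      rewrite -/(w a j k i) [(X i *m u) j' 0]mxE !mulr_sumr mulr_suml; apply: eq_bigr => c _.
      by ring.
    rewrite normrM (gtr0_norm M0) -mulrA ler_wpM2l ?(ltW M0)//.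
    apply: le_trans (l2_cauchy_schwarz _ _) _; rewrite ler_wpM2r ?l2_ge0//.
    rewrite ler_l2P//; apply: le_trans (z3 a j k); rewrite -[leLHS]add0r.
    apply: lerD; first exact: sqr_ge0.
    apply: (le_sum_term (F := fun j' => \sum_c (V a j k j' c o / M) ^+ 2)) => j''.
    exact: sum_sqr_ge0.
Qed.

End RandomTerms.

(** * The comparison at a fixed sample size *)

Section FixedSample.
Context {R : realType} (m l : nat).
Local Notation A := {ffun 'I_m -> bool}.

Lemma design_norm_sqr p n (X : 'I_n -> 'M[R]_(m, p)) v : (0 < n)%N ->
  design_norm X v ^+ 2 =
  n%:R * vdot v ((n%:R^-1 *: \sum_i (X i)^T *m X i) *m v).
Proof.
move=> n0; have nR : (n%:R : R) != 0 by rewrite pnatr_eq0 -lt0n.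
rewrite -scalemxAl vdotZr mulrA mulfV// mul1r l2_sqr mulmx_suml vdot_sumr.
rewrite -(pair_bigA_idem _ (fun i j => (X i *m v) j 0 ^+ 2))/= ?addr0//.
by apply: eq_bigr => i _; rewrite -mulmxA -vdot_mull vdotE.
Qed.

Lemma gram_tr p n (X : 'I_n -> 'M[R]_(m, p)) (c : R) :
  (c *: \sum_i (X i)^T *m X i)^T = c *: \sum_i (X i)^T *m X i.
Proof.
rewrite linearZ/= (raddf_sum (@trmx R p p)); congr (_ *: _).
by apply: eq_bigr => i _; rewrite /= trmx_mul trmxK.
Qed.

Lemma score_norm_le p (X : 'M[R]_(m, p)) (Rb : 'M[R]_m) (b0 z : 'cV[R]_p) (a : A)
  (C x : R) : 0 <= C -> 0 <= x ->
  (forall j, `|(X *m z) j 0| <= x) ->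
  (forall j k, gee_sd X b0 j / gee_sd X b0 k <= C) ->
  (forall j k, `|invmx Rb j k| <= C) ->
  `|gee_score X Rb b0 (bits_col a) z| <= m%:R ^+ 2 * (x * (C * C)).
Proof.
move=> C0 x0 Xz rho_le Qb_le; rewrite -sum2_const.
apply: le_trans (ler_norm_sum _ _ _) _; apply: ler_sum => j _.
apply: le_trans (ler_norm_sum _ _ _) _; apply: ler_sum => k _.
rewrite normrM; apply: ler_pM => //; rewrite normrM -[leRHS]mulr1.
apply: ler_pM => //.
  rewrite normrM; apply: ler_pM => //.
  by rewrite ger0_norm ?rho_le// divr_ge0// ltW//; exact: gee_sd_gt0.
have /andP[h0 h1] := gee_pi01 X b0 k.
by rewrite [bits_col a k 0]mxE; case: (a k) => /=; rewrite ler_norml; lra.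
Qed.

Lemma mexp_score0 p (X : 'M[R]_(m, p)) (Rb : 'M[R]_m) (b0 z : 'cV[R]_p)
  (I : finType) (q : I -> A -> R) i :
  (forall j, mexp q i (fun a => (a j)%:R - gee_pi X b0 j 0) = 0) ->
  mexp q i (fun a => gee_score X Rb b0 (bits_col a) z) = 0.
Proof.
move=> q_mean; rewrite /mexp /gee_score.
under eq_bigr do rewrite mulr_sumr.
rewrite exchange_big big1// => j _.
under eq_bigr do rewrite mulr_sumr.
rewrite exchange_big big1// => k _.
transitivity ((X *m z) j 0 * (gee_sd X b0 j / gee_sd X b0 k * invmx Rb j k) *
  mexp q i (fun a => (a k)%:R - gee_pi X b0 k 0)); last by rewrite q_mean mulr0.
rewrite /mexp mulr_sumr; apply: eq_bigr => a _; rewrite [bits_col a k 0]mxE; ring.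
Qed.

(** The constants are parameters so that the estimates below are uniform over
all samples satisfying the same bounds. *)
Record regular_sample (CX b1 b2 b3 b4 c1 c2 r : R) p n
    (X : 'I_n -> 'M[R]_(m, p)) (Rb R0 : 'M[R]_m) (b0 : 'cV[R]_p)
    (L : 'M[R]_(l, p)) (q : 'I_n -> A -> R) : Prop := RegularSample {
  rs_n : (0 < n)%N;
  rs_p : (0 < p)%N;
  rs_X : forall i j, frobenius (row j (X i)) <= CX * Num.sqrt p%:R;
  rs_pi : forall i j, b1 <= gee_pi (X i) b0 j 0 <= b2;
  rs_design_min : b3 <= lambda_min (n%:R^-1 *: \sum_i (X i)^T *m X i);
  rs_design_max : lambda_max (n%:R^-1 *: \sum_i (X i)^T *m X i) <= b4;
  rs_R0_sym : R0^T = R0;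
  rs_R0 : r <= lambda_min R0;
  rs_Rb_sym : Rb^T = Rb;
  rs_Rb_min : c1 <= lambda_min Rb;
  rs_Rb_max : lambda_max Rb <= c2;
  rs_L : L *m L^T = 1%:M;
  rs_H0 : L *m b0 = 0;
  rs_q_ge0 : forall i a, 0 <= q i a;
  rs_q_sum : forall i, \sum_a q i a = 1;
  rs_q_mean : forall i j, mexp q i (fun a => (a j)%:R - gee_pi (X i) b0 j 0) = 0;
  rs_q_cov : forall i j k,
    mexp q i (fun a => ((a j)%:R - gee_pi (X i) b0 j 0) *
                       ((a k)%:R - gee_pi (X i) b0 k 0)) =
    gee_sd (X i) b0 j * gee_sd (X i) b0 k * R0 j k }.

Lemma gee_sd_low p (X : 'M[R]_(m, p)) (b0 : 'cV[R]_p) (b1 b2 : R) j :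
  0 < b1 -> b2 < 1 -> b1 <= gee_pi X b0 j 0 <= b2 ->
  Num.sqrt (b1 * (1 - b2)) <= gee_sd X b0 j.
Proof.
move=> h1 h2 /andP[h3 h4]; rewrite gee_sdE ler_sqrt.
  by apply: ler_pM; lra.
by apply: mulr_ge0; lra.
Qed.

Lemma sqrt_rate_le (a P S : R) (i : nat) : 0 <= a -> 1 <= P -> 0 < S -> (i <= 3)%N ->
  a * (P ^+ i / S) <= a * (P ^+ 3 / S).
Proof.
move=> a0 P1 S0 i3; rewrite ler_wpM2l// ler_pM2r ?invr_gt0//.
exact: ler_weXn2l.
Qed.

Lemma sum7_terms (x1 x2 x3 x4 x5 x6 x7 : R) :
  0 <= x1 -> 0 <= x2 -> 0 <= x3 -> 0 <= x4 -> 0 <= x5 -> 0 <= x6 -> 0 <= x7 ->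
  let t := x1 + x2 + x3 + x4 + x5 + x6 + x7 in
  [/\ x1 <= t, x2 <= t & x3 <= t] /\ [/\ x4 <= t, x5 <= t, x6 <= t & x7 <= t].
Proof. by move=> h1 h2 h3 h4 h5 h6 h7; split; split; lra. Qed.

(** What one sample provides to the limit theorem. The function Zf of the
outcome dominates the random sums; B bounds its square root and K is the
constant in the rates of both estimators. *)
Record wald_expansion (KZ Kt : R) (Kw : R -> R -> R) p n
    (X : 'I_n -> 'M[R]_(m, p)) (Rb : 'M[R]_m) (b0 : 'cV[R]_p) (L : 'M[R]_(l, p))
    (q : 'I_n -> A -> R) (z : 'I_l -> 'cV[R]_p) (Zf : {ffun 'I_n -> A} -> R)
    : Prop := WaldExpansion {
  we_cov : forall a b,
    \sum_i mexp q i (fun y => gee_score (X i) Rb b0 (bits_col y) (z a)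
        * gee_score (X i) Rb b0 (bits_col y) (z b)) = (a == b)%:R;
  we_small : forall a i y, `|gee_score (X i) Rb b0 (bits_col y) (z a)|
        <= Kt * (Num.sqrt p%:R / Num.sqrt n%:R);
  we_ge0 : forall o, 0 <= Zf o;
  we_mean : pexp q Zf <= KZ;
  we_close : forall (B K : R) o (Rh : 'M[R]_m) (delta : 'cV[R]_p),
      1 <= B -> 0 < K ->
      Zf o <= B ^+ 2 ->
      vnorm delta <= K * (Num.sqrt p%:R / Num.sqrt n%:R) ->
      frobenius (invmx Rh - invmx Rb) <= K * (Num.sqrt p%:R / Num.sqrt n%:R) ->
      gee_S X (fun i => bits_col (o i)) Rh (b0 + delta) = 0 ->
      Kw B K * (Num.sqrt p%:R ^+ 3 / Num.sqrt n%:R) <= 1 ->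
      `|gee_wald X (fun i => bits_col (o i)) Rh L (b0 + delta) -
        \sum_a (\sum_i gee_score (X i) Rb b0 (bits_col (o i)) (z a)) ^+ 2|
      <= Kw B K * (Num.sqrt p%:R ^+ 3 / Num.sqrt n%:R) }.

(** Every small quantity of [gee_wald_close] is a constant times P^i / S with
i <= 3, where P^2 = p and S^2 = n. The cube is reached by the product of the
largest change of a linear predictor, of order P^2 / S, with the design norm of
the estimation error, of order P: this is where p^3 / n -> 0 is used. *)
Lemma gee_wald_approx (CX b1 b2 b3 b4 c1 c2 r : R) :
  [/\ 0 < b1, b2 < 1 & 0 < b3] -> [/\ 0 < c1, 0 < c2 & 0 < r] ->
  exists (KZ Kt : R) (Kw : R -> R -> R), (forall B K, 1 <= B -> 0 < K -> 0 < Kw B K) /\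
  forall p n (X : 'I_n -> 'M[R]_(m, p)) (Rb R0 : 'M[R]_m) (b0 : 'cV[R]_p)
    (L : 'M[R]_(l, p)) (q : 'I_n -> A -> R),
  regular_sample CX b1 b2 b3 b4 c1 c2 r X Rb R0 b0 L q ->
  exists (z : 'I_l -> 'cV[R]_p) (Zf : {ffun 'I_n -> A} -> R),
    wald_expansion KZ Kt Kw X Rb b0 L q z Zf.
Proof.
move=> [b1p b2p b3p] [c1p c2p rp].
pose al := Num.sqrt (b1 * (1 - b2)).
have al0 : 0 < al by rewrite sqrtr_gt0 mulr_gt0// subr_gt0.
pose cq := c2^-1; have cq0 : 0 < cq by rewrite invr_gt0.
pose Cz := (Num.sqrt r * (cq * al))^-1.
have Cz0 : 0 < Cz by rewrite invr_gt0 !mulr_gt0// sqrtr_gt0.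
pose C := 1 + c1^-1 + al^-1 + Cz.
have [c1V alV] : 0 < c1^-1 /\ 0 < al^-1 by rewrite !invr_gt0.
have [C1 [Cc1 [Cal CCz]]] : 1 <= C /\ c1^-1 <= C /\ al^-1 <= C /\ Cz <= C.
  by rewrite /C; move: c1V alV Cz0; move: (c1^-1) (al^-1) (Cz) => ? ? ?; lra.
have C0 : 0 <= C by apply: le_trans C1.
pose CX' := Num.max 1 CX.
have [CX1 CXle] : 1 <= CX' /\ CX <= CX' by rewrite /CX' !le_max !lexx orbT.
have CX0 : 0 <= CX' by apply: le_trans CX1.
pose c := cq * al ^+ 2; have c0 : 0 < c by rewrite mulr_gt0// exprn_gt0.
pose D := Num.sqrt b4; have D0 : 0 <= D by exact: sqrtr_ge0.
pose Kt := m%:R ^+ 2 * (CX' * (C / Num.sqrt b3) * (C * C)) + 1.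
have b3s : 0 < Num.sqrt b3 by rewrite sqrtr_gt0.
have Kt0 : 0 < Kt.
  by apply: ltr_wpDl => //; rewrite !mulr_ge0 ?exprn_ge0 ?invr_ge0// ltW.
pose KZ := l%:R + l%:R ^+ 2 + l%:R * m%:R ^+ 2 * (C ^+ 4 + m%:R * C ^+ 4).
have [Kf KfP] := @gee_wald_close R m l C c C1 c0.
(* one summand for each smallness condition of gee_wald_close *)
pose Ke B K : R := CX' * K + CX' * K ^+ 2 * D + K + K ^+ 2 * D + K * B + CX' * B * K + Kt * B.
exists KZ, Kt, (fun B K => Kf B * Ke B K); split.
  move=> B K B1 K0; have [Kf0 _] := KfP B B1; apply: mulr_gt0 => //.
  have B0 : 0 <= B by apply: le_trans B1.
  rewrite /Ke; apply: ltr_wpDr; first by rewrite mulr_ge0// ltW.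
  apply: ltr_wpDr; first by rewrite !mulr_ge0// ltW.
  apply: ltr_wpDr; first by rewrite !mulr_ge0// ltW.
  apply: ltr_wpDr; first by apply: mulr_ge0 => //; exact: sqr_ge0.
  apply: ltr_wpDl => //; apply: addr_ge0; first by apply: mulr_ge0 => //; exact: ltW.
  by apply: mulr_ge0 => //; apply: mulr_ge0 => //; exact: sqr_ge0.
move=> p n X Rb R0 b0 L q rs.
have [n0 p0] := (rs_n rs, rs_p rs).
pose P : R := Num.sqrt p%:R; pose S : R := Num.sqrt n%:R.
have P1 : 1 <= P by rewrite -sqrtr1 ler_sqrt// ler1n.
have P0 : 0 < P by apply: lt_le_trans P1.
have S0 : 0 < S by rewrite sqrtr_gt0 ltr0n.
have S2 : S ^+ 2 = n%:R by rewrite sqr_sqrtr.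
have RbL v := lambda_min_le v (rs_Rb_sym rs) (rs_Rb_min rs).
have RbU v := lambda_max_ge v (rs_Rb_sym rs) (rs_Rb_max rs).
have R0L v := lambda_min_le v (rs_R0_sym rs) (rs_R0 rs).
have [Qb_sym Qb_low Qb_le'] := posdef_inverse c1p c2p (rs_Rb_sym rs) RbL RbU.
have Qb_le j k : `|invmx Rb j k| <= C := le_trans (Qb_le' j k) Cc1.
have sd_low i j : al <= gee_sd (X i) b0 j := gee_sd_low b1p b2p (rs_pi rs i j).
have rho_le i j k : gee_sd (X i) b0 j / gee_sd (X i) b0 k <= C.
  apply: le_trans Cal; rewrite -[leRHS]mul1r; apply: ler_pM.
  - exact/ltW/gee_sd_gt0.
  - by rewrite invr_ge0; exact/ltW/gee_sd_gt0.
  - by apply: le_trans (gee_sd_le _ _ _) _; rewrite ler_pdivrMr// mul1r ler1n.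
  - by rewrite lef_pV2 ?posrE ?gee_sd_gt0.
have design_low v : b3 * n%:R * vdot v v <= design_norm X v ^+ 2.
  rewrite design_norm_sqr// mulrAC mulrC ler_wpM2l//.
  exact: lambda_min_le (gram_tr _ _) (rs_design_min rs).
have design_up v : design_norm X v <= D * S * vnorm v.
  rewrite -(@ler_pXn2r _ 2)// ?nnegrE ?mulr_ge0 ?l2_ge0 ?(ltW S0)//.
  have -> : (D * S * vnorm v) ^+ 2 = S ^+ 2 * (D ^+ 2 * vnorm v ^+ 2) by ring.
  rewrite design_norm_sqr// S2 vnorm_sqr ler_wpM2l//.
  apply: le_trans (lambda_max_ge _ (gram_tr _ _) (rs_design_max rs)) _.
  rewrite ler_wpM2r ?vdot_ge0//.
  have [b40|b40] := leP 0 b4; first by rewrite sqr_sqrtr.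
  by apply: le_trans (sqr_ge0 _); exact: ltW.
have inj v : design_norm X v = 0 -> v = 0.
  move=> dv; apply/eqP; rewrite -vdot_eq0 eq_le vdot_ge0 andbT.
  by have := design_low v; rewrite dv expr0n/= pmulr_rle0// mulr_gt0// ltr0n.
have H_low := @gee_H_low R m p n X Rb b0 al cq al0 cq0 sd_low Qb_low.
have [T [z [Tu zE zcov zle']]] := gee_normalizer al0 cq0 rp sd_low Qb_sym Qb_low
  R0L (rs_q_cov rs) inj (rs_L rs).
have zle a : design_norm X (z a) <= C := le_trans (zle' a) CCz.
have Xrow i j : vnorm (row j (X i))^T <= CX' * P.
  apply: le_trans (_ : CX * P <= _); last by rewrite ler_wpM2r// ltW.
  apply: le_trans (rs_X rs i j); rewrite /vnorm /l2 /frobenius big_ord1.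
  by under eq_bigr do rewrite mxE.
have Xv i j v : `|(X i *m v) j 0| <= CX' * P * vnorm v.
  rewrite mulmx_entry; apply: le_trans (vdot_norm_le _ _) _.
  by rewrite ler_wpM2r ?vnorm_ge0.
have z_norm a : vnorm (z a) <= C / Num.sqrt b3 / S.
  rewrite ler_pdivlMr// ler_pdivlMr// -(@ler_pXn2r _ 2)// ?nnegrE ?mulr_ge0 ?vnorm_ge0 ?(ltW S0) ?(ltW b3s)//.
  apply: (@le_trans _ _ (design_norm X (z a) ^+ 2)); last first.
    by rewrite ler_pXn2r ?nnegrE ?l2_ge0.
  apply: le_trans (design_low (z a)).
  have -> : (vnorm (z a) * S * Num.sqrt b3) ^+ 2 =
      Num.sqrt b3 ^+ 2 * S ^+ 2 * vnorm (z a) ^+ 2 by ring.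
  by rewrite S2 vnorm_sqr sqr_sqrtr// ltW.
have score_le a i y : `|gee_score (X i) Rb b0 (bits_col y) (z a)| <= Kt * (P / S).
  apply: le_trans (@score_norm_le _ _ _ _ _ _ C (CX' * P * (C / Num.sqrt b3 / S)) C0 _ _ (rho_le i) Qb_le) _.
  - by rewrite !mulr_ge0 ?invr_ge0// ltW.
  - move=> j; apply: le_trans (Xv i j (z a)) _; rewrite ler_wpM2l//.
    by rewrite mulr_ge0// ltW.
  - apply: (@le_trans _ _ (m%:R ^+ 2 * (CX' * (C / Num.sqrt b3) * (C * C)) * (P / S))).
      by rewrite le_eqVlt; apply/orP; left; apply/eqP; ring.
    by apply: ler_wpM2r; [exact/ltW/divr_gt0|rewrite /Kt lerDl].
have X_le i j : \sum_c X i j c ^+ 2 <= (CX' * P) ^+ 2.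
  rewrite -ler_l2P ?mulr_ge0 ?(ltW P0)//; apply: le_trans (Xrow i j).
  by rewrite le_eqVlt; apply/orP; left; apply/eqP; congr Num.sqrt; apply: eq_bigr => c' _; rewrite !mxE.
have CXP : 0 < CX' * P by rewrite mulr_gt0//; apply: lt_le_trans CX1.
have tau0 : 0 < Kt * (P / S) by rewrite !mulr_gt0 ?invr_gt0.
have sm a i : mexp q i (fun y => gee_score (X i) Rb b0 (bits_col y) (z a)) = 0.
  by apply: mexp_score0 => j; exact: (rs_q_mean rs i j).
have [Zf [Zf0 ZfE ZfP]] := random_terms (rs_q_ge0 rs) (rs_q_sum rs) (rs_q_mean rs)
  zcov C0 CXP tau0 rho_le zle X_le score_le sm.
exists z, Zf; apply: WaldExpansion => //.
rewrite -/P -/S.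
move=> B K o Rh delta B1 K0 ZB dl dQ S_root small.
have B0 : 0 <= B by apply: le_trans B1.
have [U_le lln r1 r2] := ZfP o B B0 ZB.
have [_ KP] := KfP B B1.
set s := P ^+ 3 / S.
have s0 : 0 <= s by rewrite divr_ge0 ?exprn_ge0// ltW.
have PS i a : (i <= 3)%N -> 0 <= a -> a * (P ^+ i / S) <= a * s.
  by move=> i3 a0; exact: sqrt_rate_le.
rewrite -mulrA; rewrite -mulrA in small.
have K0' := ltW K0.
have [k1 [k2 [k3 [k4 k5]]]] : 0 <= CX' * K /\ 0 <= CX' * K ^+ 2 * D /\
    0 <= K ^+ 2 * D /\ 0 <= K * B /\ 0 <= CX' * B * K.
  by split; [|split; [|split; [|split]]]; repeat (apply: mulr_ge0 => //); exact: sqr_ge0.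
have k6 : 0 <= Kt * B by apply: mulr_ge0 => //; exact: ltW.
have KeE x : x <= Ke B K -> x * s <= Ke B K * s by move=> xK; exact: ler_wpM2r.
have [[t1 t2 t3] [t4 t5 t6 t7]] := sum7_terms k1 k2 K0' k3 k4 k5 k6.
rewrite -/(Ke B K) in t1 t2 t3 t4 t5 t6 t7.
have [e1 [e2 [e3 [e4 [e5 [e6 e7]]]]]] : CX' * K * s <= Ke B K * s /\
    CX' * K ^+ 2 * D * s <= Ke B K * s /\ K * s <= Ke B K * s /\
    K ^+ 2 * D * s <= Ke B K * s /\ K * B * s <= Ke B K * s /\
    CX' * B * K * s <= Ke B K * s /\ Kt * B * s <= Ke B K * s.
  by split; [|split; [|split; [|split; [|split; [|split]]]]]; apply: KeE.
have dn : design_norm X delta <= D * K * P.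
  apply: le_trans (design_up _) _.
  apply: (@le_trans _ _ (D * S * (K * (P / S)))).
    by rewrite ler_wpM2l// mulr_ge0// ltW.
  by rewrite le_eqVlt; apply/orP; left; apply/eqP; field; rewrite gt_eqF.
have dn0 : 0 <= design_norm X delta by exact: l2_ge0.
have PS0 : 0 <= P / S by rewrite divr_ge0 ?ltW.
pose Dm := CX' * K * (P ^+ 2 / S).
have Dm0 : 0 <= Dm by rewrite mulr_ge0// divr_ge0 ?exprn_ge0// ltW.
have dq j k : `|invmx Rh j k - invmx Rb j k| <= K * (P / S).
  apply: le_trans dQ; have := frobenius_entry (invmx Rh - invmx Rb) j k.
  by rewrite [X in `|X|]mxE [X in `|_ + X|]mxE.
apply: (KP p n X _ Rh Rb b0 delta L T z (Ke B K * s) Dm) => //.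
- split=> //.
  + by apply: mulr_ge0 => //; exact: le_trans t1.
  + by apply: le_trans e1; exact: PS.
  + apply: (@le_trans _ _ (Dm * (D * K * P))); first exact: ler_wpM2l.
    apply: le_trans e2; rewrite le_eqVlt; apply/orP; left; apply/eqP; rewrite /Dm /s; ring.
- move=> i j; apply: le_trans (Xv i j delta) _.
  apply: (@le_trans _ _ (CX' * P * (K * (P / S)))); first by rewrite ler_wpM2l// ltW.
  by rewrite le_eqVlt; apply/orP; left; apply/eqP; rewrite /Dm; ring.
- move=> j k; split.
    by apply: le_trans (dq j k) _; apply: le_trans e3; exact: (PS 1%N).
  apply: (@le_trans _ _ (K * (P / S) * (D * K * P))); first exact: ler_pM.
  apply: le_trans e4; apply: (@le_trans _ _ (K ^+ 2 * D * (P ^+ 2 / S))); last exact: PS.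
  by rewrite le_eqVlt; apply/orP; left; apply/eqP; ring.
- split=> // i j; rewrite [bits_col _ _ _]mxE.
  by case: (o i j); [right|left].
- split=> //; exact: (rs_H0 rs).
- move=> a b; apply: le_trans (lln a b) _; apply: le_trans e7.
  rewrite mulrAC; exact: (PS 1%N).
- move=> a j k; split.
  + rewrite normrM; apply: (@le_trans _ _ (K * (P / S) * B)); first by apply: ler_pM.
    apply: le_trans e5; rewrite mulrAC; exact: (PS 1%N).
  + apply: le_trans (r2 a j k j delta) _.
    apply: (@le_trans _ _ (CX' * P * B * (K * (P / S)))).
      by rewrite ler_wpM2l// mulr_ge0// ltW.
    apply: le_trans e6; apply: (@le_trans _ _ (CX' * B * K * (P ^+ 2 / S))); last exact: PS.
    by rewrite le_eqVlt; apply/orP; left; apply/eqP; ring.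
  + apply: le_trans (r2 a j k k delta) _.
    apply: (@le_trans _ _ (CX' * P * B * (K * (P / S)))).
      by rewrite ler_wpM2l// mulr_ge0// ltW.
    apply: le_trans e6; apply: (@le_trans _ _ (CX' * B * K * (P ^+ 2 / S))); last exact: PS.
    by rewrite le_eqVlt; apply/orP; left; apply/eqP; ring.
Qed.

End FixedSample.

(** * Perturbation of a sequence in distribution *)

Section Slutsky.
Context {R : realType} (d : nat -> measure_display).
Context (T : forall n, measurableType (d n)) (P : forall n, probability (T n) R).

Lemma prob_le_add n (S S' N : set (T n)) (e : \bar R) :
  measurable S -> measurable S' -> measurable N -> S `<=` S' `|` N ->
  (P n N <= e -> P n S <= P n S' + e)%E.
Proof.
move=> mS mS' mN SN Ne; apply: (@le_trans _ _ (P n (S' `|` N))).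
  by apply: le_measure; rewrite ?inE//; exact: measurableU.
by apply: le_trans (measureU2 _ _ _) _ => //; exact: leeD2l.
Qed.

Lemma fine_leD (a b : \bar R) (e : R) : a \is a fin_num -> b \is a fin_num ->
  (a <= b + e%:E)%E -> fine a <= fine b + e.
Proof. by move=> /fineK <- /fineK <-; rewrite -EFinD lee_fin. Qed.

(** A perturbation that tends to 0 in probability does not change the limit
law; the limit is only assumed to be approached up to a shift of the argument,
which is what a smoothed test function provides. *)
Lemma slutsky_cdf (W V : forall n, T n -> R) (F : R -> \bar R) (x : R) :
  (forall n y, measurable [set w | W n w <= y]) ->
  (forall n y, measurable [set w | (V n w <= y)%R]) ->
  (forall y, (0 <= F y <= 1)%E) ->
  (forall eta e, 0 < eta -> 0 < e -> \forall n \near \oo,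
     exists N : set (T n), [/\ measurable N, (P n N <= e%:E)%E &
       forall w, ~ N w -> `|W n w - V n w| <= eta]) ->
  (forall y eta e, 0 < eta -> 0 < e -> \forall n \near \oo,
     (P n [set w | (V n w <= y)%R] <= F (y + eta)%R + e%:E)%E /\
     (F y <= P n [set w | (V n w <= y + eta)%R] + e%:E)%E) ->
  {for x, continuous F} ->
  P n [set w | (W n w <= x)%R] @[n --> \oo] --> F x.
Proof.
move=> mW mV F01 WV VF Fx.
have Ffin y : F y \is a fin_num.
  by have /andP[f0 f1] := F01 y; rewrite ge0_fin_numE// (le_lt_trans f1)// ltry.
have -> : (fun n => P n [set w | (W n w <= x)%R]) =
    (fun n => (fine (P n [set w | (W n w <= x)%R]))%:E).
  by apply/funext => n; rewrite fineK// fin_num_measure.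
rewrite -(fineK (Ffin x)); apply: cvg_EFin; first exact: nearW.
apply/cvgrPdist_le => e e0; have e4 : 0 < e / 4 by rewrite divr_gt0.
have Fc : fine (F t) @[t --> x] --> fine (F x).
  by apply: fine_cvg; rewrite fineK//; exact: Fx.
move/cvgrPdist_le : Fc => /(_ _ e4) [del /= del0 Hdel].
pose eta := del / 4; have eta0 : 0 < eta by rewrite divr_gt0.
have close t : `|x - t| < del -> `|fine (F x) - fine (F t)| <= e / 4.
  by move=> h; apply: Hdel.
near=> n.
have [N [mN Ne NW]] : exists N : set (T n), [/\ measurable N, (P n N <= (e/4)%:E)%E &
    forall w, ~ N w -> `|W n w - V n w| <= eta].
  by near: n; exact: WV.
have [h1 _] : (P n [set w | (V n w <= x + eta)%R] <= F (x + eta + eta)%R + (e/4)%:E)%E /\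
  (F (x + eta)%R <= P n [set w | (V n w <= x + eta + eta)%R] + (e/4)%:E)%E.
  by near: n; exact: VF.
have [_ h2] : (P n [set w | (V n w <= x - eta - eta)%R] <= F (x - eta - eta + eta)%R + (e/4)%:E)%E /\
  (F (x - eta - eta)%R <= P n [set w | (V n w <= x - eta - eta + eta)%R] + (e/4)%:E)%E.
  by near: n; exact: VF.
have h3 : (P n [set w | (W n w <= x)%R] <= P n [set w | (V n w <= x + eta)%R] + (e/4)%:E)%E.
  apply: (prob_le_add _ _ mN) => // w /= Wx.
  have [Nw|Nw] := pselect (N w); [by right|left => /=].
  by have := NW w Nw; rewrite ler_norml => /andP[? ?]; lra.
have h4 : (P n [set w | (V n w <= x - eta - eta + eta)%R] <= P n [set w | (W n w <= x)%R] + (e/4)%:E)%E.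
  apply: (prob_le_add _ _ mN) => // w /= Vx.
  have [Nw|Nw] := pselect (N w); [by right|left => /=].
  by have := NW w Nw; rewrite ler_norml => /andP[? ?]; lra.
have pfin S : measurable S -> P n S \is a fin_num.
  by move=> mS; rewrite fin_num_measure.
have c1 : `|fine (F x) - fine (F (x + eta + eta)%R)| <= e / 4.
  by apply: close; rewrite ltr_norml /eta; lra.
have c2 : `|fine (F x) - fine (F (x - eta - eta)%R)| <= e / 4.
  by apply: close; rewrite ltr_norml /eta; lra.
have g1 := fine_leD (pfin _ (mV n _)) (Ffin _) h1.
have g2 := fine_leD (Ffin _) (pfin _ (mV n _)) h2.
have g3 := fine_leD (pfin _ (mW n _)) (pfin _ (mV n _)) h3.
have g4 := fine_leD (pfin _ (mV n _)) (pfin _ (mW n _)) h4.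
clear - c1 c2 g1 g2 g3 g4.
move: c1 c2 g1 g2 g3 g4; rewrite !ler_norml.
move: (fine (P n [set w | (W n w <= x)%R])) (fine (P n [set w | (V n w <= x + eta)%R])).
move: (fine (P n [set w | (V n w <= x - eta - eta + eta)%R])).
move: (fine (F x)) (fine (F _)) (fine (F _)) => f f1 f2 v1 u v2.
by move=> /andP[? ?] /andP[? ?] ? ? ? ?; apply/andP; split; lra.
Unshelve. all: by end_near. Qed.

End Slutsky.

(** * Rates and the law of one sample *)

Lemma sqrt_rateE (R : realType) (p n : nat) :
  Num.sqrt p%:R ^+ 3 / Num.sqrt n%:R = Num.sqrt (n%:R^-1 * p%:R ^+ 3) :> R.
Proof.
rewrite sqrtrM ?invr_ge0// sqrtrV// mulrC; congr (_ * _).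
by rewrite !exprS expr0 !mulr1 !sqrtrM.
Qed.

Lemma cvg_sqrt_rate (R : realType) (p : nat -> nat) :
  n%:R^-1 * (p n)%:R ^+ 3 @[n --> \oo] --> (0 : R) ->
  Num.sqrt (p n)%:R ^+ 3 / Num.sqrt n%:R @[n --> \oo] --> (0 : R).
Proof.
move=> h; under eq_fun do rewrite sqrt_rateE.
have : Num.sqrt (n%:R^-1 * (p n)%:R ^+ 3) @[n --> \oo] --> (Num.sqrt 0 : R).
  by apply: (cvg_comp _ _ h); exact: sqrt_continuous.
by rewrite sqrtr0.
Qed.

Lemma cvg_small_rate (R : realType) (p : nat -> nat) (K : R) :
  (\forall n \near \oo, (0 < p n)%N) ->
  n%:R^-1 * (p n)%:R ^+ 3 @[n --> \oo] --> (0 : R) ->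
  K * (Num.sqrt (p n)%:R / Num.sqrt n%:R) @[n --> \oo] --> (0 : R).
Proof.
move=> p0 /cvg_sqrt_rate h; suff : K * (Num.sqrt (p n)%:R / Num.sqrt n%:R)
    @[n --> \oo] --> K * 0 by rewrite mulr0.
apply: cvgMr; apply: (squeeze_cvgr _ (cvg_cst 0) h); near=> n.
rewrite divr_ge0 ?sqrtr_ge0//= ler_wpM2r ?invr_ge0 ?sqrtr_ge0//.
have P1 : 1 <= Num.sqrt (p n)%:R :> R.
  by rewrite -[leLHS]sqrtr1 ler_sqrt// ler1n; near: n.
exact: (ler_weXn2l P1 (isT : (1 <= 3)%N)).
Unshelve. all: by end_near. Qed.

Section Sample.
Context {R : realType} d (T : measurableType d) (P : probability T R) (n m p l : nat).
Variables (X : 'I_n -> 'M[R]_(m, p)) (Y : 'I_n -> 'I_m -> {RV P >-> R}).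
Variables (b0 : 'cV[R]_p) (R0 : 'M[R]_m).
Hypothesis Y_binary : forall i j w, Y i j w = 0 \/ Y i j w = 1.
Hypothesis Y_mean : forall i j, ('E_P[Y i j] = (gee_pi (X i) b0 j 0)%:E)%E.
Hypothesis Y_corr : forall i j k, correlation P (Y i j) (Y i k) = R0 j k.

Lemma responseE w i : (\col_j Y i j w : 'cV[R]_m) = bits_col (outcome Y w i).
Proof.
by apply/matrixP => j k; rewrite [LHS]mxE [RHS]mxE [outcome _ _ _]ffunE (bitsE Y_binary).
Qed.

Lemma correlation_sym : (0 < n)%N -> R0^T = R0.
Proof.
move=> n0; apply/matrixP => j k; rewrite mxE -!(Y_corr (Ordinal n0)) /correlation.
by rewrite covarianceC [Num.sqrt _ * _]mulrC.
Qed.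

Lemma cluster_mean i j :
  mexp (cluster_law Y) i (fun a => (a j)%:R - gee_pi (X i) b0 j 0) = 0.
Proof. exact: (mexp_bits_centred Y_binary (mean := fun j => gee_pi (X i) b0 j 0)). Qed.

Lemma cluster_cov i j k :
  mexp (cluster_law Y) i (fun a => ((a j)%:R - gee_pi (X i) b0 j 0) *
                                   ((a k)%:R - gee_pi (X i) b0 k 0)) =
  gee_sd (X i) b0 j * gee_sd (X i) b0 k * R0 j k.
Proof.
rewrite !gee_sdE; apply: (mexp_bits_cov Y_binary (mean := fun j => gee_pi (X i) b0 j 0)) => //.
by move=> j'; exact: gee_pi01.
Qed.

End Sample.

(** * The asymptotic law of the Wald statistic *)

Lemma with_prob_to1_setC (R : realType) (d : nat -> measure_display)
  (T : forall n, measurableType (d n)) (P : forall n, probability (T n) R)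
  (E : forall n, set (T n)) (e : R) : 0 < e ->
  (forall n, measurable (E n)) -> with_prob_to1 P E ->
  \forall n \near \oo, (P n (~` E n) <= e%:E)%E.
Proof.
move=> e0 mE h.
have h1 : fine (P n (E n)) @[n --> \oo] --> (1 : R) by apply: fine_cvg h.
move/cvgrPdist_le : h1 => /(_ _ e0); apply: filterS => n hn.
have fE : P n (E n) \is a fin_num by rewrite fin_num_measure.
rewrite probability_setC// -(fineK fE) -EFinB lee_fin.
exact: le_trans (ler_norm _) hn.
Qed.

Lemma markov_square (R : realType) (I A : finType) (q : I -> A -> R) (f : {ffun I -> A} -> R)
  (K e : R) : (forall i a, 0 <= q i a) ->
  0 < e -> (forall o, 0 <= f o) -> pexp q f <= K ->
  pprob q (fun o => (1 + `|K| / e) ^+ 2 <= f o) <= e.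
Proof.
move=> q0 e0 f0 fK; set B := 1 + `|K| / e.
have B1 : 1 <= B by rewrite lerDl divr_ge0// ltW.
have Bp : 0 < B ^+ 2 by rewrite exprn_gt0// (lt_le_trans ltr01).
apply: le_trans (markov_pprob q0 Bp f0) _.
rewrite ler_pdivrMr//; apply: le_trans fK _; apply: le_trans (ler_norm _) _.
apply: (@le_trans _ _ (e * B)).
  by rewrite /B mulrDr mulr1 mulrCA mulfV ?gt_eqF// mulr1 lerDr ltW.
by rewrite ler_pM2l// expr2 ler_peMl// (le_trans ler01).
Qed.

Theorem corollary3p11 (R : realType) (m l : nat) (p : nat -> nat)
  (d : nat -> measure_display) (T : forall n, measurableType (d n))
  (P : forall n, probability (T n) R)
  (* covariates, responses, parameter space and true parameter *)
  (X : forall n, 'I_n -> 'M[R]_(m, p n))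
  (Y : forall n, 'I_n -> 'I_m -> {RV (P n) >-> R})
  (B : forall n, set 'cV[R]_(p n))
  (beta0 : forall n, 'cV[R]_(p n))
  (* true correlation matrix, working correlation matrix and its limit *)
  (R0 : nat -> 'M[R]_m)
  (Rhat : forall n, T n -> 'M[R]_m)
  (Rbar : nat -> 'M[R]_m)
  (betahat : forall n, T n -> 'cV[R]_(p n))
  (L : forall n, 'M[R]_(l, p n))
  (p_infty : p @ \oo --> \oo)
  (* the model *)
  (Y_binary : forall n (i : 'I_n) (j : 'I_m) w, Y n i j w = 0 \/ Y n i j w = 1)
  (Y_indep : forall n, independent_vectors (P n) (fun i j => Y n i j : T n -> R))
  (Y_mean : forall n (i : 'I_n) (j : 'I_m),
    ('E_(P n)[Y n i j] = (gee_pi (X n i) (beta0 n) j 0)%:E)%E)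
  (Y_corr : forall n (i : 'I_n) (j k : 'I_m),
    correlation (P n) (Y n i j) (Y n i k) = R0 n j k)
  (Rhat_meas : forall n, measurable_mx (Rhat n))
  (Rhat_posdef : with_prob_to1 P (fun n => [set w | posdef (Rhat n w)]))
  (A1 : exists C : R, \forall n \near \oo, forall (i : 'I_n) (j : 'I_m),
    frobenius (row j (X n i)) <= C * Num.sqrt (p n)%:R)
  (A2_compact : forall n, compact (B n))
  (A2_interior : forall n, (B n)° (beta0 n))
  (A2_pi : exists b1 b2 : R, [/\ 0 < b1, b2 < 1 &
    \forall n \near \oo, forall (i : 'I_n) (j : 'I_m),
      b1 <= gee_pi (X n i) (beta0 n) j 0 <= b2])
  (A3 : exists b3 b4 : R, [/\ 0 < b3, 0 < b4 & \forall n \near \oo,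
    [/\ b3 <= lambda_min (n%:R^-1 *: \sum_i (X n i)^T *m X n i) &
        lambda_max (n%:R^-1 *: \sum_i (X n i)^T *m X n i) <= b4]])
  (A4_R0 : exists c1 c2 : R, [/\ 0 < c1, 0 < c2 & \forall n \near \oo,
    c1 <= lambda_min (R0 n) /\ lambda_max (R0 n) <= c2])
  (A4_Rbar_posdef : forall n, posdef (Rbar n))
  (A4_Rbar : exists c1 c2 : R, [/\ 0 < c1, 0 < c2 & \forall n \near \oo,
    c1 <= lambda_min (Rbar n) /\ lambda_max (Rbar n) <= c2])
  (A4_rate : bigOp P
    (fun n w => frobenius (invmx (Rhat n w) - invmx (Rbar n)))
    (fun n => Num.sqrt ((p n)%:R / n%:R)))
  (* the GEE estimator *)
  (betahat_meas : forall n, measurable_mx (betahat n))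
  (betahat_root : with_prob_to1 P (fun n => [set w |
    gee_S (X n) (fun i => \col_j Y n i j w) (Rhat n w) (betahat n w) = 0]))
  (betahat_rate : bigOp P
    (fun n w => frobenius (betahat n w - beta0 n))
    (fun n => Num.sqrt ((p n)%:R / n%:R)))
  (L_orth : \forall n \near \oo, L n *m (L n)^T = 1%:M)
  (p_rate : n%:R^-1 * (p n)%:R ^+ 3 @[n --> \oo] --> (0 : R))
  (* H_0 *)
  (H0 : \forall n \near \oo, L n *m beta0 n = 0) :
  cvg_in_distribution P
    (fun n w => gee_wald (X n) (fun i => \col_j Y n i j w) (Rhat n w)
                  (L n) (betahat n w))
    (chi_square l).
Proof.
move=> x Fx.
have [CX A1'] := A1.
have [b1 [b2 [b1p b2p A2']]] := A2_pi.
have [b3 [b4 [b3p _ A3']]] := A3.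
have [r [r' [rp _ AR0]]] := A4_R0.
have [c1 [c2 [c1p c2p ARb]]] := A4_Rbar.
have [KZ [Kt [Kw [Kw0 exp_ex]]]] :=
  @gee_wald_approx R m l CX b1 b2 b3 b4 c1 c2 r (And3 b1p b2p b3p) (And3 c1p c2p rp).
pose q n := @cluster_law R (d n) (T n) (P n) n m (Y n).
have q_ge0 n i a : 0 <= q n i a by exact: cluster_law_ge0 (Y_binary n) _ _.
have q_sum n i : \sum_a q n i a = 1 by exact: cluster_law_sum (Y_binary n) _.
have p_gt0 : \forall n \near \oo, (0 < p n)%N.
  by move/cvgnyPge : p_infty; exact.
(* at a large n, the hypotheses form a regular sample *)
have regular : \forall n \near \oo, regular_sample CX b1 b2 b3 b4 c1 c2 r
    (@X n) (Rbar n) (R0 n) (beta0 n) (L n) (@q n).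
  near=> n.
  have n0 : (0 < n)%N by near: n; exact: nbhs_infty_gt.
  have [h1 h2] : b3 <= lambda_min (n%:R^-1 *: \sum_i (X n i)^T *m X n i) /\
     lambda_max (n%:R^-1 *: \sum_i (X n i)^T *m X n i) <= b4.
    by near: n; apply: filterS A3' => n [].
  have [h3 h4] : c1 <= lambda_min (Rbar n) /\ lambda_max (Rbar n) <= c2.
    by near: n; exact: ARb.
  have [h5 _] : r <= lambda_min (R0 n) /\ lambda_max (R0 n) <= r'.
    by near: n; exact: AR0.
  split=> //.
  - by near: n; exact: p_gt0.
  - by near: n; exact: A1'.
  - by near: n; exact: A2'.
  - exact: (correlation_sym (@Y_corr n) n0).
  - by have [] := A4_Rbar_posdef n.
  - by near: n; exact: L_orth.
  - by near: n; exact: H0.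
  - exact: (cluster_mean (Y_binary n) (@Y_mean n)).
  - exact: (cluster_cov (Y_binary n) (@Y_mean n) (@Y_corr n)).
(* the directions are chosen for every n, arbitrarily when n is small *)
have zex n : exists zZ : ('I_l -> 'cV[R]_(p n)) *
      ({ffun 'I_n -> {ffun 'I_m -> bool}} -> R),
    regular_sample CX b1 b2 b3 b4 c1 c2 r (@X n) (Rbar n) (R0 n) (beta0 n) (L n) (@q n) ->
    wald_expansion KZ Kt Kw (@X n) (Rbar n) (beta0 n) (L n) (@q n) zZ.1 zZ.2.
  have [rg|nrg] := pselect (regular_sample CX b1 b2 b3 b4 c1 c2 r
    (@X n) (Rbar n) (R0 n) (beta0 n) (L n) (@q n)); last by exists (fun=> 0, fun=> 0).
  by have [z [Zf we]] := exp_ex _ _ _ _ _ _ _ _ rg; exists (z, Zf).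
pose z n := (sval (cid (zex n))).1; pose Zf n := (sval (cid (zex n))).2.
have we : \forall n \near \oo,
    wald_expansion KZ Kt Kw (@X n) (Rbar n) (beta0 n) (L n) (@q n) (z n) (Zf n).
  by apply: filterS regular => n; exact: (svalP (cid (zex n))).
pose f n a i y := gee_score (@X n i) (Rbar n) (beta0 n) (bits_col y) (z n a).
pose V n w := @array_sqnorm R _ l f n (outcome (@Y n) w).
have mr n (U : T n -> R) (c : R) : measurable_fun setT U -> measurable [set w | c < U w].
  move=> mU; rewrite (_ : [set w | _] = U @^-1` `]c, +oo[).
    by rewrite -[X in measurable X]setTI; exact: mU.
  by apply/seteqP; split => w /=; rewrite in_itv/= andbT.
have mY n (i : 'I_n) : measurable_mx (fun w => \col_j Y n i j w : 'cV[R]_m).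
  by move=> j k; under eq_fun do rewrite mxE; exact: measurable_funPT.
have rateE n : Num.sqrt ((p n)%:R / n%:R) = Num.sqrt (p n)%:R / Num.sqrt n%:R :> R.
  by rewrite sqrtrM// sqrtrV.
apply: (@slutsky_cdf R d T P (fun n w => gee_wald (@X n) (fun i => \col_j Y n i j w)
  (Rhat n w) (L n) (betahat n w)) V (chi_cdf l) x) => //.
- move=> n y; have mW := measurable_gee_wald (@X n) (mY n) (Rhat_meas n) (betahat_meas n) (L n).
  rewrite (_ : [set w | _] = (fun w => gee_wald (@X n) (fun i => \col_j Y n i j w)
     (Rhat n w) (L n) (betahat n w)) @^-1` `]-oo, y]).
    by rewrite -[X in measurable X]setTI; exact: mW.
  by apply/seteqP; split => w /=; rewrite in_itv.
- move=> n y; exact: (measurable_outcome_pred (Y_binary n) (fun o => @array_sqnorm R _ l f n o <= y)).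
- by have [] := chi_cdf_props (R := R) l.
- move=> eta e eta0 e0; have e4 : 0 < e / 4 by rewrite divr_gt0.
  have [K1 K1p rate1] := betahat_rate _ e4.
  have [K2 K2p rate2] := A4_rate _ e4.
  pose K := K1 + K2; have K0 : 0 < K by rewrite addr_gt0.
  (* four bad events of probability at most e / 4 each: the two rates, the failure
     of the estimating equation, and large random sums *)
  pose Bd := 1 + `|KZ| / (e / 4).
  have B1 : 1 <= Bd by rewrite lerDl divr_ge0// ltW.
  have mroot n : measurable [set w |
      gee_S (@X n) (fun i => \col_j Y n i j w) (Rhat n w) (betahat n w) = 0].
    have mS := measurable_gee_S (@X n) (mY n) (Rhat_meas n) (betahat_meas n).
    rewrite (_ : [set w | _] = \bigcap_(c in [set: 'I_(p n)])
      ((fun w => gee_S (@X n) (fun i => \col_j Y n i j w) (Rhat n w) (betahat n w) c 0)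
        @^-1` [set 0])).
      apply: fin_bigcap_measurable => // c _.
      by rewrite -[X in measurable X]setTI; exact: mS.
    apply/seteqP; split => [w Sw c _|w Sw /=].
      by apply: etrans (congr1 (fun v : 'cV[R]_(p n) => v c 0) Sw) _; rewrite /= mxE.
    by apply/matrixP => c k; rewrite ord1 mxE; exact: Sw.
  have root := with_prob_to1_setC e4 mroot betahat_root.
  have rate : (Kw Bd K * (Num.sqrt (p n)%:R ^+ 3 / Num.sqrt n%:R)) @[n --> \oo] --> (0 : R).
    suff : (Kw Bd K * (Num.sqrt (p n)%:R ^+ 3 / Num.sqrt n%:R)) @[n --> \oo]
        --> Kw Bd K * 0 by rewrite mulr0.
    by apply: cvgMr; exact: cvg_sqrt_rate.
  move/cvgr0Pnorm_le : rate => rate.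
  have m01 : 0 < Num.min 1 eta by rewrite lt_min ltr01.
  near=> n.
  have wen : wald_expansion KZ Kt Kw (@X n) (Rbar n) (beta0 n) (L n) (@q n) (z n) (Zf n).
    by near: n; exact: we.
  have small : `|Kw Bd K * (Num.sqrt (p n)%:R ^+ 3 / Num.sqrt n%:R)| <= Num.min 1 eta.
    by near: n; exact: rate.
  have small1 := le_trans (ler_norm _) small; rewrite le_min in small1.
  have /andP[s1 s2] := small1.
  have pN1 : (P n [set w | K1 * Num.sqrt ((p n)%:R / n%:R) <
      `|frobenius (betahat n w - beta0 n)|]%R <= (e/4)%:E)%E by near: n; exact: rate1.
  have pN2 : (P n [set w | K2 * Num.sqrt ((p n)%:R / n%:R) <
      `|frobenius (invmx (Rhat n w) - invmx (Rbar n))|]%R <= (e/4)%:E)%E.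
    by near: n; exact: rate2.
  have pN3 : (P n (~` [set w | gee_S (@X n) (fun i => \col_j Y n i j w) (Rhat n w)
      (betahat n w) = 0%R]) <= (e/4)%:E)%E by near: n; exact: root.
  pose N1 := [set w | (K1 * Num.sqrt ((p n)%:R / n%:R) < `|frobenius (betahat n w - beta0 n)|)%R].
  pose N2 := [set w | (K2 * Num.sqrt ((p n)%:R / n%:R)
      < `|frobenius (invmx (Rhat n w) - invmx (Rbar n))|)%R].
  pose N3 := ~` [set w | gee_S (@X n) (fun i => \col_j Y n i j w) (Rhat n w) (betahat n w) = 0].
  rewrite -/N1 in pN1; rewrite -/N2 in pN2; rewrite -/N3 in pN3.
  pose N4 := [set w | Bd ^+ 2 <= Zf n (outcome (@Y n) w)].
  have mN1 : measurable N1.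
    apply: mr; apply: measurableT_comp => //; apply: measurable_frobenius.
    by apply: measurable_mx_sub => //; exact: measurable_mx_cst.
  have mN2 : measurable N2.
    apply: mr; apply: measurableT_comp => //; apply: measurable_frobenius.
    by apply: measurable_mx_sub; [exact: measurable_mx_inv|exact: measurable_mx_cst].
  have mN3 : measurable N3 by apply: measurableC; exact: mroot.
  have mN4 : measurable N4.
    exact: (measurable_outcome_pred (Y_binary n) (fun o => Bd ^+ 2 <= Zf n o)).
  exists ((N1 `|` N2) `|` (N3 `|` N4)); split.
  + by do ?apply: measurableU.
  + have pN4 : (P n N4 <= (e/4)%:E)%E.
      rewrite (prob_outcome (Y_binary n) (@Y_indep n) (fun o => Bd ^+ 2 <= Zf n o)) lee_fin.
      exact: (markov_square (q_ge0 n) e4 (we_ge0 wen) (we_mean wen)).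
    have -> : e%:E = ((e/4)%:E + (e/4)%:E + ((e/4)%:E + (e/4)%:E))%E.
      by rewrite -!EFinD; congr EFin; lra.
    apply: le_trans (measureU2 _ _ _) _; [exact: measurableU|exact: measurableU|].
    by apply: leeD; apply: le_trans (measureU2 _ _ _) _ => //; exact: leeD.
  + move=> w /not_orP[/not_orP[w1 w2] /not_orP[w3 w4]].
    have {w3} Sw : gee_S (@X n) (fun i => \col_j Y n i j w) (Rhat n w) (betahat n w) = 0.
      by apply: contrapT.
    have {w4} Zw : Zf n (outcome (@Y n) w) <= Bd ^+ 2.
      by rewrite leNgt; apply/negP => h; apply: w4; exact: ltW.
    have r0 : 0 <= Num.sqrt (p n)%:R / Num.sqrt n%:R :> R by rewrite divr_ge0 ?sqrtr_ge0.
    have bw : vnorm (betahat n w - beta0 n) <= K * (Num.sqrt (p n)%:R / Num.sqrt n%:R).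
      rewrite -frobenius_vnorm; apply: le_trans (ler_norm _) _.
      apply: (@le_trans _ _ (K1 * (Num.sqrt (p n)%:R / Num.sqrt n%:R))).
        by rewrite -rateE leNgt; apply/negP.
      by rewrite ler_wpM2r// /K lerDl ltW.
    have Qw : frobenius (invmx (Rhat n w) - invmx (Rbar n))
        <= K * (Num.sqrt (p n)%:R / Num.sqrt n%:R).
      apply: le_trans (ler_norm _) _.
      apply: (@le_trans _ _ (K2 * (Num.sqrt (p n)%:R / Num.sqrt n%:R))).
        by rewrite -rateE leNgt; apply/negP.
      by rewrite ler_wpM2r// /K lerDr ltW.
    have YE : (fun i => \col_j Y n i j w : 'cV[R]_m) = (fun i => bits_col (outcome (@Y n) w i)).
      by apply/funext => i; exact: responseE (Y_binary n) _ _.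
    have bE : betahat n w = beta0 n + (betahat n w - beta0 n) by rewrite addrC subrK.
    move: Sw; rewrite YE bE => Sw; move: Sw bw; set delta := betahat n w - beta0 n => Sw bw.
    by apply: le_trans (we_close wen B1 K0 Zw bw Qw Sw s1) s2.
- move=> y eta e eta0 e0.
  have cent : \forall n \near \oo, forall a (i : 'I_n), mexp (@q n) i (@f n a i) = 0.
    apply: nearW => n a i; apply: mexp_score0 => j.
    exact: (cluster_mean (Y_binary n) (@Y_mean n) i j).
  have cov : \forall n \near \oo, forall a b : 'I_l,
      \sum_(i < n) mexp (@q n) i (fun y => @f n a i y * @f n b i y) = (a == b)%:R.
    by apply: filterS we => n wen; exact: we_cov wen.
  have smallf : \forall n \near \oo, forall a (i : 'I_n) y,
      `|@f n a i y| <= Kt * (Num.sqrt (p n)%:R / Num.sqrt n%:R).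
    by apply: filterS we => n wen; exact: we_small wen.
  have := array_sqnorm_cdf q_ge0 q_sum cent cov smallf (cvg_small_rate Kt p_gt0 p_rate) y eta0 e0.
  apply: filterS => n.
  have pO t := prob_outcome (Y_binary n) (@Y_indep n) (fun o => @array_sqnorm R _ l f n o <= t).
  by rewrite /V !pO EFinD.
Unshelve. all: by end_near. Qed.
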